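(* Let $\Lambda$ be a finite, strongly connected $k$-graph with adjacency matrices $A_1,\dots,A_k$, and suppose that $A=A_1\cdots A_k$ is irreducible. Let $\delta\in(0,1)$ and suppose that $w_\delta$ is a weight satisfying $w_\delta(\lambda)=\operatorname{diam}[\lambda]$ for all $\lambda\in F\mathcal B_\Lambda$. Let $\tau$ be a choice function. Then for any $f\in C(X_{\mathcal B_\Lambda})$, the operator $\pi_\tau(f)|D|^{-\delta}$ is measurable in the sense of Connes and its Dixmier trace is $$\lim_{s\searrow1}(s-1)\operatorname{Tr}(\pi_\tau(f)|D|^{-\delta s})=\mathcal T(|D|^{-\delta})\int_{X_{\mathcal B_\Lambda}}f\,dM.$$
   Context: $\mathbb N=\{0,1,2,\dots\}$. A $k$-graph ($k\ge 1$) is a countable small category $\Lambda$ with a functor $d:\Lambda\to\mathbb N^k$ ($\mathbb N^k$ viewed as a one-object category under addition) such that whenever $d(\lambda)=m+n$ there are unique $\mu,\nu\in\Lambda$ with $d(\mu)=m$, $d(\nu)=n$, $\lambda=\mu\nu$. Here $\lambda\in\Lambda$ means $\lambda$ is a morphism; $\Lambda^n=d^{-1}(n)$; $\Lambda^0$ is identified with the objects (vertices); $r,s:\Lambda\to\Lambda^0$ are range and source. $\Lambda$ is finite if every $\Lambda^n$ is finite, and strongly connected if for all $v,w\in\Lambda^0$ there is $\lambda\in\Lambda$ with $r(\lambda)=v$, $s(\lambda)=w$. With $e_i$ the standard basis of $\mathbb N^k$, the adjacency matrices are $A_i(v,w)=\#\{\lambda\in\Lambda^{e_i}: r(\lambda)=v,\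 s(\lambda)=w\}$; $\rho_i$ is the spectral radius of $A_i$. For $\Lambda$ finite and strongly connected, $x^\Lambda\in(0,\infty)^{\Lambda^0}$ is the unique positive vector with $\sum_v x^\Lambda_v=1$ and $A_ix^\Lambda=\rho_ix^\Lambda$ for $1\le i\le k$. The stationary $k$-Bratteli diagram $\mathcal B_\Lambda$ has vertex set $\bigsqcup_{n\ge0}\mathcal V_n$, each $\mathcal V_n$ a copy of $\Lambda^0$, and edge set $\bigsqcup_{n\ge1}\mathcal E_n$, where for $n\equiv i \pmod k$, $1\le i\le k$, $\mathcal E_n$ contains exactly $A_i(p,q)$ edges with range $p\in\mathcal V_{n-1}$ and source $q\in\mathcal V_n$. $F\mathcal B_\Lambda$ is the set of finite paths $\eta=\eta_1\cdots\eta_m$ ($\eta_i\in\mathcal E_i$, $s(\eta_i)=r(\eta_{i+1})$), of length $|\eta|=m$; vertices in $\mathcal V_0$ are the paths of length $0$. $X_{\mathcal B_\Lambda}$ is the set of infinite paths $(x_n)_{n\ge1}$, $x_n\in\mathcal E_n$, $s(x_n)=r(x_{n+1})$, with the topology generated by the cylinder sets $[\lambda]$ = set of infinite paths with initial segment $\lambda\in F\mathcal B_\Lambda$. The measure $M$ (an Huef–Laca–Raeburn–Sims) is the Borel probability measure on $X_{\mathcal B_\Lambda}$ determined by $M([\lambda])=(\rho_1\cdots\rho_t)^{-(q+1)}(\rho_{t+1}\cdots\rho_k)^{-q}x^\Lambda_{s(\lambda)}$ for $\lambda\in F\mathcal B_\Lambda$ with $|\lambda|=qk+t$, $0\le t\le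 k-1$. A weight is a function $w:F\mathcal B_\Lambda\to(0,\infty)$ with $\sum_{v\in\mathcal V_0}w(v)\le1$, $\lim_{n}\sup\{w(\lambda):|\lambda|=n\}=0$, and $w(\lambda)<w(\eta)$ whenever $\eta$ is a proper initial segment of $\lambda$. For $\delta\in(0,1)$ and $|\eta|=qk+t$ with $q\in\mathbb N$, $0\le t\le k-1$, $$w_\delta(\eta)=\big(\rho_1^{q+1}\cdots\rho_t^{q+1}\rho_{t+1}^q\cdots\rho_k^q\big)^{-1/\delta}x^\Lambda_{s(\eta)}.$$ For $x\ne y$ in $X_{\mathcal B_\Lambda}$, $x\wedge y$ is the longest common initial segment in $F\mathcal B_\Lambda$ ($\emptyset$ if $r(x)\neq r(y)$); $d_\delta(x,y)=w_\delta(x\wedge y)$ if $x\wedge y\ne\emptyset$, $d_\delta(x,y)=1$ if $x\wedge y=\emptyset$, and $d_\delta(x,x)=0$; $\operatorname{diam}[\lambda]=\sup\{d_\delta(x,y):x,y\in[\lambda]\}$. Under the hypotheses of the claim, $X_{\mathcal B_\Lambda}$ is a Cantor set and $d_\delta$ is an ultrametric inducing its topology. A choice function is a map $\tau=(\tau_+,\tau_-):F\mathcal B_\Lambda\to X_{\mathcal B_\Lambda}\times X_{\mathcal B_\Lambda}$ with $\tau(\gamma)\in[\gamma]\times[\gamma]$ and $d_\delta(\tau_+(\gamma),\tau_-(\gamma))=\operatorname{diam}[\gamma]$. On $\mathcal H=\ell^2(F\mathcal B_\Lambda,\mathbb C^2)$, for $f\in C(X_{\mathcal B_\Lambda})$,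 put $\pi_\tau(f)=\bigoplus_\gamma\mathrm{diag}(f(\tau_+(\gamma)),f(\tau_-(\gamma)))$ and $D=\bigoplus_\gamma\frac1{\operatorname{diam}[\gamma]}\begin{pmatrix}0&1\\1&0\end{pmatrix}$; then $|D|^{-1}$ is multiplication by $\operatorname{diam}[\gamma]$ on the $\gamma$-summand. Let $\sigma_0(T)\ge\sigma_1(T)\ge\cdots$ be the singular values of a compact operator $T$ on a separable Hilbert space, with multiplicity. The Dixmier–Macaev ideal $\mathcal M_{1,\infty}$ consists of the compact $T$ with $\limsup_n\frac1{\ln n}\sum_{j=1}^n\sigma_j(T)<\infty$. For a (dilation-invariant) generalized limit $\omega$ on $\ell^\infty(\mathbb N)$ (a state vanishing on $c_0$), the Dixmier trace $\mathcal T_\omega$ is the linear functional on $\mathcal M_{1,\infty}$ given on positive $T$ by $\mathcal T_\omega(T)=\omega\big(\big(\frac1{\ln(2+n)}\sum_{j\le n}\sigma_j(T)\big)_n\big)$. $T\in\mathcal M_{1,\infty}$ is measurable in the sense of Connes if $\mathcal T_\omega(T)$ is the same for all such $\omega$; the common value is denoted $\mathcal T(T)$ and called its Dixmier trace. For positive $T$, Connes measurability is equivalent to existence and finiteness of $\lim_{s\searrow1}(s-1)\operatorname{Tr}(T^s)$, and then $\mathcal T(T)$ equals this limit; in particular $\mathcal T(|D|^{-\delta})=\lim_{s\searrow1}(s-1)\operatorname{Tr}(|D|^{-\delta s})$. *)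

(* Defs.v *)
From HB Require Import structures.
From mathcomp Require Import all_boot all_order all_algebra.
From mathcomp Require Import finmap.
From mathcomp Require Import all_classical all_reals all_analysis.
From mathcomp Require Import complex.
From mathcomp Require Import ring.

Set Implicit Arguments.
Unset Strict Implicit.
Unset Printing Implicit Defensive.

Import Order.TTheory GRing.Theory Num.Theory.
Import numFieldNormedType.Exports.
Import Normc.

Local Open Scope classical_set_scope.
Local Open Scope ring_scope.
Local Open Scope complex_scope.

(* The category is given by its type [V] of objects and its countable type of
   all morphisms.  [kg_comp a b] is the composite "a after b"; it is a total
   function whose value is meaningful only when [kg_src a = kg_rng b]. *)
Record kgraph (k : nat) (V : Type) := KGraph {
  kg_mor :> countType;
  kg_rng : kg_mor -> V;
  kg_src : kg_mor -> V;
  kg_id : V -> kg_mor;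
  kg_comp : kg_mor -> kg_mor -> kg_mor;
  kg_deg : kg_mor -> {ffun 'I_k -> nat};
  rank_gt0 : (0 < k)%N;
  rng_idm : forall v, kg_rng (kg_id v) = v;
  src_idm : forall v, kg_src (kg_id v) = v;
  rng_comp : forall a b, kg_src a = kg_rng b -> kg_rng (kg_comp a b) = kg_rng a;
  src_comp : forall a b, kg_src a = kg_rng b -> kg_src (kg_comp a b) = kg_src b;
  comp_idl : forall a, kg_comp (kg_id (kg_rng a)) a = a;
  comp_idr : forall a, kg_comp a (kg_id (kg_src a)) = a;
  comp_assoc : forall a b c, kg_src a = kg_rng b -> kg_src b = kg_rng c ->
    kg_comp a (kg_comp b c) = kg_comp (kg_comp a b) c;
  deg_idm : forall v, kg_deg (kg_id v) = 0;
  deg_comp : forall a b, kg_src a = kg_rng b -> kg_deg (kg_comp a b) = kg_deg a + kg_deg b;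
  factorization : forall l m n, kg_deg l = m + n ->
    exists! ab : kg_mor * kg_mor,
      [/\ kg_src ab.1 = kg_rng ab.2, kg_deg ab.1 = m, kg_deg ab.2 = n
        & kg_comp ab.1 ab.2 = l] }.

Arguments rank_gt0 {k V} _.

Definition kg_finite k V (L : kgraph k V) : Prop :=
  forall n : {ffun 'I_k -> nat}, finite_set [set l : L | kg_deg l = n].

Definition kg_strongly_connected k V (L : kgraph k V) : Prop :=
  forall v w : V, exists l : L, kg_rng l = v /\ kg_src l = w.

Definition basis_vec k (i : 'I_k) : {ffun 'I_k -> nat} :=
  [ffun j => nat_of_bool (j == i)].

(* [fset_set] is the underlying finite set of a finite set, so that [adj] is
   the intended cardinal as soon as [kg_finite L]. *)
Definition adj k V (L : kgraph k V) (i : 'I_k) (v w : V) : nat :=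
  #|` fset_set [set l : L | [/\ kg_deg l = basis_vec i, kg_rng l = v & kg_src l = w]] |.

Definition adjmx (R : realType) k (V : finType) (L : kgraph k V) (i : 'I_k) :
    'M[R]_#|V| :=
  \matrix_(a, b) (adj L i (enum_val a) (enum_val b))%:R.

Definition irreducible_mx (R : realType) n (A : 'M[R]_n) : Prop :=
  forall a b, exists2 m, (0 < m)%N & 0 < (A ^+ m) a b.

Definition spectral_radius (R : realType) n (A : 'M[R]_n) : R :=
  sup [set normc z | z in
        [set z : R[i] | eigenvalue (map_mx (fun t : R => t%:C) A) z]].

Definition rho (R : realType) k (V : finType) (L : kgraph k V) (i : 'I_k) : R :=
  spectral_radius (adjmx R L i).

Definition is_perron_vector (R : realType) k (V : finType) (L : kgraph k V)
    (x : V -> R) : Prop :=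
  [/\ forall v, 0 < x v,
      \sum_v x v = 1
    & forall i v, \sum_w (adj L i v w)%:R * x w = rho R L i * x v].

(* An edge of colour [i] with range [p] and source [q], for the colour [i]
   adjacency matrix.  As the diagram is stationary, the edge sets E_n are
   identified with the edges of colour [n.-1 %% k]; colours, and the positions
   of the edges of a path, are numbered from 0. *)
Definition bedge k (V : finType) (L : kgraph k V) : Type :=
  {c : 'I_k * V * V & 'I_(adj L c.1.1 c.1.2 c.2)}.
HB.instance Definition _ k (V : finType) (L : kgraph k V) :=
  Finite.on (bedge L).

Definition ecol k (V : finType) (L : kgraph k V) (e : bedge L) : 'I_k :=
  (tag e).1.1.
Definition erng k (V : finType) (L : kgraph k V) (e : bedge L) : V :=
  (tag e).1.2.
Definition esrc k (V : finType) (L : kgraph k V) (e : bedge L) : V :=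
  (tag e).2.

(* [bchain n v es]: [es] is a path starting (i.e. with range) at the vertex [v]
   of level [n]. *)
Fixpoint bchain k (V : finType) (L : kgraph k V) (n : nat) (v : V)
    (es : seq (bedge L)) : bool :=
  if es is e :: es' then
    [&& ecol e == (n %% k)%N :> nat, erng e == v & bchain n.+1 (esrc e) es']
  else true.

(* A finite path is recorded as its range together with its list of edges, so
   that the paths of length 0 are the vertices of level 0. *)
Definition bpath k (V : finType) (L : kgraph k V) : Type :=
  {p : V * seq (bedge L) | bchain 0 p.1 p.2}.
HB.instance Definition _ k (V : finType) (L : kgraph k V) :=
  Countable.on (bpath L).

Definition pedges k (V : finType) (L : kgraph k V) (p : bpath L) :=
  (val p).2.
Definition plen k (V : finType) (L : kgraph k V) (p : bpath L) : nat :=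
  size (pedges p).
Definition prng k (V : finType) (L : kgraph k V) (p : bpath L) : V :=
  (val p).1.
Definition psrc k (V : finType) (L : kgraph k V) (p : bpath L) : V :=
  last (prng p) [seq esrc e | e <- pedges p].
Definition vpath k (V : finType) (L : kgraph k V) (v : V) : bpath L :=
  exist _ (v, [::]) isT.

Definition initial_segment k (V : finType) (L : kgraph k V) (p q : bpath L) :
    bool :=
  (prng p == prng q) && prefix (pedges p) (pedges q).

Definition ipath k (V : finType) (L : kgraph k V) : Type :=
  {x : nat -> bedge L |
    `[< forall n, ecol (x n) = (n %% k)%N :> nat /\ esrc (x n) = erng (x n.+1) >]}.
HB.instance Definition _ k (V : finType) (L : kgraph k V) :=
  Choice.on (ipath L).

Definition iedge k (V : finType) (L : kgraph k V) (x : ipath L) (n : nat) :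
  bedge L := val x n.
Definition irng k (V : finType) (L : kgraph k V) (x : ipath L) : V :=
  erng (iedge x 0).

Lemma chain_iedge k (V : finType) (L : kgraph k V) (x : ipath L) (m n : nat) :
  bchain m (erng (iedge x m)) [seq iedge x i | i <- iota m n].
Proof.
elim: n m => //= n IH m; have /asboolP/(_ m)[cx sx] := valP x.
by rewrite /iedge cx !eqxx /= sx; exact: IH.
Qed.

Definition iprefix k (V : finType) (L : kgraph k V) (x : ipath L) (n : nat) :
    bpath L :=
  exist _ (irng x, mkseq (iedge x) n) (chain_iedge x 0 n).

Definition cylinder k (V : finType) (L : kgraph k V) (p : bpath L) :
    set (ipath L) :=
  [set x | iprefix x (plen p) = p].

HB.instance Definition _ k (V : finType) (L : kgraph k V) :=
  @isSubBaseTopological.Build (ipath L) (set (ipath L)) (range (@cylinder k V L)) id.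

(* The Borel space of infinite paths.  Measurable types of the library are
   pointed, whence the base point, on which nothing else depends. *)
Definition borel_ipath k (V : finType) (L : kgraph k V) (x0 : ipath L) : Type :=
  ipath L.
HB.instance Definition _ k (V : finType) (L : kgraph k V) (x0 : ipath L) :=
  Choice.on (borel_ipath x0).
HB.instance Definition _ k (V : finType) (L : kgraph k V) (x0 : ipath L) :=
  isPointed.Build (borel_ipath x0) x0.
HB.instance Definition _ k (V : finType) (L : kgraph k V) (x0 : ipath L) :=
  Measurable.copy (borel_ipath x0)
    (g_sigma_algebraType (open : set (set (borel_ipath x0)))).

(* [rho_1 ^ (q+1) ... rho_t ^ (q+1) rho_(t+1) ^ q ... rho_k ^ q] for
   [m = q k + t] with [t < k]. *)
Definition rho_pow (R : realType) k (V : finType) (L : kgraph k V) (m : nat) :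
    R :=
  \prod_(i < k) rho R L i ^+ (m %/ k + (i < m %% k)%N)%N.

(* Finite measures agreeing on the cylinders coincide, so this determines
   [M]. *)
Definition is_path_measure (R : realType) k (V : finType) (L : kgraph k V)
    (x : V -> R) (M : set (ipath L) -> \bar R) : Prop :=
  forall p : bpath L,
    M (cylinder p) = ((rho_pow R L (plen p))^-1 * x (psrc p))%:E.

Definition is_weight (R : realType) k (V : finType) (L : kgraph k V)
    (w : bpath L -> R) : Prop :=
  [/\ forall p, 0 < w p,
      \sum_v w (vpath L v) <= 1,
      (fun n => sup [set w p | p in [set p | plen p = n]]) @ \oo --> (0 : R)
    & forall p q, initial_segment q p -> q != p -> w p < w q].

Definition w_delta (R : realType) k (V : finType) (L : kgraph k V)
    (x : V -> R) (delta : R) (p : bpath L) : R :=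
  rho_pow R L (plen p) `^ (- delta^-1) * x (psrc p).
Arguments w_delta {R k V} L x delta p.

(* The number of common leading edges of two distinct infinite paths. *)
Definition agree k (V : finType) (L : kgraph k V) (x y : ipath L) : nat :=
  if pselect (exists n, iedge x n != iedge y n) is left ex then ex_minn ex
  else 0.

(* The longest common initial segment of two distinct infinite paths; [None]
   stands for the empty path. *)
Definition meet_path k (V : finType) (L : kgraph k V) (x y : ipath L) :
    option (bpath L) :=
  if irng x == irng y then Some (iprefix x (agree x y)) else None.

Definition pdist (R : realType) k (V : finType) (L : kgraph k V)
    (w : bpath L -> R) (x y : ipath L) : R :=
  if x == y then 0 else if meet_path x y is Some p then w p else 1.

Definition diam (R : realType) k (V : finType) (L : kgraph k V)
    (w : bpath L -> R) (p : bpath L) : R :=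
  sup [set d | exists x y,
        [/\ cylinder p x, cylinder p y & d = pdist w x y]].

Definition is_choice (R : realType) k (V : finType) (L : kgraph k V)
    (w : bpath L -> R) (tau : bpath L -> ipath L * ipath L) : Prop :=
  forall p, [/\ cylinder p (tau p).1, cylinder p (tau p).2
              & pdist w (tau p).1 (tau p).2 = diam w p].

Definition square_summable (R : realType) (J : choiceType) : {pred J -> R[i]} :=
  fun a => `[< summable setT (fun j => (normc (a j) ^+ 2)%:E) >].

Lemma summable_scale (R : realType) (J : choiceType) (c : R) (u : J -> R) :
  0 <= c -> (forall j, 0 <= u j) ->
  summable setT (fun j => (u j)%:E) -> summable setT (fun j => (c * u j)%:E).
Proof.
move=> c0 u0 su.
have ub : (\esum_(j in setT) (c * u j)%:E <= c%:E * \esum_(j in setT) (u j)%:E)%E.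
  apply: ge_ereal_sup => _ [F finF <-].
  under eq_fsbigr do rewrite EFinM.
  rewrite -ge0_mule_fsumr; last by move=> j; rewrite lee_fin.
  by rewrite lee_wpmul2l ?lee_fin//; apply: ereal_sup_ubound; exists F.
rewrite /summable (_ : (fun=> _) = fun j => (c * u j)%:E); last first.
  by apply/funext => j; rewrite gee0_abs// lee_fin mulr_ge0.
apply: (le_lt_trans ub); rewrite lte_mul_pinfty ?lee_fin//.
move: su; rewrite /summable (_ : (fun=> _) = fun j => (u j)%:E)//.
by apply/funext => j; rewrite gee0_abs// lee_fin.
Qed.

Lemma normc_comb_sqr (R : realType) (c z t : R[i]) :
  normc (c * z + t) ^+ 2 <=
  normc c ^+ 2 *+ 2 * normc z ^+ 2 + 2 * normc t ^+ 2.
Proof.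
have : normc (c * z + t) <= normc c * normc z + normc t.
  by rewrite -normcM; exact: le_normcD.
have n0 (y : R[i]) : 0 <= normc y by case: y => p q; exact: sqrtr_ge0.
move: (n0 (c * z + t)) (n0 c) (n0 z) (n0 t).
move: (normc _) (normc c) (normc z) (normc t) => n x y w n_ge0 x0 y0 w0 h.
apply: (@le_trans _ _ ((x * y + w) ^+ 2)).
  by rewrite ler_pXn2r// nnegrE addr_ge0// mulr_ge0.
rewrite -subr_ge0; set e := (X in _ <= X).
have -> : e = (x * y - w) ^+ 2 by rewrite /e; ring.
exact: sqr_ge0.
Qed.

Lemma square_summable_submod (R : realType) (J : choiceType) :
  submod_closed (@square_summable R J).
Proof.
split.
  apply/asboolP; rewrite /summable (_ : (fun=> _) = fun=> 0%E) ?esum1//.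
  by apply/funext => j; rewrite normc0 expr0n abse0.
move=> c a b /asboolP sa /asboolP sb; apply/asboolP.
have sqr_sum z (d : J -> R[i]) : 0 <= z ->
    summable setT (fun j => (normc (d j) ^+ 2)%:E) ->
    summable setT (fun j => (z * normc (d j) ^+ 2)%:E).
  by move=> z0; apply: summable_scale => // j; exact: sqr_ge0.
have := summableD (sqr_sum (normc c ^+ 2 *+ 2) a _ sa) (sqr_sum 2 b _ sb).
rewrite mulrn_wge0 ?sqr_ge0// ler0n => /(_ isT isT).
apply: le_lt_trans; apply: le_esum => j _ /=.
rewrite lee_fin !ger0_norm ?sqr_ge0//; first exact: normc_comb_sqr.
by rewrite addr_ge0// mulr_ge0 ?sqr_ge0// mulrn_wge0// sqr_ge0.
Qed.

HB.instance Definition _ (R : realType) (J : choiceType) :=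
  GRing.isSubmodClosed.Build R[i] (J -> R[i]) (@square_summable R J)
    (@square_summable_submod R J).

(* The space of square-summable families; l2(J, C^2) is [lsq R (J * bool)]. *)
Definition lsq (R : realType) (J : choiceType) : Type :=
  {a : J -> R[i] | square_summable a}.
HB.instance Definition _ (R : realType) (J : choiceType) :=
  SubChoice.on (lsq R J).
HB.instance Definition _ (R : realType) (J : choiceType) :=
  [SubChoice_isSubLmodule of lsq R J by <:].

Definition rsum (R : realType) (J : choiceType) (u : J -> R) : R :=
  fine (\esum_(j in setT) (Num.max (u j) 0)%:E) -
  fine (\esum_(j in setT) (Num.max (- u j) 0)%:E).

(* The sum of an absolutely summable family of complex numbers. *)
Definition csum (R : realType) (J : choiceType) (u : J -> R[i]) : R[i] :=
  rsum (fun j => complex.Re (u j)) +i* rsum (fun j => complex.Im (u j)).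

Definition l2inner (R : realType) (J : choiceType) (a b : lsq R J) : R[i] :=
  csum (fun j => val a j * conjc (val b j)).

Definition l2norm (R : realType) (J : choiceType) (a : lsq R J) : R :=
  Num.sqrt (fine (\esum_(j in setT) (normc (val a j) ^+ 2)%:E)).

Definition l2basis (R : realType) (J : choiceType) (j : J) : lsq R J :=
  insubd 0 (fun i => (i == j)%:R : R[i]).

(* Multiplication by [m].  For bounded [m] the product is always square
   summable; the value [0] of [insubd] is used only when it is not. *)
Definition mulop (R : realType) (J : choiceType) (m : J -> R[i])
    (a : lsq R J) : lsq R J :=
  insubd 0 (fun j => m j * val a j).

Definition positive_op (R : realType) (J : choiceType) (T : lsq R J -> lsq R J)
    : Prop :=
  forall a, 0 <= l2inner (T a) a.

Definition is_adjoint (R : realType) (J : choiceType)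
    (T S : lsq R J -> lsq R J) : Prop :=
  forall a b, l2inner (T a) b = l2inner a (S b).

(* The image of the unit ball is totally bounded, which in the complete space
   l2 means relatively compact. *)
Definition compact_op (R : realType) (J : choiceType) (T : lsq R J -> lsq R J)
    : Prop :=
  linear T /\
  forall e : R, 0 < e -> exists F : seq (lsq R J),
    forall a, l2norm a <= 1 -> exists2 b, b \in F & l2norm (T a - b) < e.

(* [s] lists in nonincreasing order, with multiplicity, the singular values of
   the compact operator [T], that is the square roots of the eigenvalues of
   T^* T: the nonzero ones come with an orthonormal family of eigenvectors
   whose orthogonal complement is the kernel of [T].  If [T] has finite rank
   then the list is completed by zeros. *)
Definition singular_values (R : realType) (J : choiceType)
    (T : lsq R J -> lsq R J) (s : nat -> R) : Prop :=
  [/\ forall n, 0 <= s n,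
      forall m n, (m <= n)%N -> s n <= s m
    & exists (S : lsq R J -> lsq R J) (e : nat -> lsq R J),
      [/\ is_adjoint T S,
          forall m n, 0 < s m -> 0 < s n -> l2inner (e m) (e n) = (m == n)%:R,
          forall n, 0 < s n -> S (T (e n)) = (s n ^+ 2)%:C *: e n
        & forall a, (forall n, 0 < s n -> l2inner a (e n) = 0) -> T a = 0]].

Definition trace_class (R : realType) (J : choiceType)
    (T : lsq R J -> lsq R J) : Prop :=
  compact_op T /\ exists2 s, singular_values T s & cvgn (series s).

Definition op_trace (R : realType) (J : choiceType) (T : lsq R J -> lsq R J) :
    R[i] :=
  csum (fun j => l2inner (T (l2basis R j)) (l2basis R j)).

Definition dixmier_ideal (R : realType) (J : choiceType)
    (T : lsq R J -> lsq R J) : Prop :=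
  compact_op T /\ exists2 s, singular_values T s &
  (limn_esup (fun n => ((ln n%:R)^-1 * \sum_(1 <= j < n.+1) s j)%:E) < +oo)%E.

Definition bounded_seq (R : realType) (u : nat -> R[i]) : Prop :=
  exists K : R, forall n, normc (u n) <= K.

(* Dilation-invariant states on the bounded sequences vanishing on c_0; only
   the values at bounded sequences matter. *)
Definition generalized_limit (R : realType) (om : (nat -> R[i]) -> R[i]) :
    Prop :=
  [/\ forall c u v, bounded_seq u -> bounded_seq v ->
        om (fun n => c * u n + v n) = c * om u + om v,
      forall u, bounded_seq u -> (forall n, 0 <= u n) -> 0 <= om u,
      om (fun=> 1) = 1,
      forall u : nat -> R[i]^o, u @ \oo --> (0 : R[i]^o) -> om u = 0
    & forall m u, (0 < m)%N -> bounded_seq u ->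
        om (fun n => u (n %/ m)%N) = om u].

(* [tr] is the Dixmier trace of [om]: the linear functional on the
   Dixmier-Macaev ideal with the given values at positive operators (these
   span the ideal, so its values there are determined). *)
Definition is_dixmier_functional (R : realType) (J : choiceType)
    (om : (nat -> R[i]) -> R[i]) (tr : (lsq R J -> lsq R J) -> R[i]) : Prop :=
  (forall c S T, dixmier_ideal S -> dixmier_ideal T ->
     tr (fun a => c *: S a + T a) = c * tr S + tr T) /\
  (forall T s, dixmier_ideal T -> positive_op T -> singular_values T s ->
     tr T = om (fun n => ((ln (2 + n)%:R)^-1 * \sum_(j < n.+1) s j)%:C)).

(* [T] is measurable in the sense of Connes and its Dixmier trace is [c]. *)
Definition has_dixmier_trace (R : realType) (J : choiceType)
    (T : lsq R J -> lsq R J) (c : R[i]) : Prop :=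
  dixmier_ideal T /\
  forall om tr, generalized_limit om -> is_dixmier_functional om tr -> tr T = c.

(* The summand of [p] in l2(FB, C^2) has the coordinates [(p, true)] and
   [(p, false)], in this order. *)
Definition bhilbert (R : realType) k (V : finType) (L : kgraph k V) : Type :=
  lsq R (bpath L * bool)%type.

(* The formal expression of D; the domain of D consists of the square-summable
   [a] such that [dirac w a] is square summable. *)
Definition dirac (R : realType) k (V : finType) (L : kgraph k V)
    (w : bpath L -> R) (a : bpath L * bool -> R[i]) : bpath L * bool -> R[i] :=
  fun j => ((diam w j.1)^-1)%:C * a (j.1, ~~ j.2).

Lemma dirac_sqr (R : realType) k (V : finType) (L : kgraph k V)
    (w : bpath L -> R) (a : bpath L * bool -> R[i]) (j : bpath L * bool) :
  dirac w (dirac w a) j = ((diam w j.1)^-1 ^+ 2)%:C * a j.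
Proof. by case: j => p b; rewrite /dirac /= negbK mulrA -rmorphM. Qed.

(* |D|^(-p).  By [dirac_sqr], |D| is multiplication by the inverse of the
   diameter. *)
Definition absD_negpow (R : realType) k (V : finType) (L : kgraph k V)
    (w : bpath L -> R) (p : R) : bhilbert R L -> bhilbert R L :=
  mulop (fun j : bpath L * bool => (diam w j.1 `^ p)%:C).

Definition pi_tau (R : realType) k (V : finType) (L : kgraph k V)
    (tau : bpath L -> ipath L * ipath L) (f : ipath L -> R[i]) :
    bhilbert R L -> bhilbert R L :=
  mulop (fun j : bpath L * bool => f (if j.2 then (tau j.1).1 else (tau j.1).2)).

Definition cintegral (R : realType) k (V : finType) (L : kgraph k V)
    (x0 : ipath L) (M : probability (borel_ipath x0) R) (f : ipath L -> R[i]) :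
    R[i] :=
  (\int[M]_x complex.Re (f x)) +i* (\int[M]_x complex.Im (f x)).

(* Main.v *)
(* On the p-summand of l2(FB, C^2) the operator |D|^(-delta) is multiplication by
   u(p) = x_(s(p))^delta / rho_pow |p|, so every operator of the theorem is a
   multiplication operator on l2(FB x {+,-}).  Since A x = rho x with A
   irreducible, a vector b decomposes as [a x + (1 - A / rho) v], whence the
   masses of u over the extensions of length l of a path p have the Cesaro mean
   [alpha * M [p]] (with bounded total error); by uniform continuity, the masses
   of (f o tau) u over the paths of length l have the Cesaro mean
   [2 alpha int f dM].  As u decays like [expR (- th l)] while the number of paths
   of length l is of order [expR (th l)], the n largest values of f u are, up to a
   bounded total error, those at the paths of length less than (ln n) / th, which
   gives the Dixmier trace [(2 alpha / th) int f dM]; and Abel summation in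
   [z = expR (- th (s - 1))] gives the same residue of the zeta function. *)

Require Import Defs.
From mathcomp Require Import all_boot all_order all_algebra.
From mathcomp Require Import all_classical all_reals all_analysis.
From mathcomp Require Import complex finmap ring lra zify.

Set Implicit Arguments.
Unset Strict Implicit.
Unset Printing Implicit Defensive.

Import Order.TTheory GRing.Theory Num.Theory.
Import numFieldNormedType.Exports.
Import Normc.

Local Open Scope classical_set_scope.
Local Open Scope ring_scope.
Local Open Scope complex_scope.

(** * Cesaro means of the powers of an irreducible matrix *)

(** Irreducibility allows periodicity, so the masses of single levels need not converge; only their
    Cesaro means do, and neither a logarithmic average nor a residue sees anything finer. This
    dictates [mean_limit]: its slope error [e] stems from the uniform continuity of [f], its bounded
    error [K] from telescoping. The density [u] carries the power [delta] of [x], whereas [M]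
    carries [x] itself: the two need not be proportional path by path, and it is because the vectors
    fixed by [A / rho] form a line that the constant [alpha] is the same for all cylinders. The
    factor 2 counts the two coordinates of a summand, at which [f] takes asymptotically equal
    values. A Dixmier functional is prescribed on positive operators only, so the positive and
    negative parts of the real and imaginary parts of [f] are treated separately. Finally [u] decays
    geometrically only up to constant factors; in the power [s - 1] of [u] these factors tend to 1,
    which is why they leave no trace in the residue. *)

Section irreducible_matrices.
Variables (R : realType) (n : nat) (B : 'M[R]_n) (x : 'cV[R]_n).
Hypotheses (B_ge0 : forall i j, 0 <= B i j) (x_gt0 : forall i, 0 < x i 0).
Hypothesis Bx : B *m x = x.

Lemma expmx_ge0 q i j : 0 <= (B ^+ q) i j.
Proof.
elim: q i j => [|q IH] i j; first by rewrite expr0 !mxE; case: eqP.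
by rewrite exprS mxE sumr_ge0 // => l _; rewrite mulr_ge0.
Qed.

Lemma expmx_fix (z : 'cV[R]_n) q : B *m z = z -> B ^+ q *m z = z.
Proof.
by move=> Bz; elim: q => [|q IH]; rewrite ?expr0 ?mul1mx// exprSr -mulmxA Bz.
Qed.

(** In the sup norm weighted by [1 / x], a nonnegative matrix fixing [x] is a contraction, so one
    [C] serves all powers. *)
Lemma expmx_dominated (v : 'cV[R]_n) C q :
  (forall i, `|v i 0| <= C * x i 0) -> forall i, `|(B ^+ q *m v) i 0| <= C * x i 0.
Proof.
move=> vC i; rewrite -[in leRHS](expmx_fix q Bx) 2!mxE mulr_sumr.
apply: le_trans (ler_norm_sum _ _ _) _; apply: ler_sum => j _.
by rewrite normrM ger0_norm ?expmx_ge0 // mulrCA ler_wpM2l ?expmx_ge0.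
Qed.

Lemma dominated_ex (v : 'cV[R]_n) :
  exists2 C, 0 <= C & forall i, `|v i 0| <= C * x i 0.
Proof.
exists (\sum_i `|v i 0| / x i 0) => [|i].
  by apply: sumr_ge0 => i _; rewrite divr_ge0 // ltW.
rewrite -ler_pdivrMr // (bigD1 i) //= lerDl.
by apply: sumr_ge0 => j _; rewrite divr_ge0 // ltW.
Qed.

Hypothesis B_irr : irreducible_mx B.

(* Subtract the largest multiple of [x] below [z]: the difference is a
   nonnegative fixed vector with a zero entry, hence vanishes. *)
Lemma irreducible_fix (z : 'cV[R]_n) : B *m z = z -> exists c, z = c *: x.
Proof.
move=> Bz; have [n0|i0] := pickP 'I_n; last first.
  by exists 0; apply/matrixP => i; have := i0 i.
pose i := [arg min_(i < n0) (z i 0 / x i 0)]%O; pose c := z i 0 / x i 0.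
have cP j : c * x j 0 <= z j 0.
  by rewrite -ler_pdivlMr // /c /i; case: arg_minP => // l _; apply.
have By : B *m (z - c *: x) = z - c *: x.
  by rewrite mulmxBr Bz -scalemxAr Bx.
exists c; apply/colP => j; apply/eqP; rewrite -subr_eq0.
have [m _ Bm] := B_irr i j.
have : (B ^+ m *m (z - c *: x)) i 0 = 0.
  by rewrite (expmx_fix _ By) !mxE /c divfK ?subrr // gt_eqF.
have y_ge0 l : 0 <= (z - c *: x) l 0 by rewrite !mxE subr_ge0.
rewrite mxE => /eqP; rewrite psumr_eq0 => [|l _]; last first.
  by rewrite mulr_ge0 ?expmx_ge0.
move=> /allP/(_ j (mem_index_enum _))/=; rewrite mulf_eq0 gt_eqF //=.
by rewrite !mxE.
Qed.

(** Otherwise [B ^+ Q *m v = v - Q%:R *: x] would drift linearly, although the powers of [B] stay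
    bounded on [v]. The index [i] excludes the empty matrix, for which equality holds. *)
Lemma fix_notin_range (v : 'cV[R]_n) (i : 'I_n) : v - B *m v != x.
Proof.
apply/eqP => vx; have [C C0 vC] := dominated_ex v.
have BQ Q : B ^+ Q *m v = v - Q%:R *: x.
  elim: Q => [|Q IH]; first by rewrite expr0 mul1mx scale0r subr0.
  rewrite exprS -mulmxA IH mulmxBr -scalemxAr Bx -natr1 scalerDl scale1r.
  have -> : B *m v = v - x by rewrite -vx opprB addrC subrK.
  by rewrite opprD addrA addrAC.
have Qle Q : Q%:R <= C *+ 2.
  have := expmx_dominated Q vC i; rewrite BQ => h.
  rewrite -(ler_pM2r (x_gt0 i)).
  rewrite (_ : Q%:R * x i 0 = v i 0 - (v - Q%:R *: x) i 0); last first.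
    by rewrite !mxE opprB addrCA subrr addr0.
  have := vC i; move: h; rewrite !ler_norml.
  by move=> /andP[h _] /andP[_ h']; rewrite mulrnAl mulr2n; lra.
have := Qle (Num.truncn (C *+ 2)).+1; apply/negP; rewrite -ltNge.
exact: truncnS_gt.
Qed.

(** Rank count: the fixed vectors form at most a line, so the range of [1 - B] has codimension at
    most one, and [x] lies outside it. *)
Lemma fix_range_decomposition (b : 'cV[R]_n) :
  exists a v, b = a *: x + (v - B *m v).
Proof.
have [i0|n0] := pickP 'I_n; last first.
  by exists 0, 0; apply/colP => i; have := n0 i.
(* After transposition the row space of [N] is the range of [1 - B], and [kermx N] consists of the
   fixed vectors. *)
pose N := (1%:M - B)^T.
have NE (v : 'cV[R]_n) : v^T *m N = (v - B *m v)^T.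
  by rewrite /N -trmx_mul mulmxBl mul1mx.
have kerN : (kermx N <= x^T)%MS.
  apply/rV_subP => u /sub_kermxP uN; have := NE u^T; rewrite trmxK uN.
  move=> /(congr1 trmx); rewrite trmxK trmx0 => /esym/subr0_eq/esym Bu.
  have [c uc] := irreducible_fix Bu.
  by rewrite -[u]trmxK uc linearZ /= scalemx_sub.
have rN : (n <= (\rank N).+1)%N.
  have := mxrank_ker N; have := mxrankS kerN; have := rank_leq_row x^T.
  move=> h1 h2 h3; have := leq_trans h2 h1; rewrite h3 leq_subLR addn1.
  by [].
have xN : ~~ (x^T <= N)%MS.
  apply/negP => /submxP[u xu]; have := NE u^T; rewrite trmxK -xu.
  by move=> /trmx_inj/esym/eqP; apply/negP; exact: fix_notin_range.
have NltD : (N < N + x^T)%MS.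
  rewrite ltmxE addsmxSl /=; apply: contra xN; apply: submx_trans.
  exact: addsmxSr.
have full : row_full (N + x^T)%MS.
  rewrite /row_full eqn_leq rank_leq_col /=.
  by apply: leq_trans rN _; exact: rank_ltmx.
have := submx_full b^T full => /sub_addsmxP[[u1 u2] /= bE].
exists (u2 0 0), u1^T; rewrite -[LHS]trmxK bE addrC linearD /=.
rewrite -[u1 in LHS]trmxK NE trmxK; congr (_ + _).
by rewrite trmx_mul trmxK [u2]mx11_scalar tr_scalar_mx mul_mx_scalar !mxE eqxx mulr1n.
Qed.

(** The component [v - B *m v] of [b] telescopes to a bounded amount; the component along [x] is
    repeated [Q] times. *)
Lemma mean_ergodic (b : 'cV[R]_n) : exists a K, forall Q i,
  `|(\sum_(q < Q) B ^+ q *m b) i 0 - Q%:R * a * x i 0| <= K.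
Proof.
have [a [v ->]] := fix_range_decomposition b.
have [C C0 vC] := dominated_ex v.
have sumE Q : \sum_(q < Q) B ^+ q *m (a *: x + (v - B *m v)) =
    (Q%:R * a) *: x + (v - B ^+ Q *m v).
  elim: Q => [|Q IH]; first by rewrite big_ord0 mul0r scale0r expr0 mul1mx subrr addr0.
  rewrite big_ord_recr /= IH mulmxDr -scalemxAr (expmx_fix _ Bx) mulmxBr mulmxA.
  rewrite exprSr -natr1 mulrDl mul1r scalerDl mulmxE.
  by rewrite addrACA; congr (_ + _); rewrite addrA subrK.
exists a, (\sum_i (C * x i 0) *+ 2) => Q i; rewrite sumE.
rewrite [X in `|X|](_ : _ = v i 0 - (B ^+ Q *m v) i 0); last first.
  by rewrite !mxE addrAC subrr add0r.
apply: (@le_trans _ _ ((C * x i 0) *+ 2)).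
  by rewrite mulr2n; apply: le_trans (ler_normB _ _) _; rewrite lerD // expmx_dominated.
rewrite (bigD1 i) //= lerDl; apply: sumr_ge0 => j _.
by rewrite mulrn_wge0 // mulr_ge0 // ltW.
Qed.

End irreducible_matrices.

(** * Decreasing rearrangement of a family tending to zero *)

Section decreasing_rearrangement.
Variables (R : realType) (J : choiceType).

(** Membership in c_0, in the one-sided form that suits nonnegative families. *)
Definition vanishing (u : J -> R) : Prop :=
  forall e, 0 < e -> exists F : seq J, forall j, e <= u j -> j \in F.

Lemma ler_sum_uniq (F S : seq J) (v : J -> R) : uniq F ->
  (forall j, 0 <= v j) -> (forall j, j \in F -> j \notin S -> v j = 0) ->
  \sum_(j <- F) v j <= \sum_(j <- S) v j.
Proof.
move=> + v0; elim: F S => [|a F IH] S /=; first by rewrite big_nil sumr_ge0.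
move=> /andP[aF uF] FS; rewrite big_cons.
have [aS|aS] := boolP (a \in S); last first.
  rewrite FS ?mem_head // add0r; apply: IH => // j jF.
  by apply: FS; rewrite inE jF orbT.
rewrite (big_rem a aS) lerD2l; apply: IH => // j jF jS.
apply: FS; first by rewrite inE jF orbT.
apply: contra jS; rewrite (perm_mem (perm_to_rem aS)) inE => /predU1P[ja|//].
by rewrite -ja jF in aF.
Qed.

Lemma sumr_const_seq (S : seq J) (c : R) : \sum_(j <- S) c = c *+ size S.
Proof. by rewrite big_const_seq count_predT iter_addr_0. Qed.

(** Only finitely many entries reach a given positive value, so a positive supremum is attained;
    [None] signals that only zeros are left. *)
Lemma max_outside (u : J -> R) (S : seq J) : vanishing u -> (forall j, 0 <= u j) ->
  exists o : option J, if o is Some j then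
    [/\ j \notin S, 0 < u j & forall i, i \notin S -> u i <= u j]
  else forall i, i \notin S -> u i = 0.
Proof.
move=> u_van u0; have [[i [iS ui]]|nex] := pselect (exists i, i \notin S /\ 0 < u i); last first.
  exists None => i iS; apply/eqP; rewrite eq_le u0 andbT leNgt.
  by apply/negP => ui; apply: nex; exists i.
have [F FP] := u_van _ ui; pose G := [seq j <- F | j \notin S].
have iG : i \in G by rewrite mem_filter iS FP.
have [j jG jmax] : exists2 j, j \in G & forall l, l \in G -> u l <= u j.
  elim: G i iG {iS ui FP} => // a G IH i _.
  case: G IH => [_|b G IH].
    by exists a; rewrite ?mem_head // => l; rewrite inE => /eqP->.
  have [j jG jmax] := IH b (mem_head _ _).
  have [ja|aj] := leP (u j) (u a).
    exists a; rewrite ?mem_head // => l; rewrite inE => /predU1P[->//|/jmax h].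
    exact: le_trans ja.
  exists j; first by rewrite inE jG orbT.
  by move=> l; rewrite inE => /predU1P[->|/jmax//]; exact: ltW.
exists (Some j); move: (jG); rewrite mem_filter => /andP[jS jF].
have uij := jmax _ iG.
split=> //; first exact: lt_le_trans uij.
move=> l lS; have [ul|/ltW ul] := leP (u i) (u l).
  by apply: jmax; rewrite mem_filter lS FP.
exact: le_trans uij.
Qed.

Section greedy.
Variables (u : J -> R) (next : seq J -> option J).
Hypotheses (u_ge0 : forall j, 0 <= u j) (u_van : vanishing u).
Hypothesis nextP : forall S, if next S is Some j then
    [/\ j \notin S, 0 < u j & forall i, i \notin S -> u i <= u j]
  else forall i, i \notin S -> u i = 0.

(** The greedy choice stalls once all positive entries are taken, so the list can be shorter than
    [n]; the rearrangement then continues with zeros. *)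
Fixpoint chosen n : seq J :=
  if n is m.+1 then (if next (chosen m) is Some j then j :: chosen m else chosen m)
  else [::].

Definition choice_at n : option J := next (chosen n).
Definition rearr n : R := if choice_at n is Some j then u j else 0.

Lemma rearr_ge0 n : 0 <= rearr n.
Proof. by rewrite /rearr; case: choice_at. Qed.

Lemma chosen_mono m n : (m <= n)%N -> {subset chosen m <= chosen n}.
Proof.
elim: n => [|n IH]; first by rewrite leqn0 => /eqP->.
rewrite leq_eqVlt => /predU1P[->//|/IH h] j /h /= jn.
by case: next => // i; rewrite inE jn orbT.
Qed.

Lemma chosen_uniq n : uniq (chosen n).
Proof.
by elim: n => //= n IH; have := nextP (chosen n); case: next => //= j [-> _ _].
Qed.

Lemma chosen_size n : (size (chosen n) <= n)%N.
Proof. by elim: n => //= n IH; case: next => //=; exact: leqW. Qed.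

Lemma sum_rearr n : \sum_(j < n) rearr j = \sum_(j <- chosen n) u j.
Proof.
elim: n => [|n IH]; first by rewrite big_ord0 big_nil.
rewrite big_ord_recr /= IH /rearr /choice_at.
by case: next => [j|]; rewrite ?big_cons ?addr0 // addrC.
Qed.

Lemma rearr_le_out n i : i \notin chosen n -> u i <= rearr n.
Proof.
move=> ni; rewrite /rearr /choice_at; have := nextP (chosen n).
by case: next => [j [_ _ ->//]|->].
Qed.

Lemma rearr_nincr m n : (m <= n)%N -> rearr n <= rearr m.
Proof.
move=> mn; rewrite {1}/rearr; case E: (choice_at n) => [j|]; last exact: rearr_ge0.
apply: rearr_le_out; have := nextP (chosen n); rewrite -/(choice_at n) E => -[jn _ _].
by apply: contra jn; exact: chosen_mono.
Qed.

Lemma choice_at_chosen n j : choice_at n = Some j -> j \in chosen n.+1.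
Proof. by rewrite /choice_at /= => ->; rewrite mem_head. Qed.

Lemma choice_at_inj m n j : choice_at m = Some j -> choice_at n = Some j -> m = n.
Proof.
wlog mn : m n / (m <= n)%N => [W|].
  move=> mj nj; case/orP: (leq_total m n) => mn; first exact: (W m n).
  exact/esym/(W n m).
move=> mj nj; apply/eqP; rewrite eqn_leq mn leqNgt; apply/negP => lt_mn.
have := nextP (chosen n); rewrite -/(choice_at n) nj => -[/negP jn _ _]; apply: jn.
exact: chosen_mono lt_mn _ (choice_at_chosen mj).
Qed.

(** An index that is never chosen forces every chosen entry to be at least as large as its own, and
    only finitely many are. *)
Lemma rearr_exhausts j : 0 < u j -> exists n, choice_at n = Some j.
Proof.
move=> uj; apply: contrapT => nex.
have out n : j \notin chosen n.
  elim: n => //= n IH; case E: (next (chosen n)) => [i|//].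
  rewrite inE negb_or IH andbT; apply/eqP => ji; apply: nex.
  by exists n; rewrite /choice_at E ji.
have [F FP] := u_van uj.
have sub n : {subset chosen n <= F} /\ size (chosen n) = n.
  elim: n => [|n [IH sn]] //=; have := nextP (chosen n).
  case: next => [i [_ _ /(_ _ (out n)) ui]|/(_ _ (out n)) uj0]; last first.
    by move: uj; rewrite uj0 ltxx.
  by split=> [l|/=]; rewrite ?sn // inE => /predU1P[->|/IH//]; exact: FP.
have [s1 s2] := sub (size F).+1.
by have := uniq_leq_size (chosen_uniq _) s1; rewrite s2 ltnn.
Qed.

Lemma chosen_ge n j : j \in chosen n -> rearr n <= u j.
Proof.
elim: n => //= n IH; case E: (next (chosen n)) => [i|]; last first.
  by move=> /IH; apply: le_trans; exact: rearr_nincr.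
have ri : rearr n = u i by rewrite /rearr /choice_at E.
rewrite inE => /predU1P[->|/IH]; first by rewrite -ri rearr_nincr.
by apply: le_trans; exact: rearr_nincr.
Qed.

Lemma chosen_size_pos n : 0 < rearr n -> size (chosen n) = n.
Proof.
elim: n => //= n IH pos.
have pn : 0 < rearr n by apply: lt_le_trans pos _; exact: rearr_nincr.
by move: (pn); rewrite /rearr /choice_at; case: next => [j _ /=|]; rewrite ?ltxx // IH.
Qed.

(* The sum of [n] entries exceeds [n * rearr n] at most by the excess of the
   [n] chosen ones. *)
Lemma rearr_top n (F : seq J) : uniq F -> (size F <= n)%N ->
  \sum_(j <- F) u j <= \sum_(j < n) rearr j.
Proof.
move=> uF sF; rewrite sum_rearr.
pose v j := Num.max (u j - rearr n) 0.
have v0 j : 0 <= v j by rewrite /v le_max lexx orbT.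
apply: (@le_trans _ _ (\sum_(j <- F) (v j + rearr n))).
  by apply: ler_sum => j _; rewrite -lerBlDr /v le_max lexx.
have vS : \sum_(j <- F) v j <= \sum_(j <- chosen n) v j.
  apply: ler_sum_uniq => // j _ jn; apply/max_idPr.
  by rewrite subr_le0 rearr_le_out.
rewrite big_split /= sumr_const_seq.
apply: (@le_trans _ _ (\sum_(j <- chosen n) v j + (size (chosen n))%:R * rearr n)).
  apply: lerD => //; have := rearr_ge0 n; rewrite le_eqVlt => /predU1P[<-|pos].
    by rewrite mulr0 mul0rn.
  by rewrite chosen_size_pos // mulr_natl ler_wpMn2l // ltW.
rewrite mulr_natl -sumr_const_seq -big_split /=.
rewrite big_seq [leRHS]big_seq; apply: ler_sum => j jn.
by rewrite /v (max_idPl _) ?subrK // subr_ge0 chosen_ge.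
Qed.

(** Chosen entries inside [E] are paid for by the sum over [E], the others, at most [n] in number,
    by [t] each. *)
Lemma rearr_bound n (E : seq J) t : 0 <= t ->
  (forall j, j \notin E -> u j <= t) ->
  \sum_(j < n) rearr j <= \sum_(j <- E) u j + n%:R * t.
Proof.
move=> t0 ut; rewrite sum_rearr.
pose v j := if j \in E then u j else 0.
have v0 j : 0 <= v j by rewrite /v; case: ifP.
apply: (@le_trans _ _ (\sum_(j <- chosen n) (v j + t))).
  apply: ler_sum => j _; rewrite /v; case: ifPn => [_|/ut]; first by rewrite lerDl.
  by rewrite add0r.
rewrite big_split /= sumr_const_seq; apply: lerD; last first.
  by rewrite mulr_natl ler_wpMn2l // chosen_size.
rewrite [leRHS](_ : _ = \sum_(j <- E) v j).
  by apply: ler_sum_uniq; rewrite ?chosen_uniq // => j _ /negPf jE; rewrite /v jE.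
by rewrite big_seq [RHS]big_seq; apply: eq_bigr => j jE; rewrite /v jE.
Qed.

End greedy.

(** The last two clauses bracket the partial sums and carry the trace asymptotics; the clauses on
    [o] supply the eigenvectors for the singular values. *)
Lemma decreasing_rearrangement (u : J -> R) : vanishing u -> (forall j, 0 <= u j) ->
  exists (s : nat -> R) (o : nat -> option J),
  [/\ (forall n, s n = if o n is Some j then u j else 0) /\
      (forall m n, (m <= n)%N -> s n <= s m),
      (forall m n j, o m = Some j -> o n = Some j -> m = n) /\
      (forall n j, o n = Some j -> 0 < u j),
      forall j, 0 < u j -> exists n, o n = Some j,
      forall n (F : seq J), uniq F -> (size F <= n)%N ->
        \sum_(j <- F) u j <= \sum_(j < n) s j
    & forall n (E : seq J) t, 0 <= t -> (forall j, j \notin E -> u j <= t) ->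
        \sum_(j < n) s j <= \sum_(j <- E) u j + n%:R * t].
Proof.
move=> u_van u0; have /choice[next nextP] := fun S => max_outside S u_van u0.
exists (rearr u next), (choice_at next); split => //.
- by split=> // m n; exact: (rearr_nincr u0 nextP).
- split=> [m n j|n j]; first exact: (choice_at_inj nextP).
  by move=> E; have := nextP (chosen next n); rewrite -/(choice_at next n) E => -[].
- by move=> j; exact: rearr_exhausts.
- by move=> n F; exact: rearr_top.
- by move=> n E t; exact: rearr_bound.
Qed.

End decreasing_rearrangement.

(** * Multiplication operators on square-summable families *)

Section sums.
Variables (R : realType) (J : choiceType).

Lemma esum_seq_ge (F : seq J) (v : J -> R) : uniq F -> (forall j, 0 <= v j) ->
  ((\sum_(j <- F) v j)%:E <= \esum_(j in setT) (v j)%:E)%E.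
Proof.
move=> uF v0; apply: esum_ge; exists [set` F]; first by split.
by rewrite -sumEFin fsbig_seq.
Qed.

Lemma esum_seq_le (v : J -> R) (B : \bar R) : (forall j, 0 <= v j) ->
  (forall F : seq J, uniq F -> ((\sum_(j <- F) v j)%:E <= B)%E) ->
  (\esum_(j in setT) (v j)%:E <= B)%E.
Proof.
move=> v0 FB; apply: ge_ereal_sup => _ [A [fA _] <-].
rewrite fsbig_finite //= sumEFin; exact: FB (fset_uniq _).
Qed.

Lemma esum_fin (v : J -> R) B : (forall j, 0 <= v j) ->
  (forall F : seq J, uniq F -> \sum_(j <- F) v j <= B) ->
  \esum_(j in setT) (v j)%:E \is a fin_num.
Proof.
move=> v0 FB; rewrite ge0_fin_numE; last by apply: esum_ge0 => j _; rewrite lee_fin.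
apply: le_lt_trans (ltry B).
by apply: esum_seq_le => // F uF; rewrite lee_fin FB.
Qed.

Lemma esum_single (v : J -> R) j0 : (forall j, j != j0 -> v j = 0) -> 0 <= v j0 ->
  \esum_(j in setT) (v j)%:E = (v j0)%:E.
Proof.
move=> v0 vj; have vge j : 0 <= v j by have [->//|/v0->] := eqVneq j j0.
apply/eqP; rewrite eq_le; apply/andP; split; last first.
  by have := @esum_seq_ge [:: j0] v isT vge; rewrite big_seq1.
apply: esum_seq_le => // F uF; rewrite lee_fin -[leRHS](big_seq1 +%R j0 v).
by apply: ler_sum_uniq => // j _; rewrite inE => /v0.
Qed.

Lemma rsum_single (v : J -> R) j0 : (forall j, j != j0 -> v j = 0) -> rsum v = v j0.
Proof.
move=> v0; rewrite /rsum !(@esum_single _ j0) ?le_max ?lexx ?orbT //=; last first.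
- by move=> j /v0->; rewrite maxxx.
- by move=> j /v0->; rewrite oppr0 maxxx.
have [h|/ltW h] := leP 0 (v j0).
  by rewrite (max_idPr _) ?subr0 // oppr_le0.
by rewrite (max_idPl _) ?oppr_ge0 // sub0r opprK.
Qed.

Lemma csum_single (v : J -> R[i]) j0 : (forall j, j != j0 -> v j = 0) ->
  csum v = v j0.
Proof.
move=> v0; rewrite /csum !(@rsum_single _ j0); last first.
- by move=> j /v0->.
- by move=> j /v0->.
by case: (v j0).
Qed.

Lemma csum_ge0 (v : J -> R) : (forall j, 0 <= v j) -> 0 <= csum (fun j => (v j)%:C).
Proof.
move=> v0; rewrite /csum /= lecE /=; apply/andP; split.
  by rewrite /rsum !oppr0 subrr.
rewrite /rsum [X in _ - fine X]esum1 ?subr0 => [|j _]; last first.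
  by rewrite (max_idPr _) ?oppr_le0.
rewrite fine_ge0 // esum_ge0 // => j _.
by rewrite lee_fin le_max lexx orbT.
Qed.

End sums.

Section complex_norm.
Variable R : realType.
Implicit Types z : R[i].

Lemma normc_ge0 z : 0 <= normc z.
Proof. by case: z => a b; exact: sqrtr_ge0. Qed.

Lemma sqr_normcE z : normc z ^+ 2 = complex.Re z ^+ 2 + complex.Im z ^+ 2.
Proof. by case: z => a b; rewrite sqr_sqrtr // addr_ge0 ?sqr_ge0. Qed.

Lemma normc_mulJ z : conjc z * z = (normc z ^+ 2)%:C.
Proof. by rewrite sqr_normcE; case: z => a b /=; simpc; congr (_ +i* _); ring. Qed.

Lemma normc_real (r : R) : normc r%:C = `|r|.
Proof. by rewrite /= expr0n addr0 sqrtr_sqr. Qed.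

Lemma Re_le_normc z : `|complex.Re z| <= normc z.
Proof.
rewrite -(@ler_pXn2r _ 2) // ?nnegrE ?normc_ge0 // real_normK ?num_real //.
by rewrite sqr_normcE lerDl sqr_ge0.
Qed.

Lemma Im_le_normc z : `|complex.Im z| <= normc z.
Proof.
rewrite -(@ler_pXn2r _ 2) // ?nnegrE ?normc_ge0 // real_normK ?num_real //.
by rewrite sqr_normcE lerDr sqr_ge0.
Qed.

Lemma normc_le_ReIm z : normc z <= `|complex.Re z| + `|complex.Im z|.
Proof.
rewrite -(@ler_pXn2r _ 2) // ?nnegrE ?normc_ge0 ?addr_ge0 //.
rewrite sqr_normcE sqrrD !real_normK ?num_real // addrAC lerDl.
by rewrite mulrn_wge0 // mulr_ge0.
Qed.

Lemma cvg_complex (T : Type) (F : set_system T) (g : T -> R[i]) (l : R[i]) :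
  Filter F -> complex.Re (g t) @[t --> F] --> complex.Re l ->
  complex.Im (g t) @[t --> F] --> complex.Im l ->
  (g : T -> R[i]^o) @ F --> (l : R[i]^o).
Proof.
(* A positive element of [R[i]] is a positive real, so the radius reduces to [e]. *)
move=> FF gRe gIm; apply/cvgrPdist_lt => -[e i]; rewrite ltcE /= => /andP[/eqP-> e0].
have d0 : 0 < e / 2 by rewrite divr_gt0.
near=> t; rewrite normc_def (_ : Num.sqrt _ = normc (l - g t)) ?ltcR; last by case: (l - g t).
apply: le_lt_trans (normc_le_ReIm _) _; rewrite !raddfB /=.
have h1 : `|complex.Re l - complex.Re (g t)| < e / 2.
  by near: t; move/cvgrPdist_lt: gRe; exact.
have h2 : `|complex.Im l - complex.Im (g t)| < e / 2.
  by near: t; move/cvgrPdist_lt: gIm; exact.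
by move: h1 h2; set p := `|_ - _|; set q := `|_ - _|; lra.
Unshelve. all: by end_near. Qed.

Lemma normc_lt_continuous (X : topologicalType) (f : X -> R[i]) (x : X) e :
  {for x, continuous (f : X -> R[i]^o)} -> 0 < e ->
  \forall y \near x, normc (f x - f y) < e.
Proof.
move=> fx e0; have e0' : 0 < e%:C by rewrite ltcR.
move/cvgrPdist_lt: fx => /(_ _ e0'); apply: filterS => y.
by rewrite normc_def ltcR; case: (f x - f y).
Qed.

End complex_norm.

Section operators.
Variables (R : realType) (J : choiceType).
Implicit Types (a b : lsq R J) (m : J -> R[i]).

Lemma lsq_sum_le a (F : seq J) : uniq F ->
  \sum_(j <- F) normc (val a j) ^+ 2 <= l2norm a ^+ 2.
Proof.
move=> uF; have v0 j : 0 <= normc (val a j) ^+ 2 by rewrite sqr_ge0.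
have fa : \esum_(j in setT) (normc (val a j) ^+ 2)%:E \is a fin_num.
  rewrite ge0_fin_numE; last by apply: esum_ge0 => j _; rewrite lee_fin.
  have /asboolP := valP a; rewrite /summable.
  by under eq_esum do rewrite gee0_abs ?lee_fin //.
rewrite sqr_sqrtr; last by rewrite fine_ge0 // esum_ge0 // => j _; rewrite lee_fin.
by rewrite -lee_fin fineK // esum_seq_ge.
Qed.

Lemma square_summableP (v : J -> R[i]) B :
  (forall F : seq J, uniq F -> \sum_(j <- F) normc (v j) ^+ 2 <= B) ->
  square_summable v.
Proof.
move=> FB; apply/asboolP; rewrite /summable.
under eq_esum do rewrite gee0_abs ?lee_fin ?sqr_ge0 //.
apply: le_lt_trans (ltry B).
by apply: esum_seq_le => [j|F uF]; rewrite ?sqr_ge0 // lee_fin FB.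
Qed.

Lemma l2norm_le a B : 0 <= B ->
  (forall F : seq J, uniq F -> \sum_(j <- F) normc (val a j) ^+ 2 <= B ^+ 2) ->
  l2norm a <= B.
Proof.
move=> B0 FB; rewrite -[leRHS](ger0_norm B0) -sqrtr_sqr ler_wsqrtr //.
have v0 j : 0 <= normc (val a j) ^+ 2 by rewrite sqr_ge0.
rewrite -lee_fin fineK ?(esum_fin v0 FB) //.
by apply: esum_seq_le => // F uF; rewrite lee_fin FB.
Qed.

Lemma val_l2basis (j : J) : val (l2basis R j) = fun i => (i == j)%:R.
Proof.
rewrite /l2basis insubdK //; apply: (@square_summableP _ 1) => F uF.
apply: (@le_trans _ _ (\sum_(i <- [:: j]) normc ((i == j)%:R : R[i]) ^+ 2)).
  apply: ler_sum_uniq => // [i|i _]; first by rewrite sqr_ge0.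
  by rewrite inE => /negPf->; rewrite normc0 expr0n.
by rewrite big_seq1 eqxx normc1 expr1n.
Qed.

(** A bounded multiplier keeps the product square summable, so the default of [insubd] does not
    intervene. *)
Lemma val_mulop m C a : (forall j, normc (m j) <= C) ->
  val (mulop m a) = fun j => m j * val a j.
Proof.
move=> mC; rewrite /mulop insubdK //.
apply: (@square_summableP _ (C ^+ 2 * l2norm a ^+ 2)) => F uF.
apply: (@le_trans _ _ (\sum_(j <- F) C ^+ 2 * normc (val a j) ^+ 2)).
  apply: ler_sum => j _; rewrite normcM exprMn ler_wpM2r ?sqr_ge0 //.
  rewrite ler_pXn2r // nnegrE ?normc_ge0 //.
  exact: le_trans (normc_ge0 _) (mC j).
by rewrite -mulr_sumr ler_wpM2l ?sqr_ge0 // lsq_sum_le.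
Qed.

Lemma l2inner_basis a j : l2inner a (l2basis R j) = val a j.
Proof.
rewrite /l2inner (@csum_single _ _ _ j) => [|i /negPf ij].
  by rewrite val_l2basis eqxx rmorph1 mulr1.
by rewrite val_l2basis ij rmorph0 mulr0.
Qed.

Lemma mulop_linear m C : (forall j, normc (m j) <= C) -> linear (mulop m).
Proof.
move=> mC c a b; apply: val_inj; rewrite (val_mulop _ mC) /=.
rewrite !(val_mulop _ mC); apply/funext => j.
by rewrite /= mulrDr mulrCA.
Qed.

Lemma mulop_adjoint m C : (forall j, normc (m j) <= C) ->
  is_adjoint (mulop m) (mulop (fun j => conjc (m j))).
Proof.
move=> mC a b; have mC' j : normc (conjc (m j)) <= C.
  by have := mC j; case: (m j) => p q; rewrite /= sqrrN.
rewrite /l2inner (val_mulop _ mC) (val_mulop _ mC'); congr csum.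
have conjK (z : R[i]) : conjc (conjc z) = z by case: z => p q; rewrite /= opprK.
by apply/funext => j; rewrite rmorphM /= conjK; ring.
Qed.

Lemma mulop_comp m m' C C' : (forall j, normc (m j) <= C) ->
  (forall j, normc (m' j) <= C') ->
  mulop m \o mulop m' = mulop (fun j => m j * m' j).
Proof.
move=> mC mC'; apply/funext => a; apply: val_inj => /=.
rewrite (val_mulop _ mC) (val_mulop _ mC') (@val_mulop _ (C * C')).
  by apply/funext => j; rewrite mulrA.
by move=> j; rewrite normcM ler_pM ?normc_ge0.
Qed.

Lemma mulop_positive (r : J -> R) C : (forall j, 0 <= r j) -> (forall j, r j <= C) ->
  positive_op (mulop (fun j => (r j)%:C)).
Proof.
move=> r0 rC a; rewrite /l2inner (@val_mulop _ C).
  rewrite [X in csum X](_ : _ = fun j => (r j * normc (val a j) ^+ 2)%:C).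
    by apply: csum_ge0 => j; rewrite mulr_ge0 ?sqr_ge0.
  by apply/funext => j; rewrite rmorphM /= -normc_mulJ; ring.
by move=> j; rewrite normc_real ger0_norm.
Qed.

Lemma op_trace_mulop m C : (forall j, normc (m j) <= C) -> op_trace (mulop m) = csum m.
Proof.
move=> mC; rewrite /op_trace; congr csum; apply/funext => j.
by rewrite l2inner_basis (val_mulop _ mC) val_l2basis eqxx mulr1.
Qed.

End operators.

(** * Compactness and singular values of multiplication operators *)

Section compact_and_singular.
Variables (R : realType) (J : choiceType).

(** A square grid of mesh [e / 2]: rounding each coordinate down costs at most [e / 2]. *)
Lemma complex_net (C e : R) : 0 < e -> exists G : seq R[i],
  forall z, normc z <= C -> exists2 g, g \in G & normc (z - g) <= e.
Proof.
move=> e0; have d0 : 0 < e / 2 by rewrite divr_gt0.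
pose S := [seq k%:R * (e / 2) - C | k <- iota 0 (Num.truncn (C *+ 2 / (e / 2))).+1].
have SP x : `|x| <= C -> exists2 g, g \in S & `|x - g| <= e / 2.
  rewrite ler_norml => /andP[Cx xC]; set k := Num.truncn ((x + C) / (e / 2)).
  have xC0 : 0 <= (x + C) / (e / 2) by rewrite divr_ge0 ?(ltW d0) //; lra.
  exists (k%:R * (e / 2) - C).
    apply/mapP; exists k => //; rewrite mem_iota /= add0n ltnS.
    by apply: le_truncn; rewrite ler_pM2r ?invr_gt0 // mulr2n lerD2r.
  have /andP[k1 k2] := truncn_itv xC0; rewrite -/k in k1 k2.
  rewrite ler_pdivlMr // in k1; rewrite ltr_pdivrMr // -natr1 mulrDl mul1r in k2.
  by rewrite ler_norml; apply/andP; split; lra.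
exists [seq a +i* b | a <- S, b <- S] => z zC.
have [a aS ha] := SP _ (le_trans (Re_le_normc z) zC).
have [b bS hb] := SP _ (le_trans (Im_le_normc z) zC).
exists (a +i* b); first by apply/allpairsP; exists (a, b).
apply: le_trans (normc_le_ReIm _) _; case: z {zC} ha hb => p q /= ha hb; lra.
Qed.

Lemma finite_net (G : seq R[i]) (P : R[i] -> R[i] -> Prop) (F : seq J) :
  exists N : seq (J -> R[i]), forall z : J -> R[i],
    (forall j, j \in F -> exists2 g, g \in G & P (z j) g) ->
    exists2 b, b \in N & forall j, if j \in F then P (z j) (b j) else b j = 0.
Proof.
elim: F => [|i F [N NP]]; first by exists [:: fun=> 0] => z _; exists (fun=> 0); rewrite ?mem_head.
exists [seq (fun j => if j == i then g else b j) | g <- G, b <- N] => z zG.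
have [|b bN bP] := NP z; first by move=> j jF; apply: zG; rewrite inE jF orbT.
have [g gG gP] := zG i (mem_head _ _).
exists (fun j => if j == i then g else b j); first by apply/allpairsP; exists (g, b).
by move=> j; rewrite inE; case: eqVneq => [->|_] //=; exact: bP.
Qed.

Lemma vanishing_bounded (u : J -> R) : vanishing u -> exists C, forall j, u j <= C.
Proof.
move=> /(_ 1 ltr01)[F FP]; exists (\sum_(j <- F) `|u j| + 1) => j.
have S0 (G : seq J) : 0 <= \sum_(i <- G) `|u i| by rewrite sumr_ge0.
have [/FP jF|/ltW u1] := leP 1 (u j); last by apply: le_trans u1 _; rewrite lerDr.
by rewrite (big_rem j jF) /= -addrA; apply: le_trans (ler_norm _) _; rewrite lerDl addr_ge0.
Qed.

(** The finitely many coordinates where the multiplier reaches [e / 2] are approximated by a finite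
    net; on the others the image of the unit ball has norm at most [e / 2]. *)
Lemma mulop_compact (m : J -> R[i]) : vanishing (fun j => normc (m j)) -> compact_op (mulop m).
Proof.
move=> m_van; have [C mC] := vanishing_bounded m_van; split.
  exact: mulop_linear mC.
move=> e e0; have d0 : 0 < e / 2 by rewrite divr_gt0.
have [F0 F0P] := m_van _ d0; pose F := undup F0.
have C0 : 0 <= `|C| by [].
(* Dividing the mesh by the number of coordinates, plus one in case there are none, makes the
   squared errors on [F] add up to at most [(e / 2) ^+ 2]. *)
have [G GP] := @complex_net `|C| (e / 2 / (size F).+1%:R) (divr_gt0 d0 (ltr0Sn _ _)).
have [N NP] := finite_net G (fun z g => normc (z - g) <= e / 2 / (size F).+1%:R) F.
exists [seq insubd 0 b | b <- N] => a a1.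
have aF (S : seq J) : uniq S -> \sum_(j <- S) normc (val a j) ^+ 2 <= 1.
  move=> uS; apply: le_trans (lsq_sum_le a uS) _.
  by rewrite exprn_ile1 // sqrtr_ge0.
have aj j : normc (val a j) <= 1.
  have := aF [:: j] isT; rewrite big_seq1 -[X in _ <= X](expr1n _ 2%N).
  by rewrite ler_pXn2r ?nnegrE ?normc_ge0.
have [|b bN bP] := NP (fun j => m j * val a j).
  move=> j _; apply: GP; rewrite normcM -[leRHS]mulr1.
  by rewrite ler_pM ?normc_ge0 //; apply: le_trans (mC j) (ler_norm _).
have diffE (S : seq J) : uniq S ->
    \sum_(j <- S) normc (m j * val a j - b j) ^+ 2 <= (e / 2) ^+ 2 *+ 2.
  move=> uS; rewrite (bigID [in F]) /= mulr2n; apply: lerD.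
    rewrite -big_filter; set S' := [seq i <- S | i \in F].
    apply: (@le_trans _ _ (\sum_(j <- S') (e / 2 / (size F).+1%:R) ^+ 2)).
      rewrite big_seq [leRHS]big_seq; apply: ler_sum => j.
      rewrite mem_filter => /andP[jF _]; have := bP j; rewrite jF => h.
      by rewrite ler_pXn2r // nnegrE ?normc_ge0 // divr_ge0 // ltW.
    rewrite sumr_const_seq.
    have sS : (size S' <= size F)%N.
      apply: uniq_leq_size; first exact: filter_uniq.
      by move=> j; rewrite mem_filter => /andP[].
    have q0 : 0 <= (e / 2 / (size F).+1%:R) ^+ 2 by rewrite sqr_ge0.
    apply: le_trans (ler_wpMn2l q0 (leqW sS)) _.
    rewrite -[X in X <= _]mulr_natr; set N0 : R := (size F).+1%:R.
    have N1 : 1 <= N0 by rewrite ler1n.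
    move: N0 N1 => N0 N1; have -> : (e / 2 / N0) ^+ 2 * N0 = (e / 2) ^+ 2 / N0 by field; lra.
    by rewrite ler_pdivrMr ?ler_peMr ?sqr_ge0 //; lra.
  apply: (@le_trans _ _ (\sum_(j <- S | j \notin F) (e / 2) ^+ 2 * normc (val a j) ^+ 2)).
    apply: ler_sum => j jF; have := bP j; rewrite (negPf jF) => ->.
    rewrite subr0 normcM exprMn ler_wpM2r ?sqr_ge0 //.
    rewrite ler_pXn2r // ?nnegrE ?normc_ge0 ?(ltW d0) // leNgt.
    by apply: contra jF => /ltW/F0P; rewrite mem_undup.
  rewrite -mulr_sumr ler_piMr ?sqr_ge0 //; apply: le_trans (aF S uS).
  by rewrite [leRHS](bigID [in F]) /= lerDr sumr_ge0 // => j _; rewrite sqr_ge0.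
have b2 : square_summable b.
  have /square_summableP := diffE => dS.
  have -> : b = val (mulop m a) - (fun j => m j * val a j - b j).
    by rewrite (val_mulop _ mC); apply/funext => j /=; rewrite !fctE; ring.
  apply: rpredB dS; exact: valP.
exists (insubd 0 b); first by apply/mapP; exists b.
(* The two contributions give a squared norm of at most [e ^+ 2 / 2], which is below
   [9 / 16 * e ^+ 2]; the margin makes the inequality strict. *)
apply: (@le_lt_trans _ _ (e * (3 / 4))); last by rewrite gtr_pMr //; lra.
apply: l2norm_le => [|S uS]; first by rewrite mulr_ge0 ?ltW // divr_gt0.
have -> : val (mulop m a - insubd 0 b) = fun j => m j * val a j - b j.
  by rewrite [LHS]/= (val_mulop _ mC) insubdK //.
apply: le_trans (diffE _ uS) _; have := sqr_ge0 e; lra.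
Qed.

(** Composed with its adjoint, the operator is multiplication by the squared modulus, so basis
    vectors diagonalise it. Where [s n] is 0 the eigenvector is set to 0, on which the definition
    imposes nothing. *)
Lemma mulop_singular_values (m : J -> R[i]) : vanishing (fun j => normc (m j)) ->
  exists s, [/\ singular_values (mulop m) s,
    forall n (F : seq J), uniq F -> (size F <= n)%N ->
      \sum_(j <- F) normc (m j) <= \sum_(j < n) s j
    & forall n (E : seq J) t, 0 <= t -> (forall j, j \notin E -> normc (m j) <= t) ->
        \sum_(j < n) s j <= \sum_(j <- E) normc (m j) + n%:R * t].
Proof.
move=> m_van; have [C mC] := vanishing_bounded m_van.
have [s [c [[sE s_nincr] [c_inj c_pos] c_ex s_top s_bound]]] :=
  decreasing_rearrangement m_van (fun j => normc_ge0 (m j)).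
have mC' j : normc (conjc (m j)) <= C.
  by have := mC j => /=; case: (m j) => p q; rewrite /= sqrrN.
have s_pos n : 0 < s n -> exists j, c n = Some j.
  by rewrite sE; case: (c n) => [j|]; [exists j|rewrite ltxx].
exists s; split=> //; split=> //.
  by move=> n; rewrite sE; case: (c n) => // j; exact: normc_ge0.
exists (mulop (fun j => conjc (m j))), (fun n => if c n is Some j then l2basis R j else 0).
split; first exact: mulop_adjoint mC.
- move=> p q /s_pos[i ci] /s_pos[j cj]; rewrite ci cj l2inner_basis val_l2basis.
  congr (nat_of_bool _)%:R; apply/eqP/eqP => [ij|pq].
    by apply: (c_inj _ _ i) => //; rewrite cj ij.
  by move: cj; rewrite -pq ci => -[].
- move=> n sn; have [j cj] := s_pos _ sn; rewrite cj sE cj; apply: val_inj.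
  rewrite (val_mulop _ mC') (val_mulop _ mC) val_l2basis /= val_l2basis.
  apply/funext => i; rewrite mulrA normc_mulJ.
  rewrite [RHS](_ : _ = (normc (m j) ^+ 2)%:C * (i == j)%:R) //.
  have [->|_] := eqVneq i j; first by [].
  by rewrite !mulr0.
- move=> a a0; apply: val_inj; rewrite (val_mulop _ mC); apply/funext => j /=.
  have := normc_ge0 (m j); rewrite le_eqVlt => /predU1P[/esym/eq0_normc->|mj].
    by rewrite mul0r.
  have [n cn] := c_ex _ mj; have := a0 n; rewrite sE cn => /(_ mj).
  by rewrite l2inner_basis => ->; rewrite mulr0.
Qed.

End compact_and_singular.

(** * Multipliers on exponentially growing levels *)

(* [S n / n] tends to [l]; in this form, bounded perturbations of [S] are
   absorbed by [K]. *)
Definition mean_limit (R : realType) (S : nat -> R) (l : R) : Prop :=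
  forall e, 0 < e -> exists K, forall n, `|S n - n%:R * l| <= e * n%:R + K.

Lemma generalized_limit_cvg (R : realType) (om : (nat -> R[i]) -> R[i])
    (x : nat -> R) (l : R) :
  generalized_limit om -> x @ \oo --> l -> om (fun n => (x n)%:C) = l%:C.
Proof.
move=> [omL _ om1 om0 _] xl.
have bd1 : bounded_seq (fun=> 1 : R[i]) by exists 1 => _; rewrite normc1.
have yl : x n - l @[n --> \oo] --> (0 : R) by rewrite -(subrr l); apply: cvgB => //; exact: cvg_cst.
have bdy : bounded_seq (fun n => (x n - l)%:C).
  have [M [_ MP]] := cvg_seq_bounded (cvgP _ yl).
  exists (`|M| + 1) => n; rewrite normc_real; apply: MP => //.
  by have := ler_norm M; lra.
have -> : (fun n => (x n)%:C) = fun n => l%:C * 1 + (x n - l)%:C.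
  by apply/funext => n; rewrite mulr1 -rmorphD /= addrC subrK.
rewrite omL // om1 mulr1 om0 ?addr0 //.
by apply: cvg_complex => //=; exact: cvg_cst.
Qed.

Lemma abel_summation (R : realType) (a : nat -> R) (z : R) n :
  \sum_(l < n) z ^+ l * a l =
  z ^+ n * (\sum_(i < n) a i) + (1 - z) * \sum_(l < n) z ^+ l * \sum_(i < l.+1) a i.
Proof.
elim: n => [|n IH]; first by rewrite !big_ord0 !mulr0 addr0.
rewrite [LHS]big_ord_recr /= IH exprS; set B := \sum_(i < n) _.
rewrite [X in _ = _ * X + _]big_ord_recr [X in _ = _ + _ * X]big_ord_recr /=.
by rewrite [X in _ = _ + _ * (_ + _ * X)]big_ord_recr /= -/B; ring.
Qed.

Lemma geometric_sum (R : realType) (z : R) n : (1 - z) * (\sum_(l < n) z ^+ l) = 1 - z ^+ n.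
Proof. by rewrite -opprB mulNr -subrX1 opprB. Qed.

(** Summation by parts expresses the weighted sum of [a i - l] through its partial sums with
    nonnegative coefficients; once these are bounded by [e * n%:R + K], the same identity read
    backwards restores the geometric weights. *)
Lemma abel_mean (R : realType) (a : nat -> R) (z l e K : R) : 0 <= z < 1 ->
  (forall n, `|\sum_(i < n) a i - n%:R * l| <= e * n%:R + K) ->
  forall n, `|\sum_(i < n) z ^+ i * a i - l * \sum_(i < n) z ^+ i| <=
    e * (\sum_(i < n) z ^+ i) + K.
Proof.
move=> /andP[z0 z1] aK n; pose d i := a i - l.
have dS p : \sum_(i < p) d i = \sum_(i < p) a i - p%:R * l.
  by rewrite sumrB sumr_const card_ord mulr_natl.
have -> : \sum_(i < n) z ^+ i * a i - l * (\sum_(i < n) z ^+ i) = \sum_(i < n) z ^+ i * d i.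
  rewrite mulr_sumr -sumrB; apply: eq_bigr => i _; rewrite /d; ring.
have -> : e * (\sum_(i < n) z ^+ i) + K = z ^+ n * (e * n%:R + K) +
    (1 - z) * \sum_(i < n) z ^+ i * (e * i.+1%:R + K).
  have sc p : \sum_(i < p) e = e * p%:R by rewrite sumr_const card_ord mulr_natr.
  have -> : e * (\sum_(i < n) z ^+ i) =
      z ^+ n * (e * n%:R) + (1 - z) * \sum_(i < n) z ^+ i * (e * i.+1%:R).
    rewrite mulr_sumr; under eq_bigr do rewrite mulrC.
    rewrite (abel_summation (fun=> e)) sc; congr (_ + _ * _).
    by apply: eq_bigr => i _; rewrite sc.
  have -> : \sum_(i < n) z ^+ i * (e * i.+1%:R + K) =
      \sum_(i < n) z ^+ i * (e * i.+1%:R) + K * (\sum_(i < n) z ^+ i).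
    by rewrite mulr_sumr -big_split; apply: eq_bigr => i _; rewrite mulrDr [K * _]mulrC.
  rewrite [(1 - z) * (_ + _)]mulrDr [(1 - z) * (K * _)]mulrCA geometric_sum; ring.
rewrite abel_summation; apply: le_trans (ler_normD _ _) _.
rewrite !normrM normrX (ger0_norm z0) (@ger0_norm _ (1 - z)) ?subr_ge0 ?(ltW z1) //.
apply: lerD; first by rewrite ler_wpM2l ?exprn_ge0 // dS.
rewrite ler_wpM2l ?subr_ge0 ?(ltW z1) //; apply: le_trans (ler_norm_sum _ _ _) _.
apply: ler_sum => i _; rewrite normrM normrX (ger0_norm z0) ler_wpM2l ?exprn_ge0 //.
by rewrite dS.
Qed.

Lemma mean_limit_ge0 (R : realType) (S : nat -> R) (l : R) :
  (forall n, 0 <= S n) -> mean_limit S l -> 0 <= l.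
Proof.
move=> S0 Sl; rewrite leNgt; apply/negP => l0.
have e0 : 0 < - l / 2 by rewrite divr_gt0 // oppr_gt0.
have [K KP] := Sl _ e0; pose n := (Num.truncn (K / (- l / 2))).+1.
have := KP n; have := S0 n; rewrite ler_norml => S0n /andP[_ h].
have : K < n%:R * (- l / 2) by rewrite -ltr_pdivrMr //; exact: truncnS_gt.
have : n%:R * (- l) <= - l / 2 * n%:R + K by lra.
by set q := n%:R; lra.
Qed.

(** Used at [y = th * sg] to compare [sg / (1 - z)] with [1 / th]. *)
Lemma oneB_expRN_bounds (R : realType) (y : R) : 0 < y ->
  y / (1 + y) <= 1 - expR (- y) <= y.
Proof.
move=> y0; have y1 : 0 < 1 + y by lra.
apply/andP; split; last by have := expR_ge1Dx (- y); lra.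
have -> : y / (1 + y) = 1 - (1 + y)^-1 by field; lra.
by rewrite lerD2l lerN2 expRN lef_pV2 ?posrE ?expR_gt0 // expR_ge1Dx.
Qed.

Section geometric_levels.
Variables (R : realType) (J : choiceType) (lev : J -> nat) (Lv : nat -> seq J).
Hypotheses (Lv_uniq : forall n, uniq (Lv n))
  (mem_Lv : forall n j, (j \in Lv n) = (lev j == n)).

Definition below n : seq J := flatten [seq Lv l | l <- iota 0 n].

Lemma mem_below n j : (j \in below n) = (lev j < n)%N.
Proof.
apply/flatten_mapP/idP => [[l]|jn].
  by rewrite mem_iota mem_Lv /= add0n => ln /eqP->.
by exists (lev j); rewrite ?mem_Lv // mem_iota.
Qed.

Lemma belowS n : below n.+1 = below n ++ Lv n.
Proof. by rewrite /below -addn1 iotaD map_cat flatten_cat /= cats0 add0n. Qed.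

Lemma below_uniq n : uniq (below n).
Proof.
elim: n => // n IH; rewrite belowS cat_uniq IH Lv_uniq andbT /=.
apply/hasPn => j; rewrite mem_below mem_Lv => /eqP->.
by rewrite ltnn.
Qed.

Lemma sum_below (F : J -> R) n : \sum_(j <- below n) F j = \sum_(l < n) \sum_(j <- Lv l) F j.
Proof.
elim: n => [|n IH]; first by rewrite big_nil big_ord0.
by rewrite belowS big_cat big_ord_recr /= IH.
Qed.

Lemma sub_below (F : seq J) : exists n, {subset F <= below n}.
Proof.
exists (\max_(j <- F) lev j).+1 => j jF.
by rewrite mem_below ltnS; exact: leq_bigmax_seq.
Qed.

Variables (u : J -> R) (th b1 b2 K0 : R).
Hypotheses (th_gt0 : 0 < th) (b1_gt0 : 0 < b1) (b2_gt0 : 0 < b2) (K0_gt0 : 0 < K0).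
Hypothesis u_ge : forall j, b1 * expR (- (th * (lev j)%:R)) <= u j.
Hypothesis u_le : forall j, u j <= b2 * expR (- (th * (lev j)%:R)).
Hypothesis size_below : forall n, (size (below n))%:R <= K0 * expR (th * n%:R).

Lemma u_gt0 j : 0 < u j.
Proof. by apply: lt_le_trans (u_ge j); rewrite mulr_gt0 // expR_gt0. Qed.

Lemma u_notin_below n j : j \notin below n -> u j <= b2 * expR (- (th * n%:R)).
Proof.
rewrite mem_below -leqNgt => nj; apply: le_trans (u_le j) _.
by rewrite ler_pM2l // ler_expR lerN2 ler_pM2l // ler_nat.
Qed.

(** The growth of the number of entries cancels the decay of the values; the factor [expR th] is due
    to counting below [l.+1]. *)
Lemma level_sum_bound : exists2 Z, 0 <= Z & forall l, \sum_(j <- Lv l) u j <= Z.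
Proof.
exists (b2 * (K0 * expR th)) => [|l].
  by rewrite !mulr_ge0 ?expR_ge0 // ltW.
apply: (@le_trans _ _ (\sum_(j <- Lv l) b2 * expR (- (th * l%:R)))).
  rewrite big_seq [leRHS]big_seq; apply: ler_sum => j.
  by rewrite mem_Lv => /eqP <-.
rewrite sumr_const_seq -[leLHS]mulr_natr -mulrA ler_pM2l //.
apply: (@le_trans _ _ (expR (- (th * l%:R)) * (K0 * expR (th * l.+1%:R)))).
  rewrite ler_pM2l ?expR_gt0 //; apply: le_trans (size_below l.+1).
  by rewrite ler_nat belowS size_cat leq_addl.
by rewrite mulrCA -expRD -natr1 mulrDr mulr1 addKr.
Qed.

Lemma u_vanishing : vanishing u.
Proof.
(* This makes [th * n.+1%:R] exceed [b2 / e], and the exponential of a number exceeds that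
   number. *)
move=> e e0; pose n := Num.truncn ((b2 / e) / th); exists (below n.+1) => j ej.
apply: contraT => /u_notin_below/(le_trans ej); apply: contraLR => _.
rewrite -ltNge expRN ltr_pdivrMr ?expR_gt0 // mulrC -ltr_pdivrMr //.
apply: lt_le_trans (expR_ge1Dx _).
have := truncnS_gt ((b2 / e) / th).
by rewrite -/n ltr_pdivrMr // mulrC; lra.
Qed.

Lemma dominated_vanishing (v : J -> R) C : (forall j, v j <= C * u j) -> vanishing v.
Proof.
move=> vC e e0; have C0 : 0 < `|C| + 1 by rewrite ltr_wpDl.
have [F FP] := u_vanishing (divr_gt0 e0 C0); exists F => j ej; apply: FP.
rewrite ler_pdivrMr //; apply: le_trans ej _; apply: le_trans (vC j) _.
by rewrite mulrC ler_pM2l ?u_gt0 //; have := ler_norm C; lra.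
Qed.

Section cutoff.
Variable m : J -> R[i].
Variable C : R.
Hypothesis mC : forall j, normc (m j) <= C * u j.

(** The solution [c] of [K0 * expR (th * c) = n], rounded down: the last level up to which
    [size_below] guarantees at most [n] entries. Truncation gives 0 when [0 < n < K0]. *)
Definition cutoff (n : nat) : nat := Num.truncn ((ln n%:R - ln K0) / th).

(** The indices are those of the Dixmier functional, which divides the sum of [n.+1] values by
    [ln (2 + n)]; the shift and the truncation cost a bounded amount. *)
Lemma cutoff_ln : exists K, forall n, `|(cutoff n.+1)%:R - ln (2 + n)%:R / th| <= K.
Proof.
exists ((`|ln K0| + ln 2) / th + 1) => n.
have n0 : 0 < (n.+1%:R : R) by [].
pose c := ln K0; pose y := @ln R n.+1%:R; pose L := @ln R (2 + n)%:R.
have y0 : 0 <= y by rewrite ln_ge0 // ler1n.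
have l0 : 0 <= @ln R 2 by rewrite ln_ge0 // ler1n.
have yL : y <= L by rewrite ler_ln ?posrE // ler_nat.
have Ly : L <= y + ln 2.
  rewrite -lnM ?posrE // ler_ln ?posrE ?mulr_gt0 //.
  by rewrite -natrM ler_nat muln2 -addnn; lia.
rewrite /cutoff -/c -/y -/L; set t := (y - c) / th.
have tE : t * th = y - c by rewrite /t divfK // gt_eqF.
have LE : L / th * th = L by rewrite divfK // gt_eqF.
have kE : (`|c| + ln 2) / th * th = `|c| + ln 2 by rewrite divfK // gt_eqF.
have c1 := ler_norm c; have := ler_norm (- c); rewrite normrN => c2.
have tL : `|t - L / th| <= (`|c| + ln 2) / th.
  rewrite -(ler_pM2r th_gt0) kE -[X in _ * X](ger0_norm (ltW th_gt0)) -normrM.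
  rewrite mulrBl tE LE ler_norml; apply/andP; split; lra.
have [t0|t0] := leP 0 t.
  have /andP[k1 k2] := truncn_itv t0; rewrite -natr1 in k2.
  move: tL; rewrite !ler_norml => /andP[h1 h2]; apply/andP; split; first lra.
  by apply: (@le_trans _ _ (t - L / th)); [rewrite lerD2r|apply: (le_trans h2); rewrite lerDl].
have -> : Num.truncn t = 0%N by apply/truncn0Pn; rewrite -ltNge (lt_trans t0).
have L0 : 0 <= L / th by rewrite divr_ge0 ?(ltW th_gt0) ?(le_trans y0 yL).
by move: tL; rewrite !ler_norml => /andP[h1 h2]; apply/andP; split; lra.
Qed.

Lemma cutoff_size n : (0 < n)%N -> (size (below (cutoff n)) <= n)%N.
Proof.
move=> n0; rewrite /cutoff; set t := (_ / th); have [t0|t0] := leP 0 t; last first.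
  by rewrite (_ : Num.truncn t = 0%N) //; apply/truncn0Pn; rewrite -ltNge (lt_trans t0).
have /andP[k1 _] := truncn_itv t0; rewrite -(ler_nat R).
apply: le_trans (size_below _) _.
rewrite -[X in X * _](@lnK _ K0) ?posrE // -expRD -[leRHS](@lnK _ n%:R) ?posrE ?ltr0n //.
move: k1; rewrite ler_expR ler_pdivlMr //; lra.
Qed.

(** For positive [n], rounding down gives [n < K0 * expR (th * (cutoff n).+1%:R)]. *)
Lemma cutoff_tail : exists K, forall n, n%:R * (b2 * expR (- (th * (cutoff n)%:R))) <= K.
Proof.
exists (b2 * (K0 * expR th)) => -[|n].
  by rewrite mul0r !mulr_ge0 ?expR_ge0 // ltW.
rewrite mulrCA ler_pM2l // expRN ler_pdivrMr ?expR_gt0 // -mulrA -expRD.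
rewrite -[X in X * _](@lnK _ K0) ?posrE // -expRD -[leLHS](@lnK _ n.+1%:R) ?posrE //.
rewrite ler_expR /cutoff; set t := (_ / th); have := truncnS_gt t.
rewrite -[(Num.truncn t).+1%:R]natr1 {1}/t ltr_pdivrMr // mulrDl mul1r.
by rewrite [X in _ < X + _]mulrC ltrBlDl => /ltW; rewrite [X in _ + X]addrC.
Qed.

(* The [n] largest values are, up to a bounded error, those of the levels
   below a cutoff of order [ln n]: these levels have at most [n] elements, and
   the values on the other levels are [O(1/n)]. *)
Lemma singular_values_cutoff : exists s, [/\ singular_values (mulop m) s,
  forall n, (0 < n)%N ->
    \sum_(j <- below (cutoff n)) normc (m j) <= \sum_(j < n) s j
  & exists K, forall n,
    \sum_(j < n) s j <= \sum_(j <- below (cutoff n)) normc (m j) + K].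
Proof.
have [s [ss s_top s_bd]] := mulop_singular_values (dominated_vanishing mC).
exists s; split=> // [n n0|].
  by apply: s_top; [exact: below_uniq|exact: cutoff_size].
have [K KP] := cutoff_tail; exists (`|C| * K) => n.
pose t := `|C| * (b2 * expR (- (th * (cutoff n)%:R))).
apply: le_trans (s_bd n (below (cutoff n)) t _ _) _.
- by rewrite !mulr_ge0 ?expR_ge0 // ltW.
- move=> j /u_notin_below uj; apply: le_trans (mC j) _.
  apply: (@le_trans _ _ (`|C| * u j)); last by rewrite ler_wpM2l.
  by rewrite ler_wpM2r ?ler_norm // ltW // u_gt0.
- by rewrite lerD2l /t mulrCA ler_wpM2l.
Qed.

Lemma dominated_sum : exists2 Z, 0 <= Z &
  forall n, \sum_(j <- below n) normc (m j) <= Z * n%:R.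
Proof.
have [Z Z0 ZP] := level_sum_bound; exists (`|C| * Z); first by rewrite mulr_ge0.
move=> p; rewrite sum_below mulr_natr.
rewrite [leRHS](_ : _ = \sum_(l < p) (`|C| * Z)); last by rewrite sumr_const card_ord.
apply: ler_sum => l _; apply: (@le_trans _ _ (\sum_(j <- Lv l) `|C| * u j)).
  apply: ler_sum => j _; apply: le_trans (mC j) _.
  by rewrite ler_wpM2r ?ler_norm // ltW // u_gt0.
by rewrite -mulr_sumr ler_wpM2l.
Qed.

Lemma log_growth (s : nat -> R) :
  (exists K, forall n,
    \sum_(j < n) s j <= \sum_(j <- below (cutoff n)) normc (m j) + K) ->
  exists A B, [/\ 0 <= A, 0 <= B
    & forall n, \sum_(j < n.+1) s j <= A * ln (2 + n)%:R + B].
Proof.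
move=> [K KP]; have [Z Z0 ZP] := dominated_sum; have [K1 K1P] := cutoff_ln.
exists (Z / th), (`|Z * K1 + K|); split=> [||n].
- by rewrite divr_ge0 // ltW.
- by [].
- apply: le_trans (KP _) _; apply: le_trans (lerD (ZP _) (lexx K)) _.
  have := K1P n; rewrite ler_norml => /andP[_]; rewrite lerBlDr => /(ler_wpM2l Z0) h.
  apply: le_trans (lerD h (lexx K)) _.
  set L := ln _; have -> : Z * (K1 + L / th) + K = Z / th * L + (Z * K1 + K) by ring.
  by rewrite lerD2l ler_norm.
Qed.

Lemma mulop_dixmier_ideal : dixmier_ideal (mulop m).
Proof.
split; first exact: mulop_compact (dominated_vanishing mC).
have [s [ss _ /log_growth[A [B [A0 B0 AB]]]]] := singular_values_cutoff.
exists s => //; have [s0 _ _] := ss.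
have l2 : 0 < @ln R 2 by rewrite ln_gt0 // ltr1n.
apply: le_lt_trans (ltry (2 * A + B / ln 2)).
have B2 : 0 <= B / ln 2 by rewrite divr_ge0 // ltW.
(* The limit superior is an infimum of suprema over neighbourhoods of infinity; the supremum over
   all [n] is already finite. *)
apply: ge_ereal_inf; exists (ereal_sup (range (fun n : nat =>
  ((ln n%:R)^-1 * \sum_(1 <= j < n.+1) s j)%:E))).
  by exists setT => //; exact: filterT.
apply: ge_ereal_sup => _ [n _ <-]; rewrite lee_fin.
(* For [n < 2] the logarithm is 0, and so is its inverse by convention; from 2 on,
   [2 + n <= n * n]. *)
have [n2|n2] := ltnP n 2.
  have -> : @ln R n%:R = 0.
    by case: n n2 => [|[|//]] _; rewrite ?ln1 // ln0.
  by rewrite invr0 mul0r addr_ge0 // mulr_ge0.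
have Ln : ln 2 <= @ln R n%:R by rewrite ler_ln ?posrE ?ltr0n ?ler_nat //; lia.
have L2n : ln (2 + n)%:R <= 2 * @ln R n%:R.
  have n0 : 0 < (n%:R : R) by rewrite ltr0n (leq_trans _ n2).
  rewrite mulr_natl mulr2n -lnM ?posrE // -natrM ler_ln ?posrE ?ltr0n ?muln_gt0 //.
    by rewrite ler_nat; case: n n2 {Ln n0} => [|[|n]] // _; rewrite !mulSn; lia.
  by case: n n2 {Ln n0}.
rewrite mulrC ler_pdivrMr ?(lt_le_trans l2) //.
apply: (@le_trans _ _ (\sum_(j < n.+1) s j)).
  by rewrite -(big_mkord xpredT s) [leRHS]big_ltn // lerDr.
apply: le_trans (AB n) _; rewrite mulrDl lerD //.
  by apply: le_trans (ler_wpM2l A0 L2n) _; rewrite mulrCA mulrA.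
by rewrite mulrAC ler_pdivlMr // ler_wpM2l.
Qed.

(** The sum of singular values is compared with the sum below the cutoff, this with [l] times the
    cutoff, and this with [l / th] times the logarithm; only the second comparison costs more than a
    bounded error. *)
Lemma log_average_limit (s : nat -> R) (l : R) :
  (forall n, (0 < n)%N ->
    \sum_(j <- below (cutoff n)) normc (m j) <= \sum_(j < n) s j) ->
  (exists K, forall n,
    \sum_(j < n) s j <= \sum_(j <- below (cutoff n)) normc (m j) + K) ->
  mean_limit (fun n => \sum_(j <- below n) normc (m j)) l ->
  (ln (2 + n)%:R)^-1 * \sum_(j < n.+1) s j @[n --> \oo] --> l / th.
Proof.
move=> lo [K1 up] ml; apply/cvgrPdist_le => e e0.
(* The slope error gets multiplied by the cutoff, about [ln (2 + n) / th], hence the factor [th];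
   the other half of [e] is kept for the bounded errors gathered in [B]. *)
have [K KP] := ml (e / 2 * th) (mulr_gt0 (divr_gt0 e0 (ltr0Sn _ _)) th_gt0).
have [K2 K2P] := cutoff_ln.
pose B := e / 2 * th * K2 + `|K| + `|K1| + `|l| * K2.
near=> n; set L := ln _; set T := \sum_(j < n.+1) s j; set c := cutoff n.+1.
have L0 : 0 < L by rewrite ln_gt0 // ltr1n.
have BL : B <= e / 2 * L.
  rewrite -ler_pdivrMl ?divr_gt0 // -ler_expR lnK ?posrE //.
  near: n; apply: filterS (nbhs_infty_ger (expR ((e / 2)^-1 * B))) => n h.
  by apply: le_trans h _; rewrite ler_nat leq_addl.
have K20 : 0 <= K2 by apply: le_trans (K2P 0).
have cL := K2P n; rewrite -/c -/L in cL.
have Sc := KP c; have loc := lo n.+1 isT; have upc := up n.+1; rewrite -/c -/T in loc upc.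
suff h : `|T - l / th * L| <= e * L.
  rewrite -(ler_pM2r L0) -[X in _ * X <= _](gtr0_norm L0) -normrM.
  rewrite (_ : (_ - _) * L = - (T - l / th * L)) ?normrN //.
  by rewrite mulrBl [L^-1 * T * L]mulrAC mulVf ?gt_eqF // mul1r opprB.
set S := \sum_(j <- below c) _ in Sc loc upc.
have -> : T - l / th * L = (T - S) + (S - c%:R * l) + l * (c%:R - L / th).
  by field; rewrite gt_eqF.
have lc : `|l * (c%:R - L / th)| <= `|l| * K2 by rewrite normrM ler_wpM2l.
have TS : `|T - S| <= `|K1|.
  have := ler_norm K1; rewrite ler_norml; move: loc upc.
  by move=> h1 h2 h3; apply/andP; split; lra.
have thc : e / 2 * th * c%:R <= e / 2 * L + e / 2 * th * K2.
  have -> : e / 2 * L + e / 2 * th * K2 = e / 2 * th * (L / th + K2).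
    by field; rewrite gt_eqF.
  rewrite ler_pM2l ?mulr_gt0 ?divr_gt0 //.
  by have := le_trans (ler_norm _) cL; rewrite lerBlDr [K2 + _]addrC.
apply: le_trans (ler_normD _ _) _; apply: le_trans (lerD (ler_normD _ _) (lexx _)) _.
apply: le_trans (lerD (lerD TS (le_trans Sc (lerD thc (lexx K)))) lc) _.
have := ler_norm K; have -> : e * L = e / 2 * L + e / 2 * L by field.
rewrite /B in BL; lra.
Unshelve. all: by end_near. Qed.

End cutoff.

Lemma dixmier_trace_positive (r : J -> R) C l om tr : (forall j, 0 <= r j) ->
  (forall j, r j <= C * u j) -> mean_limit (fun n => \sum_(j <- below n) r j) l ->
  generalized_limit om -> is_dixmier_functional om tr ->
  tr (mulop (fun j => (r j)%:C)) = (l / th)%:C.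
Proof.
move=> r0 rC ml om_lim [_ trP].
have normr j : normc (r j)%:C = r j by rewrite normc_real ger0_norm.
have mC j : normc (r j)%:C <= C * u j by rewrite normr.
have [s [ss lo up]] := singular_values_cutoff mC.
have [D rD] := vanishing_bounded (dominated_vanishing rC).
rewrite (trP _ s) //; last 2 first.
- exact: mulop_dixmier_ideal mC.
- exact: mulop_positive rD.
apply: generalized_limit_cvg => //.
apply: log_average_limit lo up _.
by under eq_fun do under eq_bigr do rewrite normr.
Qed.

Lemma dixmier_functional_comb om tr (c : R[i]) (m m' : J -> R[i]) C C' :
  is_dixmier_functional om tr ->
  (forall j, normc (m j) <= C * u j) -> (forall j, normc (m' j) <= C' * u j) ->
  tr (mulop (fun j => c * m j + m' j)) = c * tr (mulop m) + tr (mulop m').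
Proof.
move=> [trL _] mC mC'.
have [D mD] := vanishing_bounded (dominated_vanishing mC).
have [D' mD'] := vanishing_bounded (dominated_vanishing mC').
rewrite -trL; [|exact: mulop_dixmier_ideal mC|exact: mulop_dixmier_ideal mC'].
congr tr; apply/funext => a; apply: val_inj.
rewrite (@val_mulop _ _ _ (normc c * D + D')) /=.
  apply/funext => j; transitivity (c * val (mulop m a) j + val (mulop m' a) j) => //.
  by rewrite (val_mulop _ mD) (val_mulop _ mD') mulrDl mulrA.
move=> j; apply: le_trans (le_normcD _ _) _; rewrite normcM lerD //.
by rewrite ler_wpM2l ?normc_ge0.
Qed.

Lemma dominated_comb (c : R[i]) (m m' : J -> R[i]) C C' :
  (forall j, normc (m j) <= C * u j) -> (forall j, normc (m' j) <= C' * u j) ->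
  forall j, normc (c * m j + m' j) <= (normc c * C + C') * u j.
Proof.
move=> mC mC' j; apply: le_trans (le_normcD _ _) _; rewrite normcM mulrDl lerD //.
by rewrite -mulrA ler_wpM2l ?normc_ge0.
Qed.

(** Linearity carries the values on positive operators over to [m], a combination of four
    nonnegative multipliers dominated by multiples of [u]. *)
Lemma has_dixmier_trace_mulop (m : J -> R[i]) C l1 l2 l3 l4 :
  (forall j, normc (m j) <= C * u j) ->
  mean_limit (fun n => \sum_(j <- below n) Num.max (complex.Re (m j)) 0) l1 ->
  mean_limit (fun n => \sum_(j <- below n) Num.max (- complex.Re (m j)) 0) l2 ->
  mean_limit (fun n => \sum_(j <- below n) Num.max (complex.Im (m j)) 0) l3 ->
  mean_limit (fun n => \sum_(j <- below n) Num.max (- complex.Im (m j)) 0) l4 ->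
  has_dixmier_trace (mulop m) (((l1 - l2) / th) +i* ((l3 - l4) / th)).
Proof.
move=> mC ml1 ml2 ml3 ml4; split; first exact: mulop_dixmier_ideal mC.
move=> om tr om_lim trP.
have pos (r : R) : 0 <= Num.max r 0 by rewrite le_max lexx orbT.
have dom (p : J -> R) : (forall j, `|p j| <= normc (m j)) ->
    (forall j, Num.max (p j) 0 <= C * u j) /\ (forall j, Num.max (- p j) 0 <= C * u j).
  move=> pm; have pC j : `|p j| <= C * u j := le_trans (pm j) (mC j).
  have z j : 0 <= C * u j := le_trans (normc_ge0 _) (mC j).
  split=> j; rewrite ge_max z andbT; apply: le_trans (pC j); first exact: ler_norm.
  by rewrite -normrN ler_norm.
have [dRe dRe'] := dom _ (fun j => Re_le_normc (m j)).
have [dIm dIm'] := dom _ (fun j => Im_le_normc (m j)).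
have domC (p : J -> R) : (forall j, Num.max (p j) 0 <= C * u j) ->
    forall j, normc (Num.max (p j) 0)%:C <= C * u j.
  by move=> h j; rewrite normc_real ger0_norm.
have -> : m = fun j => -1 * (Num.max (- complex.Re (m j)) 0)%:C +
    ('i * (Num.max (complex.Im (m j)) 0)%:C +
    (- 'i * (Num.max (- complex.Im (m j)) 0)%:C + (Num.max (complex.Re (m j)) 0)%:C)).
  apply/funext => j; case: (m j) => p q /=; simpc.
  have maxB (t : R) : Num.max t 0 - Num.max (- t) 0 = t.
    by have [t0|/ltW t0] := leP 0 t; [rewrite (max_idPr _)|rewrite (max_idPl _)];
      rewrite ?oppr_le0 ?oppr_ge0 ?subr0 ?sub0r ?opprK.
  by rewrite -[p in LHS]maxB -[q in LHS]maxB; congr (_ +i* _); ring.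
have d1 := domC _ dRe; have d2 := domC _ dRe'; have d3 := domC _ dIm; have d4 := domC _ dIm'.
have d41 := dominated_comb (- 'i) d4 d1; have d341 := dominated_comb 'i d3 d41.
rewrite (dixmier_functional_comb _ trP d2 d341) (dixmier_functional_comb _ trP d3 d41).
rewrite (dixmier_functional_comb _ trP d4 d1).
rewrite (dixmier_trace_positive _ dRe ml1 om_lim trP) //.
rewrite (dixmier_trace_positive _ dRe' ml2 om_lim trP) //.
rewrite (dixmier_trace_positive _ dIm ml3 om_lim trP) //.
rewrite (dixmier_trace_positive _ dIm' ml4 om_lim trP) //.
by simpc; congr (_ +i* _); ring.
Qed.

(** * The zeta function near its pole *)

Section power.
Variable sg : R.
Hypothesis sg_gt0 : 0 < sg.
(** Here [sg] stands for [s - 1]. Up to the powers [sg] of [b1] and [b2], which tend to 1 as [sg]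
    tends to 0, the power [sg] of [u j] is [z ^+ lev j]. *)
Let z := expR (- (th * sg)).

Lemma rate_itv : 0 <= z < 1.
Proof. by rewrite expR_ge0 expR_lt1 oppr_lt0 mulr_gt0. Qed.

Lemma powR_level b l : 0 < b ->
  (b * expR (- (th * l%:R))) `^ sg = b `^ sg * z ^+ l.
Proof.
move=> b0; rewrite powRM ?expR_ge0 ?(ltW b0) // -expRM /z -expRM_natr.
by congr (_ * expR _); ring.
Qed.

Lemma powR_u_le j : u j `^ sg <= b2 `^ sg * z ^+ lev j.
Proof.
rewrite -powR_level //; apply: ge0_ler_powR; rewrite ?nnegrE ?(ltW sg_gt0) //.
  by rewrite ltW // u_gt0.
by rewrite mulr_ge0 ?expR_ge0 // ltW.
Qed.

Lemma powR_u_ge j : b1 `^ sg * z ^+ lev j <= u j `^ sg.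
Proof.
rewrite -powR_level //; apply: ge0_ler_powR; rewrite ?nnegrE ?(ltW sg_gt0) //.
  by rewrite mulr_ge0 ?expR_ge0 // ltW.
by rewrite ltW // u_gt0.
Qed.

Lemma sum_level_weight (r : J -> R) n :
  \sum_(j <- below n) z ^+ lev j * r j = \sum_(l < n) z ^+ l * \sum_(j <- Lv l) r j.
Proof.
rewrite sum_below; apply: eq_bigr => l _; rewrite mulr_sumr big_seq [RHS]big_seq.
by apply: eq_bigr => j; rewrite mem_Lv => /eqP->.
Qed.

Lemma geometric_le n : \sum_(l < n) z ^+ l <= (1 - z)^-1.
Proof.
have /andP[z0 z1] := rate_itv; rewrite -[leRHS]mulr1 ler_pdivlMl ?subr_gt0 //.
by rewrite geometric_sum lerBlDr lerDl exprn_ge0.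
Qed.

(** Any [n] with [z ^+ n <= 1 - z] will do; a loss of 1 is harmless because it is later multiplied
    by [sg]. *)
Lemma geometric_ge : exists n, (1 - z)^-1 - 1 <= \sum_(l < n) z ^+ l.
Proof.
have /andP[z0 z1] := rate_itv; have zz : 0 < 1 - z by rewrite subr_gt0.
have zn0 : z ^+ n @[n --> \oo] --> (0 : R) by apply: cvg_expr; rewrite ger0_norm.
move/cvgrPdist_lt: zn0 => /(_ _ zz)[n _ /(_ _ (leqnn n))] /=.
rewrite sub0r normrN ger0_norm ?exprn_ge0 // => /ltW zn.
exists n; rewrite -(ler_pM2l zz) geometric_sum mulrBr mulr1 mulfV ?gt_eqF //.
by rewrite lerD2l lerN2.
Qed.

Section residue_bounds.
Variables (r : J -> R) (l e K : R).
Hypotheses (r_ge0 : forall j, 0 <= r j) (l_ge0 : 0 <= l) (e_ge0 : 0 <= e).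
Hypothesis rK : forall n, `|\sum_(j <- below n) r j - n%:R * l| <= e * n%:R + K.

Let G := (1 - z)^-1.

Lemma weighted_sum_itv n :
  l * (\sum_(i < n) z ^+ i) - e * G - K <= \sum_(j <- below n) z ^+ lev j * r j <=
  (l + e) * G + K.
Proof.
have aK p : `|\sum_(i < p) \sum_(j <- Lv i) r j - p%:R * l| <= e * p%:R + K.
  by rewrite -sum_below.
have := @abel_mean _ (fun i => \sum_(j <- Lv i) r j) _ _ _ _ rate_itv aK n; rewrite sum_level_weight.
set P := \sum_(i < n) _ * _; set g := \sum_(i < n) _.
have gG : g <= G := geometric_le n.
have lg := ler_wpM2l l_ge0 gG; have eg := ler_wpM2l e_ge0 gG.
by rewrite ler_norml => /andP[h1 h2]; apply/andP; split; lra.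
Qed.

Lemma power_sum_le (F : seq J) : uniq F ->
  \sum_(j <- F) r j * u j `^ sg <= b2 `^ sg * ((l + e) * G + K).
Proof.
move=> uF; have [n Fn] := sub_below F.
apply: (@le_trans _ _ (\sum_(j <- below n) r j * u j `^ sg)).
  apply: ler_sum_uniq => // [j|j /Fn ->//]; by rewrite mulr_ge0 // powR_ge0.
apply: (@le_trans _ _ (b2 `^ sg * \sum_(j <- below n) z ^+ lev j * r j)).
  rewrite mulr_sumr; apply: ler_sum => j _; rewrite mulrA [leRHS]mulrC.
  by rewrite ler_wpM2l // powR_u_le.
by rewrite ler_wpM2l ?powR_ge0 //; have /andP[] := weighted_sum_itv n.
Qed.

Lemma power_esum_itv :
  b1 `^ sg * (l * G - e * G - (K + l)) <=
  fine (\esum_(j in setT) (r j * u j `^ sg)%:E) <= b2 `^ sg * ((l + e) * G + K).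
Proof.
have v0 j : 0 <= r j * u j `^ sg by rewrite mulr_ge0 // powR_ge0.
have fin := esum_fin v0 power_sum_le.
apply/andP; split; rewrite -lee_fin fineK //; last first.
  by apply: esum_seq_le => // F uF; rewrite lee_fin power_sum_le.
have [n nP] := geometric_ge.
apply: le_trans (esum_seq_ge (below_uniq n) v0); rewrite lee_fin.
apply: (@le_trans _ _ (b1 `^ sg * \sum_(j <- below n) z ^+ lev j * r j)).
  rewrite ler_wpM2l ?powR_ge0 //; have /andP[h _] := weighted_sum_itv n.
  by apply: le_trans h; have := ler_wpM2l l_ge0 nP; rewrite mulrBr mulr1 -/G; lra.
rewrite mulr_sumr; apply: ler_sum => j _; rewrite mulrA [leLHS]mulrC.
by rewrite ler_wpM2l // powR_u_ge.
Qed.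

(** Multiplying by [sg] turns [G] into a number between [1 / th] and [1 / th + sg], and gives the
    bounded error a factor [sg]. *)
Lemma residue_itv :
  b1 `^ sg * (l / th - e * (th^-1 + sg) - sg * (K + l)) <=
  sg * fine (\esum_(j in setT) (r j * u j `^ sg)%:E) <=
  b2 `^ sg * ((l + e) * (th^-1 + sg) + sg * K).
Proof.
have /andP[lo up] := power_esum_itv; have /andP[z0 z1] := rate_itv.
have zz : 0 < 1 - z by rewrite subr_gt0.
have /andP[y1 y2] := oneB_expRN_bounds (mulr_gt0 th_gt0 sg_gt0); rewrite -/z in y1 y2.
have G1 : th^-1 <= sg * G.
  by rewrite /G ler_pdivlMr // ler_pdivrMl.
have G2 : sg * G <= th^-1 + sg.
  rewrite /G ler_pdivrMr //; have p : 0 < 1 + th * sg by rewrite addr_gt0 // mulr_gt0.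
  have -> : th^-1 + sg = (1 + th * sg) / th by field; rewrite gt_eqF.
  rewrite mulrAC ler_pdivlMr //; move: y1; rewrite ler_pdivrMr //; lra.
apply/andP; split.
  apply: le_trans (ler_wpM2l (ltW sg_gt0) lo); rewrite mulrCA ler_wpM2l ?powR_ge0 //.
  have -> : sg * (l * G - e * G - (K + l)) = l * (sg * G) - e * (sg * G) - sg * (K + l) by ring.
  have := ler_wpM2l l_ge0 G1; have := ler_wpM2l e_ge0 G2; lra.
apply: le_trans (ler_wpM2l (ltW sg_gt0) up) _; rewrite mulrCA ler_wpM2l ?powR_ge0 //.
rewrite mulrDr lerD2r mulrCA ler_wpM2l // addr_ge0 //.
Qed.

End residue_bounds.

Lemma power_dominated (m : J -> R[i]) C : (forall j, normc (m j) <= C * u j) ->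
  forall j, normc (m j * (u j `^ sg)%:C) <= (C * b2 `^ sg) * u j.
Proof.
move=> mC j; rewrite normcM normc_real ger0_norm ?powR_ge0 //.
rewrite mulrAC ler_pM ?normc_ge0 ?powR_ge0 //; apply: le_trans (powR_u_le j) _.
have /andP[z0 z1] := rate_itv.
by rewrite ler_piMr ?powR_ge0 // exprn_ile1 // ltW.
Qed.

Lemma power_trace_class (m : J -> R[i]) C : (forall j, normc (m j) <= C * u j) ->
  trace_class (mulop (fun j => m j * (u j `^ sg)%:C)).
Proof.
move=> mC; have m_van := dominated_vanishing (power_dominated mC).
split; first exact: mulop_compact.
have [s [ss _ s_bd]] := mulop_singular_values m_van; exists s => //.
have [s0 _ _] := ss; have [Z Z0 ZP] := dominated_sum mC.
(* The linear bound is read as mean 0 with slope error [Z], in the format of [power_sum_le]. *)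
have ZP' n : `|\sum_(j <- below n) normc (m j) - n%:R * 0| <= Z * n%:R + 0.
  by rewrite mulr0 subr0 addr0 ger0_norm // sumr_ge0 // => j _; exact: normc_ge0.
have bd := power_sum_le (fun j => normc_ge0 (m j)) (lexx 0) Z0 ZP'.
apply: nondecreasing_is_cvgn.
  by apply: nondecreasing_series => n _ _; exact: s0.
exists (b2 `^ sg * ((0 + Z) / (1 - z) + 0) + 1) => _ [n _ <-].
rewrite seriesEord; have n0 : 0 < (n.+1%:R : R)^-1 by rewrite invr_gt0.
(* Values off [F] are below [1 / n.+1], so [n] of them add at most 1; this is the final summand of
   the bound. *)
have [F FP] := m_van _ n0; apply: le_trans (s_bd n (undup F) _ (ltW n0) _) _.
  by move=> j; rewrite mem_undup leNgt => jF; apply/negP => /ltW/FP; exact/negP.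
apply: lerD.
  have := bd _ (undup_uniq F); congr (_ <= _); apply: eq_bigr => j _.
  by rewrite normcM normc_real ger0_norm ?powR_ge0.
by rewrite ler_pdivrMr // mul1r ler_nat.
Qed.

End power.

(** For a fixed slope error [e] the bounds of [residue_itv] converge to [(l - e) / th] and
    [(l + e) / th]; [e] is taken so that [e / th] is [eta / 4]. *)
Lemma zeta_residue_positive (r : J -> R) l : (forall j, 0 <= r j) ->
  mean_limit (fun n => \sum_(j <- below n) r j) l ->
  (s - 1) * fine (\esum_(j in setT) (r j * u j `^ (s - 1))%:E) @[s --> 1^'+] --> l / th.
Proof.
move=> r0 ml; have l0 : 0 <= l by apply: mean_limit_ge0 ml => n; exact: sumr_ge0.
apply/cvgrPdist_le => eta eta0; pose e := th * eta / 4.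
have e0 : 0 < e by rewrite divr_gt0 // mulr_gt0.
have [K KP] := ml _ e0.
have e4 : 0 < eta / 4 by rewrite divr_gt0.
have eth : e / th = eta / 4 by rewrite /e mulrAC [th * _]mulrC mulfK ?gt_eqF.
have s0 : s - 1 @[s --> (1 : R)^'+] --> (0 : R).
  apply: cvg_at_right_filter; rewrite -[X in _ --> X](subrr 1).
  by apply: cvgB; [exact: cvg_id|exact: cvg_cst].
have pw b : 0 < b -> b `^ (s - 1) @[s --> (1 : R)^'+] --> (1 : R).
  move=> b0; rewrite /powR gt_eqF // -[X in _ --> X]expR0.
  apply: continuous_cvg; first exact: continuous_expR.
  by rewrite -[X in _ --> X](mul0r (ln b)); apply: cvgM => //; exact: cvg_cst.
have up : b2 `^ (s - 1) * ((l + e) * (th^-1 + (s - 1)) + (s - 1) * K)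
    @[s --> (1 : R)^'+] --> (l / th + eta / 4).
  have -> : l / th + eta / 4 = 1 * ((l + e) * (th^-1 + 0) + 0 * K) by rewrite -eth; ring.
  apply: cvgM; first exact: pw.
  apply: cvgD; last by apply: cvgM => //; exact: cvg_cst.
  by apply: cvgM; [exact: cvg_cst|apply: cvgD => //; exact: cvg_cst].
have lo : b1 `^ (s - 1) * (l / th - e * (th^-1 + (s - 1)) - (s - 1) * (K + l))
    @[s --> (1 : R)^'+] --> (l / th - eta / 4).
  have -> : l / th - eta / 4 = 1 * (l / th - e * (th^-1 + 0) - 0 * (K + l)) by rewrite -eth; ring.
  apply: cvgM; first exact: pw.
  apply: cvgB; last by apply: cvgM => //; exact: cvg_cst.
  apply: cvgB; first exact: cvg_cst.
  by apply: cvgM; [exact: cvg_cst|apply: cvgD => //; exact: cvg_cst].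
near=> s; have sg0 : 0 < s - 1.
  by rewrite subr_gt0; near: s; exact: nbhs_right_gt.
have /andP[h1 h2] := residue_itv sg0 r0 l0 (ltW e0) KP.
have hu : `|(l / th + eta / 4) - b2 `^ (s - 1) * ((l + e) * (th^-1 + (s - 1)) + (s - 1) * K)| <= eta / 4.
  by near: s; move/cvgrPdist_le: up; exact.
have hl : `|(l / th - eta / 4) - b1 `^ (s - 1) * (l / th - e * (th^-1 + (s - 1)) - (s - 1) * (K + l))| <= eta / 4.
  by near: s; move/cvgrPdist_le: lo; exact.
move: hu hl h1 h2; set X := b2 `^ _ * _; set Y := b1 `^ _ * _; set F := (s - 1) * fine _.
set q := l / th; rewrite !ler_norml => /andP[? ?] /andP[? ?] ? ?.
by apply/andP; split; lra.
Unshelve. all: by end_near. Qed.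

Lemma op_trace_residue (m : J -> R[i]) C l1 l2 l3 l4 :
  (forall j, normc (m j) <= C * u j) ->
  mean_limit (fun n => \sum_(j <- below n) Num.max (complex.Re (m j)) 0) l1 ->
  mean_limit (fun n => \sum_(j <- below n) Num.max (- complex.Re (m j)) 0) l2 ->
  mean_limit (fun n => \sum_(j <- below n) Num.max (complex.Im (m j)) 0) l3 ->
  mean_limit (fun n => \sum_(j <- below n) Num.max (- complex.Im (m j)) 0) l4 ->
  (fun s : R => (s - 1)%:C * op_trace (mulop (fun j => m j * (u j `^ (s - 1))%:C)) : R[i]^o)
    @ 1^'+ --> (((l1 - l2) / th) +i* ((l3 - l4) / th) : R[i]^o).
Proof.
move=> mC ml1 ml2 ml3 ml4.
have rsumE (p : J -> R) (s : R) :
    rsum (fun j => p j * u j `^ (s - 1)) =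
    fine (\esum_(j in setT) (Num.max (p j) 0 * u j `^ (s - 1))%:E) -
    fine (\esum_(j in setT) (Num.max (- p j) 0 * u j `^ (s - 1))%:E).
  rewrite /rsum; congr (fine _ - fine _); apply: eq_esum => j _; congr (_%:E).
    by rewrite maxr_pMl ?powR_ge0 // mul0r.
  by rewrite maxr_pMl ?powR_ge0 // mul0r mulNr.
have res (p : J -> R) k1 k2 :
    mean_limit (fun n => \sum_(j <- below n) Num.max (p j) 0) k1 ->
    mean_limit (fun n => \sum_(j <- below n) Num.max (- p j) 0) k2 ->
    (s - 1) * rsum (fun j => p j * u j `^ (s - 1)) @[s --> 1^'+] --> (k1 - k2) / th.
  move=> mk1 mk2; under eq_fun do rewrite rsumE mulrBr.
  by rewrite mulrBl; apply: cvgB; apply: zeta_residue_positive => // j; rewrite le_max lexx orbT.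
have tr s : 1 < s -> (s - 1)%:C * op_trace (mulop (fun j => m j * (u j `^ (s - 1))%:C)) =
    ((s - 1) * rsum (fun j => complex.Re (m j) * u j `^ (s - 1)))
    +i* ((s - 1) * rsum (fun j => complex.Im (m j) * u j `^ (s - 1))).
  rewrite -subr_gt0 => sg0; have dom := power_dominated sg0 mC.
  have [D mD] := vanishing_bounded (dominated_vanishing dom).
  rewrite (op_trace_mulop mD) /csum; simpc; congr (_ +i* _); congr (_ * rsum _).
    by apply/funext => i; case: (m i) => a b /=; ring.
  by apply/funext => i; case: (m i) => a b /=; ring.
have trn : \forall s \near (1 : R)^'+, ((s - 1) * rsum (fun j => complex.Re (m j) * u j `^ (s - 1)))
    +i* ((s - 1) * rsum (fun j => complex.Im (m j) * u j `^ (s - 1))) =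
   (s - 1)%:C * op_trace (mulop (fun j => m j * (u j `^ (s - 1))%:C)).
  by near=> s; rewrite tr //; near: s; exact: nbhs_right_gt.
have cv : (fun s : R => ((s - 1) * rsum (fun j => complex.Re (m j) * u j `^ (s - 1)))
    +i* ((s - 1) * rsum (fun j => complex.Im (m j) * u j `^ (s - 1))) : R[i]^o)
    @ 1^'+ --> (((l1 - l2) / th) +i* ((l3 - l4) / th) : R[i]^o).
  by apply: cvg_complex => /=; exact: res.
move=> A /cv; apply: filterS2 trn => s E /=; by rewrite E.
Unshelve. all: by end_near. Qed.

End geometric_levels.

(** * Paths of the stationary Bratteli diagram *)

Section path_enumeration.
Variables (k : nat) (V : finType) (L : kgraph k V).
Implicit Types (p q : bpath L) (e : bedge L) (y z : ipath L).

Lemma bchain_rcons n v (es : seq (bedge L)) e :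
  bchain n v (rcons es e) = [&& bchain n v es, ecol e == ((n + size es) %% k)%N :> nat
    & erng e == last v [seq esrc e | e <- es]].
Proof.
elim: es n v => [|a es IH] n v /=; first by rewrite addn0 andbT.
by rewrite IH addSnnS !andbA.
Qed.

Definition extends q e : bool := (ecol e == (plen q %% k)%N :> nat) && (erng e == psrc q).

(** The default [q] is returned for an edge that does not fit; [extends] guards against it. *)
Definition extend q e : bpath L := insubd q (prng q, rcons (pedges q) e).

Lemma val_extend q e : extends q e -> val (extend q e) = (prng q, rcons (pedges q) e).
Proof.
move=> /andP[h1 h2]; apply: insubdK.
suff : bchain 0 (prng q) (rcons (pedges q) e) by [].
by rewrite bchain_rcons add0n h1 h2 !andbT; exact: valP q.
Qed.

Lemma plen_extend q e : extends q e -> plen (extend q e) = (plen q).+1.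
Proof. by move=> ok; rewrite /plen /pedges val_extend //= size_rcons. Qed.

Lemma psrc_extend q e : extends q e -> psrc (extend q e) = esrc e.
Proof. by move=> ok; rewrite /psrc /pedges /prng val_extend //= map_rcons last_rcons. Qed.

Fixpoint paths n : seq (bpath L) :=
  if n is n'.+1 then
    [seq extend q e | q <- paths n', e <- [seq e <- enum {: bedge L} | extends q e]]
  else [seq vpath L v | v <- enum V].

Lemma mem_paths n p : (p \in paths n) = (plen p == n).
Proof.
elim: n p => [|n IH] p /=.
  apply/mapP/eqP => [[v _ ->]//|]; case: p => -[v es] /= h; rewrite /plen /pedges /=.
  move=> /size0nil es0; move: h; rewrite es0 => h.
  by exists v; [rewrite mem_enum|apply: val_inj].
apply/allpairsPdep/eqP => [[q [e [qn]]]|pn].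
  rewrite mem_filter => /andP[ok _] ->; rewrite plen_extend //.
  by move: qn; rewrite IH => /eqP->.
case: p pn => -[v es] /= h; rewrite /plen /pedges /=.
case/lastP: es h => [//|es e] h; rewrite size_rcons => -[sn].
have /and3P[h1 h2 h3] : [&& bchain 0 v es, ecol e == (size es %% k)%N :> nat
    & erng e == last v [seq esrc e | e <- es]] by move: (h); rewrite bchain_rcons.
pose q : bpath L := exist _ (v, es) h1.
have ok : extends q e by rewrite /extends h2 h3.
exists q, e; split; first by rewrite IH /plen /pedges /= sn.
  by rewrite mem_filter ok mem_enum.
by apply: val_inj; rewrite val_extend.
Qed.

Lemma paths_uniq n : uniq (paths n).
Proof.
elim: n => [|n IH] /=.
  by rewrite map_inj_uniq ?enum_uniq // => v w [].
apply: allpairs_uniq_dep => [//|q _|].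
  by rewrite filter_uniq // enum_uniq.
move=> [q e] [q' e'] /allpairsPdep[a [b [_ + [-> ->]]]].
rewrite mem_filter => /andP[ok _] /allpairsPdep[a' [b' [_ + [-> ->]]]].
rewrite mem_filter => /andP[ok' _] /= /(congr1 val); rewrite !val_extend //.
case=> rr /rcons_inj[ee ->]; congr (existT _ _ _); apply: val_inj.
by rewrite [LHS]surjective_pairing [RHS]surjective_pairing; congr (_, _).
Qed.

Lemma sum_pathsS (R : nmodType) n (P : pred (bpath L)) (F : bpath L -> R) :
  \sum_(q <- paths n.+1 | P q) F q =
  \sum_(q <- paths n) \sum_(e | extends q e && P (extend q e)) F (extend q e).
Proof.
rewrite [LHS]big_mkcond /= big_allpairs_dep /=; apply: eq_bigr => q _.
by rewrite big_filter big_enum_cond /= -big_mkcondr.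
Qed.

Lemma initial_segment_extend p q e : extends q e -> (plen p <= plen q)%N ->
  initial_segment p (extend q e) = initial_segment p q.
Proof.
move=> ok pq; rewrite /initial_segment /prng /pedges val_extend //=; congr (_ && _).
by rewrite !prefixE -cats1 takel_cat.
Qed.

Lemma initial_segment_size p q : initial_segment p q -> (plen p <= plen q)%N.
Proof. by move=> /andP[_ /prefixP[s pq]]; rewrite /plen pq size_cat leq_addr. Qed.

Lemma initial_segment_iprefix y n l : (n <= l)%N ->
  initial_segment (iprefix y n) (iprefix y l).
Proof.
move=> nl; rewrite /initial_segment eqxx /= /pedges /= prefixE size_mkseq.
by rewrite /mkseq -map_take take_iota (minn_idPl nl).
Qed.

Lemma plen_iprefix y n : plen (iprefix y n) = n.
Proof. by rewrite /plen /pedges /= size_mkseq. Qed.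

Lemma initial_segment_inj p p' q : initial_segment p q -> initial_segment p' q ->
  plen p = plen p' -> p = p'.
Proof.
move=> /andP[/eqP r1]; rewrite prefixE => /eqP e1 /andP[/eqP r2].
rewrite prefixE => /eqP e2 pp; apply: val_inj.
have ee : pedges p = pedges p' by rewrite -e1 -e2 /plen in pp *; rewrite pp.
rewrite [LHS]surjective_pairing [RHS]surjective_pairing; congr (_, _) => //.
exact: etrans (esym r2).
Qed.

Lemma initial_segment_refl p : initial_segment p p.
Proof. by rewrite /initial_segment eqxx prefix_refl. Qed.

Lemma bchain_take n v (es : seq (bedge L)) N : bchain n v es -> bchain n v (take N es).
Proof. by elim: es n v N => [|a es IH] n v [|N] //= /and3P[-> -> /IH->]. Qed.

Lemma initial_segment_ex q N : (N <= plen q)%N ->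
  exists2 p, plen p = N & initial_segment p q.
Proof.
move=> Nq; pose p : bpath L := exist _ (prng q, take N (pedges q)) (bchain_take N (valP q)).
by exists p; rewrite ?/plen /= ?/pedges /= ?size_takel // /initial_segment eqxx /= prefix_take.
Qed.

(** Every path of length [l] has exactly one initial segment of length [N]. *)
Lemma sum_paths_split (R : nmodType) N l (F : bpath L -> R) : (N <= l)%N ->
  \sum_(q <- paths l) F q =
  \sum_(p <- paths N) \sum_(q <- paths l | initial_segment p q) F q.
Proof.
move=> Nl; under [RHS]eq_bigr do rewrite big_mkcond.
rewrite exchange_big /= big_seq [RHS]big_seq; apply: eq_bigr => q.
rewrite mem_paths => /eqP ql; rewrite -big_mkcond /=.
have [p pN pq] : exists2 p, plen p = N & initial_segment p q.
  by apply: initial_segment_ex; rewrite ql.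
have ip i : i \in paths N -> initial_segment i q = (i == p).
  rewrite mem_paths => /eqP iN; apply/idP/eqP => [iq|->//].
  by apply: initial_segment_inj iq pq _; rewrite iN pN.
rewrite big_seq_cond (eq_bigl (fun i => (i \in paths N) && (i == p))) => [|i]; last first.
  by case: (boolP (i \in paths N)) => // /ip->.
rewrite -big_seq_cond -big_filter filter_pred1_uniq ?paths_uniq ?mem_paths ?pN //.
by rewrite big_seq1.
Qed.

End path_enumeration.

(** * Transfer matrices between levels *)

Section transfer.
Variables (R : realType) (k : nat) (V : finType) (L : kgraph k V).
Implicit Types (p q : bpath L) (e : bedge L).

Definition level_color (n : nat) : 'I_k := Ordinal (ltn_pmod n (rank_gt0 L)).

Definition level_mx (n : nat) : 'M[R]_#|V| := adjmx R L (level_color n).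

(** The entries count the paths between vertices of levels [n] and [l]; for [l <= n] this is the
    identity. *)
Definition transfer_mx (n l : nat) : 'M[R]_#|V| := \prod_(n <= i < l) level_mx i.

Definition at_source (phi : 'cV[R]_#|V|) p : R := phi (enum_rank (psrc p)) 0.

Lemma sum_extends (phi : 'cV[R]_#|V|) q :
  \sum_(e | extends q e) phi (enum_rank (esrc e)) 0 = at_source (level_mx (plen q) *m phi) q.
Proof.
rewrite /at_source mxE; set c := level_color (plen q); set u := psrc q.
under [RHS]eq_bigr do rewrite mxE enum_rankK.
rewrite (reindex (@enum_rank V)) /=; last first.
  by exists enum_val => v _; rewrite ?enum_valK ?enum_rankK.
under [RHS]eq_bigr do rewrite enum_rankK.
transitivity (\sum_(d : 'I_k * V * V | (d.1 == (c, u))) \sum_(j < adj L d.1.1 d.1.2 d.2)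
    phi (enum_rank d.2) 0).
  rewrite sig_big_dep /=; apply: eq_bigl => -[[[i v] w] j] /=.
  by rewrite /extends /ecol /erng /= andbT.
transitivity (\sum_(d : 'I_k * V * V | d.1 == (c, u))
    phi (enum_rank d.2) 0 *+ adj L d.1.1 d.1.2 d.2).
  by apply: eq_bigr => d _; rewrite sumr_const card_ord.
rewrite (eq_bigl (fun d : 'I_k * V * V => pred1 (c, u) d.1 && true)) => [|d]; last first.
  by rewrite /= andbT.
rewrite -(pair_big_dep (pred1 (c, u)) (fun _ _ => true)
  (fun (d : 'I_k * V) v => phi (enum_rank v) 0 *+ adj L d.1 d.2 v)) /= big_pred1_eq.
by apply: eq_bigr => v _; rewrite mulr_natl.
Qed.

Lemma sum_paths_self p (F : bpath L -> R) :
  \sum_(q <- paths L (plen p) | initial_segment p q) F q = F p.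
Proof.
rewrite big_seq_cond (eq_bigl (fun q => (q \in paths L (plen p)) && (q == p))) => [|q].
  rewrite -big_seq_cond -big_filter filter_pred1_uniq ?paths_uniq ?mem_paths //.
  by rewrite big_seq1.
rewrite mem_paths; case: eqVneq => //= qp; apply/idP/eqP => [pq|->]; last first.
  exact: initial_segment_refl.
by apply/esym/(initial_segment_inj pq (initial_segment_refl q)).
Qed.

Lemma transfer_mxS n l : (n <= l)%N -> transfer_mx n l.+1 = transfer_mx n l *m level_mx l.
Proof. by move=> nl; rewrite /transfer_mx big_nat_recr. Qed.

(** The last edge is peeled off and its level matrix absorbed into [phi], whence the induction for
    all [phi]. *)
Lemma sum_extensions p l (phi : 'cV[R]_#|V|) : (plen p <= l)%N ->
  \sum_(q <- paths L l | initial_segment p q) at_source phi q =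
  at_source (transfer_mx (plen p) l *m phi) p.
Proof.
elim: l phi => [|l IH] phi; last rewrite leq_eqVlt => /predU1P[pl|pl].
- rewrite leqn0 => /eqP p0; rewrite /transfer_mx big_geq // mul1mx.
  by have := sum_paths_self p (at_source phi); rewrite p0.
- by rewrite -pl /transfer_mx big_geq // mul1mx; exact: sum_paths_self.
rewrite sum_pathsS transfer_mxS // -mulmxA -IH // [RHS]big_mkcond /=.
rewrite big_seq [RHS]big_seq; apply: eq_bigr => q; rewrite mem_paths => /eqP ql.
rewrite (eq_bigl (fun e => extends q e && initial_segment p q)) => [|e]; last first.
  by case: (boolP (extends q e)) => // ok /=; rewrite initial_segment_extend // ql.
case: ifP => _; last by rewrite big_pred0 // => e; rewrite andbF.
rewrite -ql -sum_extends; apply: eq_big => [e|e]; rewrite andbT //.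
by move=> ok; rewrite /at_source psrc_extend.
Qed.

End transfer.

Lemma scale_expmx (R : comRingType) n (a : R) (A : 'M[R]_n) q :
  (a *: A) ^+ q = a ^+ q *: A ^+ q.
Proof.
elim: q => [|q IH]; first by rewrite !expr0 scale1r.
by rewrite !exprS IH -!mulmxE -scalemxAl -scalemxAr scalerA.
Qed.

(** * Mean mass of the extensions of a path *)

Section perron.
Variables (R : realType) (k : nat) (V : finType) (L : kgraph k V) (x : V -> R).
Hypotheses (x_gt0 : forall v, 0 < x v)
  (x_eigen : forall i v, \sum_w (adj L i v w)%:R * x w = rho R L i * x v).
Local Notation rp := (rho_pow R L).

Let k_gt0 : (0 < k)%N := rank_gt0 L.

Lemma rho_powS l : rp l.+1 = rp l * rho R L (level_color L l).
Proof.
have e_split (i : 'I_k) : (l.+1 %/ k + (i < l.+1 %% k) =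
    l %/ k + (i < l %% k) + (i == l %% k :> nat))%N.
  have := ltn_ord i; have := ltn_pmod l k_gt0; have := divn_eq l k.
  set q := (l %/ k)%N; set t := (l %% k)%N => le tk ik.
  (* When [l.+1] completes a period the quotient grows by one and the remainder drops to 0; in both
     cases only the exponent of colour [l %% k] changes. *)
  have [e|ne] := eqVneq t.+1 k.
    have -> : (l.+1 %/ k = q.+1)%N by rewrite le -addnS e -mulSnr mulnK.
    have -> : (l.+1 %% k = 0)%N by rewrite le -addnS e -mulSnr modnMl.
    rewrite ltn0; have : (i <= t)%N by rewrite -ltnS e.
    by rewrite leq_eqVlt; case: ltngtP => //= _ _; rewrite ?addn0 ?addn1.
  have tk' : (t.+1 < k)%N by rewrite ltn_neqAle ne.
  have -> : (l.+1 %/ k = q)%N by rewrite le -addnS divnMDl // divn_small // addn0.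
  have -> : (l.+1 %% k = t.+1)%N by rewrite le -addnS modnMDl modn_small.
  by rewrite ltnS leq_eqVlt -addnA; case: ltngtP.
set c := level_color L l; rewrite /rho_pow.
transitivity (\prod_(i < k) (rho R L i ^+ (l %/ k + (i < l %% k)%N) *
    (if i == c then rho R L i else 1))).
  apply: eq_bigr => i _; rewrite e_split exprD; congr (_ * _).
  by rewrite -[(i == _ :> nat)]/(i == c); case: eqP.
by rewrite big_split /= -big_mkcond /= big_pred1_eq.
Qed.

Lemma rho_powDk n l : rp (n * k + l) = rp k ^+ n * rp l.
Proof.
elim: n => [|n IH]; first by rewrite expr0 mul1r.
rewrite mulSn -addnA exprS -mulrA -IH /rho_pow -big_split /=; apply: eq_bigr => i _.
rewrite divnDl // modnDl divnn k_gt0 modnn ltn0 addn0 expr1 -exprS.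
by rewrite -addnA.
Qed.

Lemma rho_pow0 : rp 0 = 1.
Proof. by rewrite /rho_pow big1 // => i _; rewrite div0n mod0n. Qed.

(** Both sides of the eigenvector equation at [v] are compared in sign; the supremum defining [rho]
    is not examined. *)
Lemma rho_ge0 (v : V) i : 0 <= rho R L i.
Proof.
rewrite -(pmulr_lge0 _ (x_gt0 v)) -x_eigen sumr_ge0 // => w _.
by rewrite mulr_ge0 // ltW.
Qed.

Let xv : 'cV[R]_#|V| := \col_a x (enum_val a).

Lemma level_mx_perron n : level_mx R L n *m xv = rho R L (level_color L n) *: xv.
Proof.
apply/colP => a; rewrite !mxE -x_eigen (reindex (@enum_val V predT)) /=; last first.
  by exists enum_rank => v _; rewrite ?enum_valK ?enum_rankK.
by apply: eq_bigr => b _; rewrite !mxE.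
Qed.

Lemma transfer_mx_perron l : transfer_mx R L 0 l *m xv = rp l *: xv.
Proof.
elim: l => [|l IH]; first by rewrite /transfer_mx big_geq // mul1mx rho_pow0 scale1r.
by rewrite transfer_mxS // -mulmxA level_mx_perron -scalemxAr IH scalerA mulrC rho_powS.
Qed.

Lemma level_mx_period n i : level_mx R L (i + n * k) = level_mx R L i.
Proof. by congr adjmx; apply: val_inj; rewrite /= addnC modnMDl. Qed.

Lemma transfer_mx_period n l : transfer_mx R L (n * k) (n * k + l) = transfer_mx R L 0 l.
Proof.
rewrite /transfer_mx -{1}[(n * k)%N]add0n big_addn addKn.
by apply: eq_bigr => i _; rewrite level_mx_period.
Qed.

Lemma transfer_mxDk n l :
  transfer_mx R L 0 (n * k + l) = transfer_mx R L 0 k ^+ n *m transfer_mx R L 0 l.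
Proof.
elim: n => [|n IH]; first by rewrite expr0 mul1mx.
rewrite exprS mulmxE -mulrA -mulmxE -IH mulSn -addnA.
rewrite -[in RHS](transfer_mx_period 1 (n * k + l)) mul1n.
by rewrite /transfer_mx mulmxE -big_cat_nat ?leq_addr.
Qed.

Lemma transfer_mx_ge0 n l a b : 0 <= (transfer_mx R L n l) a b.
Proof.
have [ln|nl] := leqP l n; first by rewrite /transfer_mx big_geq // mxE; case: eqP.
elim: l nl a b => // l IH; rewrite ltnS leq_eqVlt => /predU1P[->|nl] a b.
  by rewrite transfer_mxS // /transfer_mx big_geq // mul1mx mxE.
rewrite transfer_mxS ?(ltnW nl) // mxE sumr_ge0 // => c _.
by rewrite mulr_ge0 ?IH // mxE.
Qed.

Hypothesis rp_gt0 : forall n, 0 < rp n.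
Hypothesis irr : irreducible_mx (\prod_(i < k) adjmx R L i).

(** One period of the diagram, divided by the product of the spectral radii so as to fix [xv]. *)
Let B : 'M[R]_#|V| := (rp k)^-1 *: transfer_mx R L 0 k.

Lemma transfer_mx_prod : transfer_mx R L 0 k = \prod_(i < k) adjmx R L i.
Proof.
rewrite /transfer_mx big_mkord; apply: eq_bigr => i _; congr adjmx; apply: val_inj.
by rewrite /= modn_small.
Qed.

Section observable.
Variable phi : 'cV[R]_#|V|.
Hypothesis phi_ge0 : forall a, 0 <= phi a 0.

(** The coordinate at a vertex sums [phi] over the sources of the paths of length [l] from it,
    divided by [rp l]. In the application [phi] is the power [delta] of the Perron vector. *)
Definition normalized_mass l : 'cV[R]_#|V| := (rp l)^-1 *: (transfer_mx R L 0 l *m phi).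

Lemma normalized_mass_ge0 l a : 0 <= normalized_mass l a 0.
Proof.
rewrite !mxE mulr_ge0 ?invr_ge0 ?(ltW (rp_gt0 _)) // sumr_ge0 // => b _.
by rewrite mulr_ge0 // transfer_mx_ge0.
Qed.

Lemma normalized_massDk n l : normalized_mass (n * k + l) = B ^+ n *m normalized_mass l.
Proof.
rewrite /normalized_mass /B rho_powDk transfer_mxDk scale_expmx -scalemxAl -scalemxAr.
by rewrite scalerA mulmxA invfM exprVn.
Qed.

Lemma normalized_mass_block Q :
  \sum_(l < Q * k) normalized_mass l =
  \sum_(q < Q) B ^+ q *m (\sum_(t < k) normalized_mass t).
Proof.
elim: Q => [|Q IH]; first by rewrite mul0n !big_ord0.
rewrite mulSnr big_split_ord /= IH [RHS]big_ord_recr /=; congr (_ + _).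
by rewrite mulmx_sumr; apply: eq_bigr => t _; rewrite -normalized_massDk.
Qed.

(** Whole periods sum to powers of [B] applied to one vector, the situation of [mean_ergodic]; other
    lengths are caught between multiples of [k], since masses are nonnegative. *)
Lemma normalized_mass_mean : exists alpha K, forall n a,
  `|(\sum_(l < n) normalized_mass l) a 0 - n%:R * (alpha * xv a 0)| <= K.
Proof.
have B_ge0 a b : 0 <= B a b.
  by rewrite mxE mulr_ge0 ?invr_ge0 ?(ltW (rp_gt0 _)) // transfer_mx_ge0.
have xv_gt0 a : 0 < xv a 0 by rewrite mxE.
have Bx : B *m xv = xv.
  by rewrite -scalemxAl transfer_mx_perron scalerA mulVf ?scale1r // gt_eqF.
have B_irr : irreducible_mx B.
  move=> a b; have [m m0 h] := irr a b; exists m => //.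
  by rewrite /B scale_expmx mxE transfer_mx_prod mulr_gt0 // exprn_gt0 // invr_gt0.
have [c [K cK]] := mean_ergodic B_ge0 xv_gt0 Bx B_irr (\sum_(t < k) normalized_mass t).
(* The mean per period is spread over its [k] levels; the second summand absorbs an incomplete
   period. *)
exists (c / k%:R), (K + \sum_a `|c * xv a 0|) => n a.
pose S n := (\sum_(l < n) normalized_mass l) a 0.
have S_mono m m' : (m <= m')%N -> S m <= S m'.
  move=> mm; rewrite /S -(subnK mm) addnC big_split_ord mxE lerDl summxE.
  by apply: sumr_ge0 => i _; exact: normalized_mass_ge0.
have SQ Q : `|S (Q * k)%N - Q%:R * c * xv a 0| <= K.
  by rewrite /S normalized_mass_block -mulmx_suml; have := cK Q a; rewrite -mulmx_suml.
have k0 : 0 < (k%:R : R) by rewrite ltr0n.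
set d := c * xv a 0; rewrite -/(S n).
have dK : `|d| <= \sum_a `|c * xv a 0| by rewrite (bigD1 a) //= lerDl sumr_ge0.
pose Q := (n %/ k)%N; have nE : n%:R = Q%:R * k%:R + (n %% k)%:R :> R.
  by rewrite -natrM -natrD -divn_eq.
have n1 : S (Q * k)%N <= S n by apply: S_mono; rewrite [leqRHS](divn_eq n k) leq_addr.
have n2 : S n <= S (Q.+1 * k)%N.
  by apply: S_mono; rewrite mulSnr [leqLHS](divn_eq n k) leq_add2l ltnW // ltn_pmod.
have h1 := SQ Q; have h2 := SQ Q.+1; rewrite -mulrA -/d in h1; rewrite -mulrA -/d in h2.
pose t : R := (n %% k)%:R / k%:R.
have -> : n%:R * (c / k%:R * xv a 0) = (Q%:R + t) * d.
  by rewrite nE /t /d; field; rewrite gt_eqF.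
have t0 : 0 <= t by rewrite divr_ge0 // ltW.
have t1 : t <= 1 by rewrite ler_pdivrMr // mul1r ler_nat ltnW // ltn_pmod.
have td : `|t * d| <= `|d| by rewrite normrM ger0_norm // ler_piMl.
have td' : `|(1 - t) * d| <= `|d|.
  by rewrite normrM ger0_norm ?subr_ge0 // ler_piMl // lerBlDr lerDl.
rewrite -natr1 in h2.
move: h1 h2 td td' dK n1 n2 t0 t1; move: (\sum_a _) (S n) (S (Q * k)%N) (S _) Q%:R t d.
move=> D s s1 s2 q r e /ler_normlP[? ?] /ler_normlP[? ?] /ler_normlP[? ?].
move=> /ler_normlP[? ?] ? ? ? ? ?. by apply/ler_normlP; split; lra.
Qed.

(** At a level divisible by [k] the colours start anew, so the extensions of [p] look like the paths
    from a vertex of level 0; this makes [alpha] independent of [p]. The factor of [alpha] is the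
    measure of the cylinder. *)
Lemma cylinder_mean : exists alpha, forall n p, plen p = (n * k)%N ->
  exists K, forall N, `|\sum_(l < N) \sum_(q <- paths L l | initial_segment p q)
      (rp l)^-1 * at_source phi q -
    N%:R * (alpha * ((rp (plen p))^-1 * x (psrc p)))| <= K.
Proof.
have [alpha [K aK]] := normalized_mass_mean; exists alpha => n p pn.
have levelE l : (n * k <= l)%N ->
    \sum_(q <- paths L l | initial_segment p q) (rp l)^-1 * at_source phi q =
    (rp k ^+ n)^-1 * normalized_mass (l - n * k) (enum_rank (psrc p)) 0.
  move=> nl; rewrite -mulr_sumr sum_extensions ?pn // -{1 2}(subnKC nl).
  rewrite transfer_mx_period rho_powDk invfM -mulrA; congr (_ * _).
  by rewrite /normalized_mass mxE.
have level0 l : (l < n * k)%N ->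
    \sum_(q <- paths L l | initial_segment p q) (rp l)^-1 * at_source phi q = 0.
  move=> ln; rewrite big_seq_cond big1 // => q; rewrite mem_paths => /andP[/eqP ql].
  by move=> /initial_segment_size; rewrite ql pn leqNgt ln.
have xE : xv (enum_rank (psrc p)) 0 = x (psrc p) by rewrite mxE enum_rankK.
have r0 : 0 < (rp k ^+ n)^-1 by rewrite invr_gt0 exprn_gt0.
set c := (rp k ^+ n)^-1 in levelE r0.
have cE : (rp (plen p))^-1 = c by rewrite pn -[(n * k)%N]addn0 rho_powDk rho_pow0 mulr1.
(* The second summand pays for the levels before [n * k], which contain no extension of [p]. *)
exists (c * K + (n * k)%:R * `|alpha * (c * x (psrc p))|) => N; rewrite cE.
have SE : \sum_(l < N) \sum_(q <- paths L l | initial_segment p q) (rp l)^-1 * at_source phi q =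
    c * (\sum_(l < N - n * k) normalized_mass l) (enum_rank (psrc p)) 0.
  have [nN|Nn] := leqP (n * k) N; last first.
    rewrite (eqP (ltnW Nn)) big_ord0 mxE mulr0 big1 // => l _.
    by rewrite level0 // (ltn_trans (ltn_ord l)).
  pose F l := \sum_(q <- paths L l | initial_segment p q) (rp l)^-1 * at_source phi q.
  transitivity (\sum_(l < n * k + (N - n * k)) F l); first by rewrite subnKC.
  rewrite big_split_ord /= big1 ?add0r => [|l _]; last by rewrite /F level0.
  by rewrite summxE mulr_sumr; apply: eq_bigr => l _; rewrite /F levelE ?leq_addr // addKn.
rewrite SE -xE.
have := aK (N - n * k)%N (enum_rank (psrc p)).
set S := fun_of_matrix (\sum_(l < _) _) _ _; set X := fun_of_matrix xv _ _ => /(ler_wpM2l (ltW r0)) h.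
have -> : c * S - N%:R * (alpha * (c * X)) =
    c * (S - (N - n * k)%:R * (alpha * X)) - (N%:R - (N - n * k)%:R) * (alpha * (c * X)).
  ring.
apply: le_trans (ler_normB _ _) _; apply: lerD.
  by rewrite normrM (ger0_norm (ltW r0)).
rewrite normrM ler_wpM2r //.
have [nN|Nn] := leqP (n * k) N.
  by rewrite natrB // opprB addrC subrK ger0_norm.
by rewrite (eqP (ltnW Nn)) subr0 ger0_norm // ler_nat ltnW.
Qed.

End observable.
End perron.

(** * Continuous functions on the space of infinite paths *)

Section path_space.
Variables (k : nat) (V : finType) (L : kgraph k V).
Implicit Types (p q : bpath L) (y z : ipath L).

Lemma iprefix_eq y z n :
  iprefix y n = iprefix z n <-> irng y = irng z /\ forall i, (i < n)%N -> iedge y i = iedge z i.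
Proof.
split=> [/(congr1 val)[yz e]|[yz e]].
  split=> // i ni; have := congr1 (fun s => nth (iedge y i) s i) e.
  by rewrite !nth_mkseq.
apply: val_inj => /=; rewrite yz; congr (_, _).
by apply/eq_in_map => i; rewrite mem_iota => /andP[_ /e].
Qed.

Lemma iprefix_le y z m n : (m <= n)%N -> iprefix y n = iprefix z n ->
  iprefix y m = iprefix z m.
Proof.
move=> mn /iprefix_eq[yz e]; apply/iprefix_eq; split=> // i im.
by apply: e; exact: leq_trans mn.
Qed.

Lemma cylinder_open p : open (cylinder p).
Proof.
exists [set cylinder p]; last by rewrite bigcup_set1.
move=> _ ->; exists [fset cylinder p]%fset.
  by move=> A; rewrite inE => /eqP->; apply/mem_set; exists p.
by rewrite set_fset1 bigcap_set1.
Qed.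

(** A basic open set is a finite intersection of cylinders, hence determined by the longest prefix
    involved. *)
Lemma nbhs_cylinder z (A : set (ipath L)) : nbhs z A ->
  exists n, forall y, iprefix y n = iprefix z n -> A y.
Proof.
rewrite nbhsE => -[B [[D sD <-] [C DC Cz]] BA].
have [F FD CE] := sD _ DC; have {}CE : \bigcap_(S in [set` F]) S = C := CE.
have {}Cz S : S \in F -> S z by move: (Cz : C z); rewrite -CE; apply.
have /choice[m mP] : forall S : set (ipath L), exists m : nat, S \in F ->
    forall y, iprefix y m = iprefix z m -> S y.
  move=> S; have [SF|SF] := boolP (S \in F); last by exists 0%N.
  have /set_mem[p _ pS] := FD _ SF; exists (plen p) => _ y yz.
  by have := Cz _ SF; rewrite -pS /cylinder /= yz.
exists (\max_(S <- F) m S) => y yz; apply: BA; exists C => //.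
change (C y); rewrite -CE => S SF.
by apply: (mP S SF); apply: iprefix_le yz; exact: leq_bigmax_seq.
Qed.

(* Koenig's lemma: along an ultrafilter every edge of a sequence of paths
   stabilizes, so the sequence converges. *)
Lemma ultra_limit (U : set_system nat) (Y : nat -> ipath L) : UltraFilter U ->
  exists z, forall n, \forall m \near U, iprefix (Y m) n = iprefix z n.
Proof.
move=> UU; have UF : ProperFilter U by exact: ultra_proper.
have lim i : exists e : bedge L, \forall m \near U, iedge (Y m) i = e.
  apply: contrapT => nex.
  have ne e : \forall m \near U, iedge (Y m) i != e.
    have [h|h] := in_ultra_setVsetC [set m | iedge (Y m) i = e] UU.
      by exfalso; apply: nex; exists e.
    by apply: filterS h => m /= /eqP.
  have [m mP] := filter_ex (filter_forall _ ne).
  by have := mP (iedge (Y m) i); rewrite eqxx.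
have /choice[zf zP] := lim.
have z_ok : `[< forall n, ecol (zf n) = (n %% k)%N :> nat /\ esrc (zf n) = erng (zf n.+1) >].
  apply/asboolP => n; have [m [<- <-]] := filter_ex (filterI (zP n) (zP n.+1)).
  by have /asboolP := valP (Y m); exact.
pose z : ipath L := exist _ zf z_ok; exists z => n.
have h : \forall m \near U, forall i : 'I_n.+1, iedge (Y m) i = zf i.
  by apply: filter_forall => i; exact: zP.
apply: filterS h => m h; apply/iprefix_eq; split; first by rewrite /irng (h ord0).
by move=> i ni; have := h (Ordinal (leqW ni)).
Qed.

(** Pairs violating the claim on longer and longer common prefixes converge along an ultrafilter to
    one and the same path, against continuity there. *)
Lemma uniformly_continuous_cylinder (R : realType) (g : ipath L -> R[i]) (e : R) :
  continuous (g : ipath L -> R[i]^o) -> 0 < e ->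
  exists n, forall y z, iprefix y n = iprefix z n -> normc (g y - g z) < e.
Proof.
move=> gc e0; apply: contrapT => nex.
have /choice[Y /choice[Z YZ]] : forall n, exists y, exists z,
    iprefix y n = iprefix z n /\ e <= normc (g y - g z).
  move=> n; apply: contrapT => nyz; apply: nex; exists n => y z yz.
  by rewrite ltNge; apply/negP => ge; apply: nyz; exists y, z.
have [U [UU sU]] := ultraFilterLemma eventually_filter.
have UF : ProperFilter U by exact: ultra_proper.
have [z zP] := ultra_limit Y UU.
have [n nP] := nbhs_cylinder (normc_lt_continuous (gc z) (divr_gt0 e0 (ltr0Sn _ 1))).
have /filter_ex[m [mz nm]] : \forall m \near U, iprefix (Y m) n = iprefix z n /\ (n <= m)%N.
  by apply: filterI; [exact: zP|apply: sU; exact: nbhs_infty_ge].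
have [/(iprefix_le nm) yz] := YZ m; apply/negP; rewrite -ltNge.
have h1 := nP _ mz; have h2 : normc (g z - g (Z m)) < e / 2 by apply: nP; rewrite -yz.
rewrite (_ : g (Y m) - g (Z m) = - (g z - g (Y m)) + (g z - g (Z m))); last by ring.
by apply: le_lt_trans (le_normcD _ _) _; rewrite normcN; lra.
Qed.

Lemma continuous_bounded (R : realType) (g : ipath L -> R[i]) :
  continuous (g : ipath L -> R[i]^o) -> exists C, forall y, normc (g y) <= C.
Proof.
move=> gc; have [n nP] := uniformly_continuous_cylinder gc ltr01.
have /choice[c cP] : forall p : bpath L, exists C, forall y, iprefix y n = p -> normc (g y) <= C.
  move=> p; have [[z zp]|nz] := pselect (exists z, iprefix z n = p); last first.
    by exists 0 => y yp; exfalso; apply: nz; exists y.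
  exists (normc (g z) + 1) => y yp.
  have -> : g y = g z + (g y - g z) by ring.
  apply: le_trans (le_normcD _ _) _; rewrite lerD2l; apply/ltW/nP.
  by rewrite yp zp.
exists (\sum_(p <- paths L n) `|c p|) => y.
have yn : iprefix y n \in paths L n by rewrite mem_paths plen_iprefix.
apply: le_trans (cP _ y erefl) _; rewrite (big_rem _ yn) /=.
by apply: le_trans (ler_norm _) _; rewrite lerDl sumr_ge0.
Qed.

End path_space.

(** * Integration of continuous functions over the path space *)

Section path_integral.
Variables (R : realType) (k : nat) (V : finType) (L : kgraph k V) (x0 : ipath L).
Variables (M : probability (borel_ipath x0) R) (mass : bpath L -> R).
Hypothesis massE : forall p, M (cylinder p) = (mass p)%:E.
Implicit Types (p : bpath L) (y z : ipath L) (g : ipath L -> R).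

Lemma measurable_cylinder p : measurable (cylinder p : set (borel_ipath x0)).
Proof. by apply: sub_sigma_algebra; exact: cylinder_open. Qed.

Lemma continuous_measurable g : continuous g ->
  measurable_fun setT (g : borel_ipath x0 -> R).
Proof.
move=> /continuousP gc; apply: (measurability _ (measurable_realfun.RGenOpens.measurableE R)) => //=.
move=> _ [_ [a [b ->]] <-]; rewrite setTI; apply: sub_sigma_algebra; apply: gc.
exact: interval_open.
Qed.

Lemma continuous_integrable g C : continuous g -> (forall y, `|g y| <= C) ->
  M.-integrable setT (EFin \o (g : borel_ipath x0 -> R)).
Proof.
move=> gc gC; apply: measurable_bounded_integrable => //.
- by rewrite (le_lt_trans (probability_le1 _ measurableT)) // ltry.
- exact: continuous_measurable.
- exists C; split; first exact: num_real.
  by move=> D CD y _; apply: le_trans (gC y) (ltW CD).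
Qed.

Lemma step_integral (c : bpath L -> R) (s : seq (bpath L)) :
  let h := fun y : borel_ipath x0 => \sum_(p <- s) c p * \1_(cylinder p) y in
  M.-integrable setT (EFin \o h) /\ \int[M]_y h y = \sum_(p <- s) c p * mass p.
Proof.
elim: s => [|p s [IHi IHe]] /=.
  have -> : (fun y : borel_ipath x0 => \sum_(p <- [::]) c p * \1_(cylinder p) y) = cst 0.
    by apply/funext => y; rewrite big_nil.
  rewrite big_nil Rintegral_cst // mul0r; split=> //.
  exact: finite_measure_integrable_cst.
have ind : M.-integrable setT (EFin \o (\1_(cylinder p) : borel_ipath x0 -> R)).
  by apply: integrable_indic; exact: measurable_cylinder.
have cind : M.-integrable setT (EFin \o (fun y : borel_ipath x0 => c p * \1_(cylinder p) y)).
  rewrite (_ : EFin \o _ = fun y => (c p)%:E * (EFin \o \1_(cylinder p)) y)%E.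
    exact: integrableZl.
  by apply/funext => y /=; rewrite EFinM.
have -> : (fun y : borel_ipath x0 => \sum_(q <- p :: s) c q * \1_(cylinder q) y) =
    (fun y => c p * \1_(cylinder p) y + \sum_(q <- s) c q * \1_(cylinder q) y).
  by apply/funext => y; rewrite big_cons.
split.
  rewrite (_ : EFin \o _ =
      (EFin \o (fun y : borel_ipath x0 => (c p * \1_(cylinder p) y)%R)) \+
      (EFin \o (fun y : borel_ipath x0 => \sum_(q <- s) (c q * \1_(cylinder q) y))%R))%E.
    exact: integrableD.
  by apply/funext => y /=; rewrite EFinD.
rewrite RintegralD // IHe big_cons RintegralZl //; congr (_ * _ + _).
rewrite /Rintegral.
have mp := measurable_cylinder p.
by rewrite integral_indic // setIT /= massE.
Qed.

(** Comparison with the step function that is [g (zeta p)] on each cylinder of length [n]; the total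
    mass is 1. *)
Lemma integral_approx g C e n (zeta : bpath L -> ipath L) :
  continuous g -> (forall y, `|g y| <= C) ->
  (forall y z, iprefix y n = iprefix z n -> `|g y - g z| <= e) ->
  (forall p, cylinder p (zeta p)) ->
  `|(\int[M]_y g y) - \sum_(p <- paths L n) g (zeta p) * mass p| <= e.
Proof.
move=> gc gC ge zP; have gi := continuous_integrable gc gC.
have [hi <-] := step_integral (g \o zeta) (paths L n).
set h := (fun y : borel_ipath x0 => _) in hi *.
have hE y : h y = g (zeta (iprefix y n)).
  rewrite /h (bigD1_seq (iprefix y n)) ?paths_uniq ?mem_paths ?plen_iprefix //=.
  rewrite big_seq_cond big1 ?addr0 => [|p /andP[]].
    by rewrite indicE mem_set ?mulr1 //= /cylinder /= plen_iprefix.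
  rewrite mem_paths => /eqP pn pne; rewrite indicE memNset ?mulr0 //.
  by rewrite /cylinder /= pn => yp; rewrite yp eqxx in pne.
have gh y : `|g y - h y| <= e.
  rewrite hE; apply: ge; have := zP (iprefix y n).
  by rewrite /cylinder /= plen_iprefix.
have ghi : M.-integrable setT (EFin \o (fun y : borel_ipath x0 => g y - h y)).
  rewrite (_ : EFin \o _ = (EFin \o (g : borel_ipath x0 -> R)) \- (EFin \o h))%E.
    exact: integrableB.
  by apply/funext => y /=; rewrite EFinB.
rewrite -RintegralB //; apply: le_trans (le_normr_Rintegral measurableT ghi) _.
have -> : e = \int[M]_(y in setT) cst e y.
  rewrite Rintegral_cst //.
  transitivity (e * fine (1%E : \bar R)); first by rewrite mulr1.
  congr (_ * fine _); exact/esym/(probability_setT M).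
apply: le_Rintegral => //.
  exact: integrable_norm.
exact: finite_measure_integrable_cst.
Qed.

End path_integral.

(** * Equidistribution of the points of a choice function *)

Lemma sum_below_cutoff (R : realType) (c : R) m N : 0 <= c ->
  \sum_(l < m) (if (l < N)%N then c else 0) <= N%:R * c.
Proof.
move=> c0; rewrite (_ : \sum_(l < m) _ = c *+ minn m N).
  by rewrite mulr_natl ler_wpMn2l // geq_minr.
elim: m => [|m IH]; first by rewrite big_ord0 min0n.
rewrite big_ord_recr /= IH; case: ltnP => mN.
  by rewrite (minn_idPl mN) mulrSr.
by rewrite addr0 (minn_idPr (leqW mN)).
Qed.

Section equidistribution.
Variables (R : realType) (k : nat) (V : finType) (L : kgraph k V) (x0 : ipath L).
Variables (M : probability (borel_ipath x0) R) (mass u : bpath L -> R) (Z alpha : R).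
Hypothesis massE : forall p, M (cylinder p) = (mass p)%:E.
Hypotheses (u_ge0 : forall p, 0 <= u p)
  (Z_bound : forall l, \sum_(q <- paths L l) u q <= Z).
Hypothesis u_mean : forall n p, plen p = (n * k)%N -> exists K, forall N,
  `|\sum_(l < N) \sum_(q <- paths L l | initial_segment p q) u q -
    N%:R * (alpha * mass p)| <= K.
Variable tau : bpath L -> ipath L * ipath L.
Hypotheses (tau1 : forall p, cylinder p (tau p).1) (tau2 : forall p, cylinder p (tau p).2).

Definition tau_level (g : ipath L -> R) l : R :=
  \sum_(q <- paths L l) (g (tau q).1 * u q + g (tau q).2 * u q).

Section observable.
Variables (g : ipath L -> R) (C e : R) (N : nat).
Hypotheses (gC : forall y, `|g y| <= C)
  (ge : forall y z, iprefix y N = iprefix z N -> `|g y - g z| <= e).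

Let C_ge0 : 0 <= C. Proof. exact: le_trans (gC x0). Qed.
Let Z_ge0 : 0 <= Z. Proof. by apply: le_trans (Z_bound 0); exact: sumr_ge0. Qed.
Let e_ge0 : 0 <= e. Proof. by have := ge (erefl (iprefix x0 N)); rewrite subrr normr0. Qed.

(** Both points of [tau q] are replaced by the sample point [(tau p).1] of the prefix [p] of length
    [N], whence the factor 2. *)
Definition cylinder_level l : R :=
  \sum_(p <- paths L N) \sum_(q <- paths L l | initial_segment p q) 2 * g (tau p).1 * u q.

Lemma tau_level_bound l : `|tau_level g l| <= 2 * C * Z.
Proof.
apply: le_trans (ler_norm_sum _ _ _) _.
apply: (@le_trans _ _ (\sum_(q <- paths L l) 2 * C * u q)); last first.
  by rewrite -mulr_sumr ler_wpM2l // mulr_ge0.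
apply: ler_sum => q _; rewrite -mulrDl normrM (ger0_norm (u_ge0 q)) ler_wpM2r //.
apply: le_trans (ler_normD _ _) _; rewrite mulr_natl mulr2n; exact: lerD.
Qed.

(** From level [N] on, the points of [tau q] share a prefix of length [N] with the sample point;
    before, [cylinder_level] is empty and the crude bound pays. *)
Lemma tau_level_approx l :
  `|tau_level g l - cylinder_level l| <= 2 * e * Z + (if (l < N)%N then 2 * C * Z else 0).
Proof.
have eZ : 0 <= 2 * e * Z by rewrite !mulr_ge0.
case: ltnP => [lN|Nl].
  rewrite /cylinder_level [X in _ - X]big_seq_cond big1 ?subr0 => [|p].
    by apply: le_trans (tau_level_bound l) _; rewrite lerDr.
  rewrite mem_paths andbT => /eqP pN; rewrite big_seq_cond big1 // => q.
  rewrite mem_paths => /andP[/eqP ql /initial_segment_size].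
  by rewrite ql pN leqNgt lN.
rewrite addr0 /tau_level (sum_paths_split _ Nl) /cylinder_level -sumrB.
apply: le_trans (ler_norm_sum _ _ _) _.
apply: (@le_trans _ _ (\sum_(p <- paths L N) \sum_(q <- paths L l | initial_segment p q) 2 * e * u q)).
  rewrite big_seq [leRHS]big_seq; apply: ler_sum => p; rewrite mem_paths => /eqP pN.
  rewrite -sumrB; apply: le_trans (ler_norm_sum _ _ _) _.
  rewrite big_seq_cond [leRHS]big_seq_cond; apply: ler_sum => q.
  rewrite mem_paths => /andP[/eqP ql pq].
  have h y : cylinder q y -> `|g y - g (tau p).1| <= e.
    move=> yq; apply: ge; have := tau1 p; rewrite /cylinder /= pN => ->.
    apply: (initial_segment_inj _ pq); last by rewrite plen_iprefix pN.
    by rewrite -yq ql; exact: initial_segment_iprefix.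
  rewrite -mulrDl -mulrBl normrM (ger0_norm (u_ge0 q)) ler_wpM2r //.
  have -> : g (tau q).1 + g (tau q).2 - 2 * g (tau p).1 =
    (g (tau q).1 - g (tau p).1) + (g (tau q).2 - g (tau p).1) by ring.
  by apply: le_trans (ler_normD _ _) _; rewrite mulr_natl mulr2n lerD ?h.
by rewrite -sum_paths_split // -mulr_sumr ler_wpM2l // mulr_ge0.
Qed.

End observable.

(** Sampling [g] on cylinders, inserting the mean mass of each cylinder, and passing from the
    Riemann sum [J] to the integral cost one error each. *)
Lemma tau_mean_limit (g : ipath L -> R) : continuous g ->
  mean_limit (fun n => \sum_(l < n) tau_level g l) (2 * alpha * \int[M]_y g y).
Proof.
move=> gc; have gCc : continuous (fun y => (g y)%:C : R[i]^o).
  move=> y; apply: (@cvg_complex _ _ (nbhs y)); first exact: (gc y).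
  exact: cvg_cst.
have [C gC'] := continuous_bounded gCc.
have gC y : `|g y| <= C by rewrite -normc_real.
have Z_ge0 : 0 <= Z by apply: le_trans (Z_bound 0); exact: sumr_ge0.
have C_ge0 : 0 <= C := le_trans (normr_ge0 _) (gC x0).
(* The factors of [e] come from sampling within a level and from the Riemann sum; the 1 keeps [D]
   positive. *)
move=> eps eps0; pose D := 2 * Z + 2 * `|alpha| + 1.
have D0 : 0 < D by rewrite /D ltr_wpDl // addr_ge0 // mulr_ge0.
pose e := eps / D; have e0 : 0 < e by rewrite divr_gt0.
have [n nP] := uniformly_continuous_cylinder gCc e0.
(* Mean masses are known below paths of length divisible by [k], so [n] is enlarged to such a
   length. *)
have k_gt0 := rank_gt0 L; pose N := (n * k)%N.
have ge y z : iprefix y N = iprefix z N -> `|g y - g z| <= e.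
  move=> yz; have := nP y z (iprefix_le (leq_pmulr n k_gt0) yz).
  by rewrite -(rmorphB (real_complex R)) normc_real => /ltW.
have intP := integral_approx massE gc gC ge tau1.
set I := \int[M]_y g y in intP *.
have /choice[K KP] : forall p : bpath L, exists K, plen p = N -> forall m,
    `|\sum_(l < m) \sum_(q <- paths L l | initial_segment p q) u q -
      m%:R * (alpha * mass p)| <= K.
  move=> p; have [pN|pN] := eqVneq (plen p) N; last by exists 0 => pN'; rewrite pN' eqxx in pN.
  by have [K KP] := u_mean pN; exists K.
pose J := \sum_(p <- paths L N) g (tau p).1 * mass p.
exists (N%:R * (2 * C * Z) + \sum_(p <- paths L N) 2 * C * `|K p|) => m.
have step1 : `|\sum_(l < m) tau_level g l - \sum_(l < m) cylinder_level g N l| <=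
    m%:R * (2 * e * Z) + N%:R * (2 * C * Z).
  rewrite -sumrB; apply: le_trans (ler_norm_sum _ _ _) _.
  apply: (@le_trans _ _ (\sum_(l < m) (2 * e * Z + (if (l < N)%N then 2 * C * Z else 0)))).
    by apply: ler_sum => l _; exact: tau_level_approx.
  rewrite big_split /= sumr_const card_ord -[_ *+ m]mulr_natl lerD2l.
  by apply: sum_below_cutoff; rewrite !mulr_ge0.
have step2 : `|\sum_(l < m) cylinder_level g N l - m%:R * (2 * alpha * J)| <=
    \sum_(p <- paths L N) 2 * C * `|K p|.
  rewrite /cylinder_level exchange_big /= /J !mulr_sumr -sumrB.
  apply: le_trans (ler_norm_sum _ _ _) _; rewrite big_seq [leRHS]big_seq.
  apply: ler_sum => p; rewrite mem_paths => /eqP pN.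
  under eq_bigr do rewrite -mulr_sumr; rewrite -mulr_sumr.
  set S := \sum_(l < m) _.
  have -> : 2 * g (tau p).1 * S - m%:R * (2 * alpha * (g (tau p).1 * mass p)) =
    2 * g (tau p).1 * (S - m%:R * (alpha * mass p)) by ring.
  rewrite !normrM ler_pM ?mulr_ge0 //; first by rewrite ger0_norm // ler_wpM2l.
  by apply: le_trans (KP p pN m) _; exact: ler_norm.
have step3 : `|m%:R * (2 * alpha * J) - m%:R * (2 * alpha * I)| <= m%:R * (2 * `|alpha| * e).
  rewrite -mulrBr -mulrBr !normrM ger0_norm // ler_wpM2l // ger0_norm //.
  by rewrite ler_wpM2l ?mulr_ge0 // distrC.
have De : e * D = eps by rewrite divfK // gt_eqF.
have -> : eps * m%:R = m%:R * (2 * e * Z) + m%:R * (2 * `|alpha| * e) + m%:R * e.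
  by rewrite -De /D; ring.
have me : 0 <= m%:R * e by rewrite mulr_ge0 // ltW.
rewrite (_ : \sum_(l < m) tau_level g l - _ =
  (\sum_(l < m) tau_level g l - \sum_(l < m) cylinder_level g N l) +
  (\sum_(l < m) cylinder_level g N l - m%:R * (2 * alpha * J)) +
  (m%:R * (2 * alpha * J) - m%:R * (2 * alpha * I))); last by ring.
apply: le_trans (ler_normD _ _) _; apply: le_trans (lerD (ler_normD _ _) (lexx _)) _.
by apply: le_trans (lerD (lerD step1 step2) step3) _; lra.
Qed.

End equidistribution.

(** * Growth of the weight and the residue *)

Section growth.
Variables (R : realType) (k : nat) (V : finType) (L : kgraph k V) (x : V -> R).
Hypotheses (x_gt0 : forall v, 0 < x v)
  (x_eigen : forall i v, \sum_w (adj L i v w)%:R * x w = rho R L i * x v).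
Variables (x0 : ipath L) (delta : R).
Hypotheses (delta_gt0 : 0 < delta) (w_weight : is_weight (w_delta L x delta)).
Local Notation rp := (rho_pow R L).
Local Notation w := (w_delta L x delta).

Let k_gt0 : (0 < k)%N := rank_gt0 L.
Let v0 : V := irng x0.

(** A zero would make the weight of a prefix of [x0] vanish, as [powR] sends 0 to 0 for the nonzero
    exponent [- delta^-1]. *)
Lemma rho_pow_gt0 n : 0 < rp n.
Proof.
have rp0 : 0 <= rp n.
  by apply: prodr_ge0 => i _; rewrite exprn_ge0 // (rho_ge0 x_gt0 x_eigen v0).
rewrite lt_neqAle rp0 andbT; apply/eqP => rpn; have [w0 _ _ _] := w_weight.
have := w0 (iprefix x0 n).
by rewrite /w_delta plen_iprefix -rpn powR0 ?mul0r ?ltxx // oppr_eq0 invr_eq0 gt_eqF.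
Qed.

Lemma x_bounds : exists2 c, 0 < c & forall v, c <= x v.
Proof.
exists (\sum_v (x v)^-1)^-1 => [|v].
  rewrite invr_gt0 (bigD1 v0) //= ltr_pwDl ?invr_gt0 // sumr_ge0 // => v _.
  by rewrite invr_ge0 ltW.
rewrite -[leRHS]invrK lef_pV2 ?posrE ?invr_gt0 //.
  by rewrite (bigD1 v) //= lerDl sumr_ge0 // => w _; rewrite invr_ge0 ltW.
rewrite (bigD1 v0) //= ltr_pwDl ?invr_gt0 // sumr_ge0 // => w _.
by rewrite invr_ge0 ltW.
Qed.

(** Otherwise the weights of the prefixes of [x0] of length divisible by [k] would stay above a
    positive lower bound of [x], although the weight tends to 0. *)
Lemma rho_pow_gt1 : 1 < rp k.
Proof.
rewrite ltNge; apply/negP => rk1; have [c c0 cx] := x_bounds.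
have [w0 _ w_lim _] := w_weight.
have wn n : w (iprefix x0 n) <= sup [set w p | p in [set p | plen p = n]].
  apply: ub_le_sup; last by exists (iprefix x0 n) => //=; rewrite plen_iprefix.
  exists (\sum_(p <- paths L n) w p) => _ [p /= pn <-].
  have pP : p \in paths L n by rewrite mem_paths pn.
  by rewrite (big_rem _ pP) /= lerDl sumr_ge0 // => q _; rewrite ltW.
have /cvgrPdist_lt/(_ _ c0)[n _ nP] := w_lim.
have := nP (n * k)%N (leq_pmulr n k_gt0); rewrite /= sub0r normrN.
move=> /(le_lt_trans (ler_norm _)) /(le_lt_trans (wn _)); apply/negP; rewrite -leNgt.
have r1 : 0 < rp (n * k) <= 1.
  rewrite rho_pow_gt0 -[(n * k)%N]addn0 rho_powDk rho_pow0 mulr1.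
  by rewrite exprn_ile1 // ltW // rho_pow_gt0.
rewrite /w_delta plen_iprefix; apply: le_trans (cx (psrc (iprefix x0 (n * k)))) _.
have /andP[r0 r1'] := r1.
have p1 : rp (n * k) `^ delta^-1 <= 1.
  have e1 : (1 : R) `^ delta^-1 = 1 by rewrite powR1.
  by rewrite -[leRHS]e1; apply: ge0_ler_powR; rewrite ?nnegrE ?invr_ge0 ?(ltW delta_gt0) ?(ltW r0).
by rewrite ler_peMl ?(ltW (x_gt0 _)) // powRN invf_ge1 // powR_gt0.
Qed.

(** The exponential rate per level: a period of [k] levels multiplies [rho_pow] by the product
    [rp k] of the spectral radii. *)
Definition growth_rate : R := ln (rp k) / k%:R.

Lemma growth_rate_gt0 : 0 < growth_rate.
Proof. by rewrite divr_gt0 ?ltr0n // ln_gt0 // rho_pow_gt1. Qed.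

(** The quotient of [rho_pow] by the exponential is positive and has period [k]; sums over a period
    stand in for its extrema. *)
Lemma rho_pow_bounds : exists c1 c2, [/\ 0 < c1, 0 < c2 &
  forall l, c1 * expR (growth_rate * l%:R) <= rp l <= c2 * expR (growth_rate * l%:R)].
Proof.
pose g l := rp l * expR (- (growth_rate * l%:R)).
have g_gt0 l : 0 < g l by rewrite mulr_gt0 ?rho_pow_gt0 // expR_gt0.
have gk n l : g (n * k + l)%N = g l.
  have rk : rp k ^+ n = expR (growth_rate * (n * k)%:R).
    rewrite -[rp k]lnK ?posrE ?rho_pow_gt0 // -expRM_natl natrM.
    by congr expR; rewrite /growth_rate; field; rewrite pnatr_eq0 -lt0n.
  rewrite /g rho_powDk rk natrD mulrDr opprD expRD.
  rewrite mulrACA -expRD subrr expR0 mul1r //.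
have gE l : g l = g (l %% k)%N by rewrite {1}(divn_eq l k) gk.
have rpE l : rp l = g l * expR (growth_rate * l%:R).
  by rewrite /g -mulrA -expRD addNr expR0 mulr1.
have inS (h : nat -> R) l : (forall i, 0 < h i) -> (forall i, h i = h (i %% k)%N) ->
    h l <= \sum_(t < k) h t.
  move=> h0 hE; rewrite hE (bigD1 (Ordinal (ltn_pmod l k_gt0))) //= lerDl.
  by apply: sumr_ge0 => t _; exact: ltW.
have sum_gt0 (h : nat -> R) : (forall i, 0 < h i) -> 0 < \sum_(t < k) h t.
  move=> h0; rewrite (bigD1 (Ordinal k_gt0)) //= ltr_pwDl // sumr_ge0 // => t _.
  exact: ltW.
have gV_gt0 i : 0 < (g i)^-1 by rewrite invr_gt0.
have sV_gt0 := sum_gt0 (fun t => (g t)^-1) gV_gt0.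
exists (\sum_(t < k) (g t)^-1)^-1, (\sum_(t < k) g t); split.
- by rewrite invr_gt0.
- exact: sum_gt0.
move=> l; rewrite {1 2}rpE !ler_pM2r ?expR_gt0 // inS // andbT.
rewrite -[leRHS]invrK lef_pV2 ?posrE //.
by apply: (inS (fun i => (g i)^-1)) => // i; rewrite gE.
Qed.

Definition weight_pow (p : bpath L) : R := (rp (plen p))^-1 * x (psrc p) `^ delta.

Lemma w_delta_pow p : w p `^ delta = weight_pow p.
Proof.
have r0 := rho_pow_gt0 (plen p).
rewrite /w_delta powRM ?powR_ge0 ?(ltW (x_gt0 _)) // -powRrM mulNr mulVf ?gt_eqF //.
by rewrite powRN powRr1 // ltW.
Qed.

Lemma weight_pow_bounds : exists b1 b2, [/\ 0 < b1, 0 < b2 & forall p,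
  b1 * expR (- (growth_rate * (plen p)%:R)) <= weight_pow p <=
  b2 * expR (- (growth_rate * (plen p)%:R))].
Proof.
have [c1 [c2 [c10 c20 cP]]] := rho_pow_bounds; have [a a0 ax] := x_bounds.
have x1 v : x v <= \sum_v x v.
  by rewrite (bigD1 v) //= lerDl sumr_ge0 // => i _; exact: ltW.
have X0 : 0 < \sum_v x v := lt_le_trans (x_gt0 v0) (x1 v0).
exists (c2^-1 * a `^ delta), (c1^-1 * (\sum_v x v) `^ delta); split.
- by rewrite mulr_gt0 ?invr_gt0 ?powR_gt0.
- by rewrite mulr_gt0 ?invr_gt0 ?powR_gt0.
move=> p; have /andP[h1 h2] := cP (plen p); have r0 := rho_pow_gt0 (plen p).
have d0 := ltW delta_gt0; have E := expR_gt0 (growth_rate * (plen p)%:R).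
rewrite /weight_pow expRN; apply/andP; split; rewrite mulrAC -invfM.
  rewrite ler_pM ?invr_ge0 ?powR_ge0 ?mulr_ge0 ?(ltW c20) ?(ltW E) //.
    by rewrite lef_pV2 ?posrE ?mulr_gt0.
  by apply: ge0_ler_powR; rewrite ?nnegrE ?(ltW delta_gt0) ?(ltW a0) ?(ltW X0) ?(ltW (x_gt0 _)).
rewrite ler_pM ?invr_ge0 ?powR_ge0 ?(ltW r0) //.
  by rewrite lef_pV2 ?posrE ?mulr_gt0.
by apply: ge0_ler_powR; rewrite ?nnegrE ?(ltW delta_gt0) ?(ltW a0) ?(ltW X0) ?(ltW (x_gt0 _)).
Qed.

Lemma sum_paths_perron l : \sum_(q <- paths L l) x (psrc q) = rp l * \sum_v x v.
Proof.
pose xv : 'cV[R]_#|V| := \col_a x (enum_val a).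
have xE q : x (psrc q) = at_source xv q by rewrite /at_source mxE enum_rankK.
rewrite (sum_paths_split _ (leq0n l)) /=.
under eq_bigr do under eq_bigr do rewrite xE.
rewrite big_map big_enum /= mulr_sumr; apply: eq_bigr => v _.
rewrite sum_extensions // /at_source (transfer_mx_perron x_eigen) mxE; congr (_ * _).
by rewrite mxE enum_rankK.
Qed.

Definition tau_index n : seq (bpath L * bool) := [seq (p, b) | p <- paths L n, b <- [:: true; false]].

Lemma tau_index_uniq n : uniq (tau_index n).
Proof. by apply: allpairs_uniq => //; [exact: paths_uniq|move=> [p b] [q c] _ _ [-> ->]]. Qed.

Lemma mem_tau_index n j : (j \in tau_index n) = (plen j.1 == n).
Proof.
case: j => p b /=; rewrite -mem_paths; apply/allpairsP/idP => [[[q c] /= [qn _ [-> _]]]//|pn].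
by exists (p, b); split=> //; case: b.
Qed.

Lemma sum_tau_index (F : bpath L * bool -> R) n :
  \sum_(j <- tau_index n) F j = \sum_(p <- paths L n) (F (p, true) + F (p, false)).
Proof.
by rewrite big_allpairs; apply: eq_bigr => p _; rewrite big_cons big_seq1.
Qed.

(** As [x] is bounded below, the paths of length [l] number at most a multiple of their total Perron
    mass, which is known exactly. *)
Lemma tau_index_count : exists2 K0, 0 < K0 & forall n,
  (size (below tau_index n))%:R <= K0 * expR (growth_rate * n%:R).
Proof.
have [c1 [c2 [c10 c20 cP]]] := rho_pow_bounds; have [a a0 ax] := x_bounds.
have X0 : 0 < \sum_v x v.
  by rewrite (bigD1 v0) //= ltr_pwDl // sumr_ge0 // => v _; exact: ltW.
set X := \sum_v x v in X0; pose E := expR growth_rate.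
have E1 : 1 < E by rewrite expR_gt1 growth_rate_gt0.
have En n : expR (growth_rate * n%:R) = E ^+ n by rewrite expRM_natr.
pose c := 2 * (c2 * X / a).
have c0 : 0 < c by rewrite mulr_gt0 // divr_gt0 // mulr_gt0.
have level l : (size (tau_index l))%:R <= c * E ^+ l.
  rewrite size_allpairs natrM mulrC /c -mulrA ler_pM2l //.
  rewrite mulrAC ler_pdivlMr //; apply: (@le_trans _ _ (\sum_(q <- paths L l) x (psrc q))).
    by rewrite mulr_natl -sumr_const_seq ler_sum.
  rewrite sum_paths_perron mulrAC ler_pM2r //.
  by have /andP[_] := cP l; rewrite En.
(* The solution of [K0 * E = K0 + c], which makes the induction close without loss. *)
exists (c / (E - 1)) => [|n]; first by rewrite divr_gt0 // subr_gt0.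
rewrite En; elim: n => [|n IH].
  by rewrite mulr_ge0 // divr_ge0 ?(ltW c0) // subr_ge0 ltW.
rewrite belowS size_cat natrD; apply: le_trans (lerD IH (level n)) _.
rewrite exprS; have -> : c / (E - 1) * (E * E ^+ n) = c / (E - 1) * E ^+ n + c * E ^+ n.
  by field; rewrite subr_eq0 gt_eqF.
by [].
Qed.

End growth.

Section lipschitz_parts.
Variable R : realType.
Implicit Types z t : R[i].

(** A common frame for the real and imaginary parts and their positive and negative parts. *)
Definition lipschitz_part (phi : R[i] -> R) : Prop :=
  forall z t, `|phi z - phi t| <= normc (z - t).

Lemma max0_lipschitz (a b : R) : `|Num.max a 0 - Num.max b 0| <= `|a - b|.
Proof.
have := ler_norm (a - b); have := ler_norm (- (a - b)); rewrite normrN.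
by case: (leP a 0) => ?; case: (leP b 0) => ? ? ?; rewrite ler_norml; apply/andP; split; lra.
Qed.

Lemma lipschitz_part_max (phi : R[i] -> R) :
  lipschitz_part phi -> lipschitz_part (fun z => Num.max (phi z) 0).
Proof. by move=> h z t; apply: le_trans (max0_lipschitz _ _) (h z t). Qed.

Lemma lipschitz_part_opp (phi : R[i] -> R) :
  lipschitz_part phi -> lipschitz_part (fun z => - phi z).
Proof. by move=> h z t; rewrite opprK addrC distrC. Qed.

Lemma lipschitz_Re : lipschitz_part (@complex.Re R).
Proof. by move=> z t; rewrite -raddfB Re_le_normc. Qed.

Lemma lipschitz_Im : lipschitz_part (@complex.Im R).
Proof. by move=> z t; rewrite -raddfB Im_le_normc. Qed.

Lemma lipschitz_part_continuous (X : topologicalType) (f : X -> R[i]) (phi : R[i] -> R) :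
  lipschitz_part phi -> continuous (f : X -> R[i]^o) -> continuous (phi \o f).
Proof.
move=> h fc y; apply/cvgrPdist_lt => e e0.
apply: filterS (normc_lt_continuous (fc y) e0) => z; exact: le_lt_trans (h _ _).
Qed.

End lipschitz_parts.

(** * Traces of the multipliers attached to a choice function *)

Section spectral_triple.
Variables (R : realType) (k : nat) (V : finType) (L : kgraph k V) (x : V -> R).
Variables (x0 : ipath L) (M : probability (borel_ipath x0) R) (delta : R).
Hypotheses (irr : irreducible_mx (\prod_(i < k) adjmx R L i)).
Hypotheses (x_perron : is_perron_vector L x) (M_path : is_path_measure x M).
Hypotheses (delta_gt0 : 0 < delta) (w_weight : is_weight (w_delta L x delta)).
Variable tau : bpath L -> ipath L * ipath L.
Hypotheses (tau1 : forall p, cylinder p (tau p).1) (tau2 : forall p, cylinder p (tau p).2).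

Let u (j : bpath L * bool) : R := weight_pow x delta j.1.
Let th : R := growth_rate R L.

Definition at_tau (T : Type) (f : ipath L -> T) (j : bpath L * bool) : T :=
  f (if j.2 then (tau j.1).1 else (tau j.1).2).

(** The constant precedes [f], so that the case [f = 1] can later identify it as the trace without
    [f]. *)
Lemma tau_residue : exists res : R, forall f : ipath L -> R[i],
  continuous (f : ipath L -> R[i]^o) ->
  [/\ has_dixmier_trace (mulop (fun j => at_tau f j * (u j)%:C)) (res%:C * cintegral M f),
      (forall s, 1 < s -> trace_class (mulop (fun j => at_tau f j * (u j)%:C * (u j `^ (s - 1))%:C)))
    & (fun s : R => (s - 1)%:C *
         op_trace (mulop (fun j => at_tau f j * (u j)%:C * (u j `^ (s - 1))%:C)) : R[i]^o)
       @ 1^'+ --> (res%:C * cintegral M f : R[i]^o)].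
Proof.
have [x_gt0 _ x_eigen] := x_perron.
have rp_gt0 := rho_pow_gt0 x_gt0 x_eigen x0 delta_gt0 w_weight.
pose phi : 'cV[R]_#|V| := \col_a x (enum_val a) `^ delta.
have phi_ge0 a : 0 <= phi a 0 by rewrite mxE powR_ge0.
have [alpha aP] := cylinder_mean x_gt0 x_eigen rp_gt0 irr phi_ge0.
have [b1 [b2 [b1_gt0 b2_gt0 bP]]] := weight_pow_bounds x_gt0 x_eigen x0 delta_gt0 w_weight.
have [K0 K0_gt0 count] := tau_index_count x_gt0 x_eigen x0 delta_gt0 w_weight.
have th_gt0 : 0 < th := growth_rate_gt0 x_gt0 x_eigen x0 delta_gt0 w_weight.
have u_ge j : b1 * expR (- (th * (plen j.1)%:R)) <= u j by have /andP[] := bP j.1.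
have u_le j : u j <= b2 * expR (- (th * (plen j.1)%:R)) by have /andP[] := bP j.1.
have u0 j : 0 < u j := u_gt0 b1_gt0 u_ge j.
have [Z Z0 ZP] := level_sum_bound (@mem_tau_index _ _ L) b2_gt0 K0_gt0 u_le count.
have Z_bound l : \sum_(q <- paths L l) weight_pow x delta q <= Z.
  apply: le_trans (ZP l); rewrite sum_tau_index; apply: ler_sum => q _.
  by rewrite lerDl; exact: ltW (u0 (q, false)).
have u_mean n p : plen p = (n * k)%N -> exists K, forall N,
    `|\sum_(l < N) \sum_(q <- paths L l | initial_segment p q) weight_pow x delta q -
      N%:R * (alpha * ((rho_pow R L (plen p))^-1 * x (psrc p)))| <= K.
  move=> pn; have [K KP] := aP n p pn; exists K => N; apply: le_trans (KP N).
  rewrite le_eqVlt; apply/orP; left; apply/eqP; congr (`|_ - _|).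
  apply: eq_bigr => l _; rewrite big_seq_cond [RHS]big_seq_cond; apply: eq_bigr => q.
  rewrite mem_paths => /andP[/eqP ql _].
  by rewrite /weight_pow ql /at_source mxE enum_rankK.
have mean g := tau_mean_limit M_path (fun q => ltW (u0 (q, true))) Z_bound u_mean tau1 tau2 (g := g).
(* Two coordinates, a mean mass [alpha] per level, and [1 / th] levels per unit of [ln n]. *)
exists (2 * alpha / th) => f fc.
have [C fC] := continuous_bounded fc.
have mC j : normc (at_tau f j * (u j)%:C) <= C * u j.
  by rewrite normcM normc_real (ger0_norm (ltW (u0 j))) ler_wpM2r ?(ltW (u0 j)) ?fC.
have part_mean (psi : R[i] -> R) : lipschitz_part psi ->
    (forall z (t : R), psi (z * t%:C) = psi z * t) ->
    mean_limit (fun n => \sum_(j <- below (@tau_index _ _ L) n)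
       Num.max (psi (at_tau f j * (u j)%:C)) 0)
     (2 * alpha * \int[M]_y Num.max (psi (f y)) 0).
  move=> psi_lip psiM.
  have gc := lipschitz_part_continuous (lipschitz_part_max psi_lip) fc.
  move=> e e0; have [K KP] := mean _ gc e e0; exists K => n; apply: le_trans (KP n).
  rewrite le_eqVlt; apply/orP; left; apply/eqP; congr (`|_ - _|).
  rewrite sum_below; apply: eq_bigr => l _; rewrite sum_tau_index; apply: eq_bigr => q _.
  by rewrite /at_tau !psiM /= !maxr_pMl ?mul0r // ltW // (u0 (q, true)).
have ReM z (t : R) : complex.Re (z * t%:C) = complex.Re z * t.
  by case: z => a b /=; rewrite mulr0 subr0.
have ImM z (t : R) : complex.Im (z * t%:C) = complex.Im z * t.
  by case: z => a b /=; rewrite mulr0 add0r.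
have opM (psi : R[i] -> R) : (forall z (t : R), psi (z * t%:C) = psi z * t) ->
    forall z (t : R), - psi (z * t%:C) = - psi z * t.
  by move=> h z t; rewrite h mulNr.
have ml1 := part_mean _ (@lipschitz_Re R) ReM.
have ml2 := part_mean _ (lipschitz_part_opp (@lipschitz_Re R)) (opM _ ReM).
have ml3 := part_mean _ (@lipschitz_Im R) ImM.
have ml4 := part_mean _ (lipschitz_part_opp (@lipschitz_Im R)) (opM _ ImM).
have int_parts (psi : R[i] -> R) : lipschitz_part psi -> (forall y, `|psi (f y)| <= C) ->
    (\int[M]_y Num.max (psi (f y)) 0) - (\int[M]_y Num.max (- psi (f y)) 0) =
    \int[M]_y psi (f y).
  move=> psi_lip psiC.
  have bd (t : R) : `|t| <= C -> `|Num.max t 0| <= C.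
    by move=> tC; apply: le_trans tC; have := max0_lipschitz t 0; rewrite maxxx !subr0.
  have int1 := continuous_integrable M
    (lipschitz_part_continuous (lipschitz_part_max psi_lip) fc) (fun y => bd _ (psiC y)).
  have int2 := continuous_integrable M
    (lipschitz_part_continuous (lipschitz_part_max (lipschitz_part_opp psi_lip)) fc)
    (fun y => bd _ (etrans (congr1 (fun t => t <= C) (normrN _)) (psiC y))).
  rewrite -RintegralB //; apply: eq_Rintegral => y _ /=.
  by case: (leP 0 (psi (f y))) => [h|/ltW h];
    [rewrite (max_idPr _)|rewrite (max_idPl _)];
    rewrite ?oppr_le0 ?oppr_ge0 ?subr0 ?sub0r ?opprK.
have iRe := int_parts _ (@lipschitz_Re R) (fun y => le_trans (Re_le_normc _) (fC y)).
have iIm := int_parts _ (@lipschitz_Im R) (fun y => le_trans (Im_le_normc _) (fC y)).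
have valE : (2 * alpha / th)%:C * cintegral M f =
    ((2 * alpha * (\int[M]_y Num.max (complex.Re (f y)) 0) -
      2 * alpha * (\int[M]_y Num.max (- complex.Re (f y)) 0)) / th)
    +i* ((2 * alpha * (\int[M]_y Num.max (complex.Im (f y)) 0) -
      2 * alpha * (\int[M]_y Num.max (- complex.Im (f y)) 0)) / th).
  rewrite -!mulrBr iRe iIm /cintegral; simpc; congr (_ +i* _); exact: mulrAC.
rewrite valE; split.
- exact: (has_dixmier_trace_mulop (@tau_index_uniq _ _ L) (@mem_tau_index _ _ L)
    th_gt0 b1_gt0 b2_gt0 K0_gt0 u_ge u_le count mC ml1 ml2 ml3 ml4).
- move=> s; rewrite -subr_gt0 => s1.
  exact: (power_trace_class (@mem_tau_index _ _ L)
    th_gt0 b1_gt0 b2_gt0 K0_gt0 u_ge u_le count s1 mC).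
- exact: (op_trace_residue (@tau_index_uniq _ _ L) (@mem_tau_index _ _ L)
    th_gt0 b1_gt0 b2_gt0 u_ge u_le mC ml1 ml2 ml3 ml4).
Qed.

End spectral_triple.

(** Weights decrease along paths, and those of the vertices sum to at most 1. *)
Lemma weight_le1 (R : realType) (k : nat) (V : finType) (L : kgraph k V)
    (w : bpath L -> R) : is_weight w -> forall p, w p <= 1.
Proof.
move=> [w0 w1 _ w_decr] p; apply: (@le_trans _ _ (w (vpath L (prng p)))).
  have [<-//|ne] := eqVneq (vpath L (prng p)) p.
  by apply/ltW/w_decr => //; rewrite /initial_segment eqxx prefix0s.
apply: le_trans w1; rewrite (bigD1 (prng p)) //= lerDl sumr_ge0 // => v _.
exact: ltW.
Qed.

Theorem theorem3p28 (R : realType) (k : nat) (V : finType) (L : kgraph k V)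
    (x : V -> R) (x0 : ipath L) (M : probability (borel_ipath x0) R)
    (delta : R) (tau : bpath L -> ipath L * ipath L) (f : ipath L -> R[i])
    (w := w_delta L x delta) :
  kg_finite L ->
  kg_strongly_connected L ->
  irreducible_mx (\prod_(i < k) adjmx R L i) ->
  is_perron_vector L x ->
  is_path_measure x M ->
  0 < delta < 1 ->
  is_weight w ->
  (forall p : bpath L, w p = diam w p) ->
  is_choice w tau ->
  continuous (f : ipath L -> R[i]^o) ->
  exists c : R[i],
    [/\ has_dixmier_trace (absD_negpow w delta) c,
        has_dixmier_trace (pi_tau tau f \o absD_negpow w delta)
          (c * cintegral M f),
        (fun s : R => (s - 1)%:C *
           op_trace (absD_negpow w (delta * s)) : R[i]^o)
          @ 1^'+ --> (c : R[i]^o),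
        forall s : R, 1 < s ->
          trace_class (pi_tau tau f \o absD_negpow w (delta * s))
      & (fun s : R => (s - 1)%:C *
           op_trace (pi_tau tau f \o absD_negpow w (delta * s)) : R[i]^o)
          @ 1^'+ --> (c * cintegral M f : R[i]^o)].
Proof.
move=> _ _ irr x_perron M_path /andP[delta_gt0 _] w_weight w_diam tau_ok fc.
have tau1 p : cylinder p (tau p).1 by have [] := tau_ok p.
have tau2 p : cylinder p (tau p).2 by have [] := tau_ok p.
have [res resP] := tau_residue irr x_perron M_path delta_gt0 w_weight tau1 tau2.
have [x_gt0 _ x_eigen] := x_perron.
pose u (j : bpath L * bool) : R := weight_pow x delta j.1.
have u_gt0 j : 0 < u j.
  rewrite mulr_gt0 ?invr_gt0 ?powR_gt0 //.
  exact: (rho_pow_gt0 x_gt0 x_eigen x0 delta_gt0 w_weight).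
(* Since [u] is the power [delta] of the diameter, the left side is the power [s] of [u], split as
   [1 + (s - 1)]. *)
have diam_pow j s : diam w j.1 `^ (delta * s) = u j * u j `^ (s - 1).
  rewrite -w_diam powRrM (w_delta_pow x_gt0 x_eigen x0 delta_gt0 w_weight) -/(u j).
  have un0 : u j != 0 by rewrite gt_eqF.
  by rewrite -[X in _ = X * _]powRr1 ?(ltW (u_gt0 j)) // -powRD ?un0 ?implybT // addrC subrK.
have diam_pow1 j : diam w j.1 `^ delta = u j.
  by rewrite -[delta in LHS]mulr1 diam_pow subrr powRr0 mulr1.
have diam_le1 s (j : bpath L * bool) : 0 <= s -> normc (diam w j.1 `^ s)%:C <= 1.
  move=> s0; rewrite normc_real ger0_norm ?powR_ge0 // -w_diam.
  have [w0 _ _ _] := w_weight; have e1 : (1 : R) `^ s = 1 by rewrite powR1.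
  rewrite -[leRHS]e1; apply: ge0_ler_powR; rewrite ?nnegrE ?(ltW (w0 _)) //.
  exact: weight_le1.
have [C fC] := continuous_bounded fc.
have absDE s : absD_negpow w (delta * s) =
    mulop (fun j : bpath L * bool => at_tau tau (fun=> 1 : R[i]) j * (u j)%:C * (u j `^ (s - 1))%:C).
  congr mulop; apply/funext => j; rewrite diam_pow rmorphM /at_tau.
  by case: j.2; rewrite mul1r.
have absD1 : absD_negpow w delta =
    mulop (fun j : bpath L * bool => at_tau tau (fun=> 1 : R[i]) j * (u j)%:C).
  by congr mulop; apply/funext => j; rewrite diam_pow1 /at_tau; case: j.2; rewrite mul1r.
have tauC j : normc (at_tau tau f j) <= C by exact: fC.
have piE s : 0 <= s -> pi_tau tau f \o absD_negpow w (delta * s) =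
    mulop (fun j => at_tau tau f j * (u j)%:C * (u j `^ (s - 1))%:C).
  move=> s0; rewrite /pi_tau /absD_negpow (mulop_comp (C := C) (C' := 1)).
  - congr mulop; apply/funext => j; rewrite diam_pow rmorphM -mulrA.
    by congr (_ * _); rewrite /at_tau.
  - exact: tauC.
  - by move=> j; rewrite diam_le1 // mulr_ge0 // ltW.
have pi1 : pi_tau tau f \o absD_negpow w delta = mulop (fun j => at_tau tau f j * (u j)%:C).
  rewrite /pi_tau /absD_negpow (mulop_comp (C := C) (C' := 1)).
  - by congr mulop; apply/funext => j; rewrite diam_pow1.
  - exact: tauC.
  - by move=> j; rewrite diam_le1 // ltW.
have int1 : cintegral M (fun=> 1) = 1.
  rewrite /cintegral /= !Rintegral_cst // mul0r mul1r.
  congr (_ +i* _); exact: (congr1 fine (probability_setT M)).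
have c1 : continuous ((fun=> 1) : ipath L -> R[i]^o) by exact: cst_continuous.
have [trD _ resD] := resP _ c1; rewrite int1 mulr1 in trD resD.
have [tr_f trc_f res_f] := resP _ fc.
exists res%:C; split.
- by rewrite absD1.
- by rewrite pi1.
- by under eq_fun do rewrite absDE.
- move=> s s1; have := trc_f s s1; rewrite -piE //.
  exact: ltW (lt_trans ltr01 s1).
(* The composite is identified with a single multiplier for nonnegative [s], where both factors are
   bounded; this covers the right of 1. *)
- move=> A /res_f; apply: filterS2 (nbhs_right_gt 1) => s s1 /=.
  by rewrite -piE // (ltW (lt_trans ltr01 s1)).
Qed.
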